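(* Let $G$ be a finitely generated group and $\mathcal{A}$ a family of subgroups of $G$ closed under conjugation and under taking subgroups. If the compatibility JSJ deformation space $\mathcal{D}_{\mathrm{co}}$ of $G$ over $\mathcal{A}$ exists and is irreducible, then it contains a canonical tree $T_{\mathrm{co}}$; that is, $T_{\mathrm{co}}=T_{\mathrm{co}}(G,\mathcal{A})\in\mathcal{D}_{\mathrm{co}}$ can be chosen for all such pairs $(G,\mathcal{A})$ in such a way that any group isomorphism $\alpha:G\to G'$ sending $\mathcal{A}$ to $\mathcal{A}'$ yields a unique $\alpha$-equivariant isomorphism of trees $T_{\mathrm{co}}(G,\mathcal{A})\to T_{\mathrm{co}}(G',\mathcal{A}')$. In particular, if $\mathcal{A}$ is invariant under automorphisms of $G$, so is $T_{\mathrm{co}}$.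
   Context: A tree is a simplicial tree $T$ with an action of $G$ by simplicial automorphisms, without inversions, minimal (no proper $G$-invariant subtree; the one-point tree is allowed), and with no redundant vertex (a valence 2 vertex is the unique fixed point of some element of $G$). An $\mathcal{A}$-tree is a tree whose edge stabilizers all belong to $\mathcal{A}$. A tree $T$ dominates a tree $T'$ if there is a $G$-equivariant map $T\to T'$. The deformation space of $T$ is the set of all trees $T'$ such that $T$ and $T'$ dominate each other. A tree is irreducible if $G$ acts on it with no fixed point, no fixed end, and no invariant line; a deformation space is irreducible if some (equivalently every) tree in it is irreducible. A collapse map is a $G$-equivariant map obtained by collapsing certain edges to points (followed by an isomorphism). Two trees are compatible if there is a tree with collapse maps onto both. An $\mathcal{A}$-tree is universally compatible if it is compatible with every $\mathcal{A}$-tree. The compatibility JSJ deformation space $\mathcal{D}_{\mathrm{co}}$ is, if it exists, the (unique) deformation space of $\mathcal{A}$-trees which is maximal for domination among deformation spaces containing a universally compatible $\mathcal{A}$-tree. For an isomorphism $\alpha:G\to G'$, a map $f$ from a $G$-tree to a $G'$-tree is $\alpha$-equivariant if $f(gx)=\alpha(g)f(x)$. A tree $T$ is invariant under $\alpha\in\mathrm{Aut}(G)$ if there is an $\alpha$-equivariant isomorphism $T\to T$. *)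

(* Defs.v *)
From HB Require Import structures.
From mathcomp Require Export all_boot ssralg ssrint.
From mathcomp Require Export boolp classical_sets.

Set Implicit Arguments.
Unset Strict Implicit.
Unset Printing Implicit Defensive.

Local Open Scope classical_set_scope.
Local Open Scope group_scope.

Section Groups.
Variable G : groupType.

Definition subgroup (H : set G) : Prop :=
  [/\ H 1, forall x y, H x -> H y -> H (x * y) & forall x, H x -> H x^-1].

Definition finitely_generated : Prop :=
  exists s : seq G,
    forall H : set G, subgroup H -> [set` s] `<=` H -> H = setT.

Definition admissible_family (A : set (set G)) : Prop :=
  [/\ A `<=` subgroup,
      forall H (g : G), A H -> A [set h ^ g | h in H] &
      forall H K, A H -> subgroup K -> K `<=` H -> A K].

End Groups.

Section Graphs.
Variables (V : choiceType) (adj : rel V).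

Definition connected (S : set V) : Prop :=
  forall x y, S x -> S y ->
    exists p, [/\ path adj x p, last x p = y & [set` p] `<=` S].

(* A simplicial tree is recorded by its vertices and its adjacency relation. *)
Definition simplicial_tree : Prop :=
  [/\ [set: V] !=set0, symmetric adj, irreflexive adj, connected setT &
      forall c, ucycle adj c -> (size c <= 2)%N].

Definition valence2 (x : V) : Prop :=
  exists y z, y != z /\ forall w, adj x w = (w == y) || (w == z).

End Graphs.

(* Since there are no inversions, a group element fixing a point of the
   geometric realization fixes a vertex, and it fixes some point other than the
   vertex [x] only if it fixes a vertex other than [x]; fixed points are
   therefore looked for among the vertices. *)
Record gtree (G : groupType) := GTree {
  vertex :> choiceType;
  adj : rel vertex;
  act : G -> vertex -> vertex;
  gtree_tree : simplicial_tree adj;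
  gtree_act1 : forall x, act 1 x = x;
  gtree_actM : forall g h x, act (g * h) x = act g (act h x);
  gtree_act_adj : forall g x y, adj (act g x) (act g y) = adj x y;
  gtree_noinv : forall g x y, adj x y -> ~ (act g x = y /\ act g y = x);
  gtree_minimal : forall S : set vertex,
    S !=set0 -> connected adj S -> (forall g x, S x -> S (act g x)) -> S = setT;
  gtree_nonredundant : forall x, valence2 adj x ->
    exists g, forall y, act g y = y <-> y = x
}.
Arguments adj {G} T : rename.
Arguments act {G} T : rename.

Definition equivariant (G G' : groupType) (alpha : G -> G')
    (T : gtree G) (T' : gtree G') (f : T -> T') : Prop :=
  forall g x, f (act T g x) = act T' (alpha g) (f x).

Definition equivariant_iso (G G' : groupType) (alpha : G -> G')
    (T : gtree G) (T' : gtree G') (f : T -> T') : Prop :=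
  [/\ bijective f, forall x y, adj T' (f x) (f y) = adj T x y &
      equivariant alpha f].

Definition invariant_under (G : groupType) (alpha : G -> G) (T : gtree G) :=
  exists f : T -> T, equivariant_iso alpha f.

Definition family_image (G G' : groupType) (alpha : G -> G')
    (A : set (set G)) : set (set G') :=
  [set alpha @` H | H in A].

Section Trees.
Variable G : groupType.
Implicit Types (A : set (set G)) (T S : gtree G) (D : gtree G -> Prop).

(* The stabilizer of an edge fixes both its ends, as there are no inversions. *)
Definition edge_stabilizer T (x y : T) : set G :=
  [set g | act T g x = x /\ act T g y = y].

Definition A_tree A T : Prop :=
  forall x y, adj T x y -> A (edge_stabilizer x y).

(* Maps between trees send vertices to vertices and edges to edge paths, hence
   are determined by their restriction to vertices, which is arbitrary. *)
Definition dominates T T' : Prop :=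
  exists f : T -> T', equivariant idfun f.

Definition deformation_space T T' : Prop := dominates T T' /\ dominates T' T.

(* Classes of trees are predicates [gtree G -> Prop]: [gtree G] lives in a
   universe that is too large for [set]. *)
Definition A_deformation_space A D : Prop :=
  exists2 T, A_tree A T &
    D = fun T' => deformation_space T T' /\ A_tree A T'.

Definition space_dominates D D' : Prop :=
  forall T T', D T -> D' T' -> dominates T T'.

Definition fixed_point T : Prop := exists x : T, forall g, act T g x = x.

Definition ray T (r : nat -> T) : Prop :=
  injective r /\ forall n, adj T (r n) (r n.+1).

Definition same_end T (r s : nat -> T) : Prop :=
  exists m n, forall k, r (m + k)%N = s (n + k)%N.

Definition fixed_end T : Prop :=
  exists2 r : nat -> T, ray r & forall g, same_end (act T g \o r) r.

Definition line T (l : int -> T) : Prop :=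
  injective l /\ forall i, adj T (l i) (l (i + 1)%R).

Definition invariant_line T : Prop :=
  exists2 l : int -> T, line l & forall g, act T g @` range l = range l.

Definition irreducible T : Prop :=
  [/\ ~ fixed_point T, ~ fixed_end T & ~ invariant_line T].

Definition irreducible_space D : Prop := exists2 T, D T & irreducible T.

(* [E] is the set of collapsed edges: the vertices of [T'] are identified with
   the components of the subgraph spanned by [E], its edges with the edges of
   [T] outside [E]. *)
Definition collapse_map T T' (f : T -> T') : Prop :=
  equivariant idfun f /\
  exists E : rel T,
    [/\ symmetric E, subrel E (adj T) &
        forall g x y, E (act T g x) (act T g y) = E x y] /\
    [/\ forall u, exists x, f x = u,
        forall x y, f x = f y <-> exists2 p, path E x p & last x p = y &
        forall u v, adj T' u v <->
          exists x y, [/\ f x = u, f y = v, adj T x y & ~~ E x y]].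

Definition compatible T1 T2 : Prop :=
  exists T (f1 : T -> T1) (f2 : T -> T2), collapse_map f1 /\ collapse_map f2.

Definition universally_compatible A T : Prop :=
  A_tree A T /\ forall S, A_tree A S -> compatible T S.

Definition universally_compatible_space A D : Prop :=
  A_deformation_space A D /\ exists2 T, D T & universally_compatible A T.

Definition compatibility_JSJ_space A D : Prop :=
  universally_compatible_space A D /\
  forall D', universally_compatible_space A D' ->
    space_dominates D' D -> D' = D.

End Trees.

(* Main.v *)
(* Two universally compatible trees have a least common refinement (lcm).  It is
   unique up to isomorphism: a vertex of valence at least 3 is the median of
   three points far away in distinct branches, equivariant maps between
   cocompact trees are at bounded distance from each other, and medians do not
   see bounded perturbations.  Hence the lcm is again universally compatible,
   and collapse maps onto a tree without global fixed point are unique.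

   Among the universally compatible trees of the space, take those without
   collapsible edge, an edge [(w, u)] being collapsible if its stabilizer is
   that of [w], if no other edge at [w] has this property, and if [u] is not in
   the orbit of [w].  A tree with the fewest orbits of edges is of this kind.
   The class is stable under lcm, because a universally compatible irreducible
   tree contains no strictly ascending loop [(v, tv)]: otherwise, sliding another
   edge at [v] twice around this loop would give an incompatible tree.  Moreover
   the trees of the class that refine a given one have a bounded number of
   orbits of edges: collapsing onto the given tree turns the fibers into rooted
   trees, each new vertex of which carries at least three orbits of edges.  So
   the class has a greatest element for refinement, which is the canonical
   tree. *)

(* In the definition of a collapsible edge [(w, u)], the clause on the other edges at [w] avoids an
   arbitrary choice: a vertex with two such edges may offer two collapses with no canonical choice
   between them. Such vertices are kept, and the count tolerates them: the edge towards the root, a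
   second edge fixed by the stabilizer and, by non-redundancy, a third one give the three orbits.
   The same clause lets the property pass to the image under a collapse map, whence the stability
   under lcm.

   The edge is slid twice because of an order on the axis of [t]. In a common refinement, compare
   the branch carried by the slid edge with a branch leaving the axis at [tv] in both trees. The
   former leaves at [v] before the slide; after one slide both would leave at [tv], which
   contradicts nothing, while after two slides the order is reversed. If there is no other edge to
   slide, the group fixes an end, against irreducibility.

   The trees are chosen independently for each pair: the characterizing property is transported
   along isomorphisms and determines the tree up to isomorphism, and uniqueness of collapse maps
   makes the isomorphism unique. *)
From mathcomp Require Import zify.
Require Import Defs.

Set Implicit Arguments.
Unset Strict Implicit.
Unset Printing Implicit Defensive.

Local Open Scope classical_set_scope.
Local Open Scope group_scope.

(** * Distances, medians and convexity in simplicial trees *)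

Section Dist.
Variables (V : choiceType) (e : rel V).

Definition reach (x y : V) (n : nat) :=
  `[< exists p, [/\ path e x p, last x p = y & size p = n] >].

(** The value 0 for points joined by no path is a default that never occurs in a tree. [reach] is
    boolean for the sake of [ex_minn]. *)
Definition dist (x y : V) : nat :=
  if pselect (exists n, reach x y n) is left P then ex_minn P else 0%N.

Definition btw x z y := (dist x z + dist z y = dist x y)%N.
Definition convex (S : set V) := forall x y z, S x -> S y -> btw x z y -> S z.
Definition side x y : set V := [set z | (dist z y < dist z x)%N].
(** Certificate that an edge is a bridge: the oriented edge [(x, y)] is the only way into [X]. A
    tree provides it for [side x y]; conversely a graph with such a set for each edge is acyclic
    ([bridges_acyclic]). *)
Definition cuts (X : set V) x y := forall a b, e a b -> ~ X a -> X b -> a = x /\ b = y.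

Lemma path_cross (X : set V) z p : path e z p -> ~ X z -> X (last z p) ->
  exists p1 b p2, [/\ p = p1 ++ b :: p2, ~ X (last z p1), X b & e (last z p1) b].
Proof.
elim: p z => [|y p IH] z /=; first by move=> _ nX X0.
move=> /andP[ezy pyp] nXz Xl; case: (pselect (X y)) => [Xy|nXy].
  by exists [::], y, p.
have [p1 [b [p2 [-> h1 h2 h3]]]] := IH _ pyp nXy Xl.
by exists (y :: p1), b, p2.
Qed.

Hypothesis Ht : simplicial_tree e.

Lemma tree_sym : symmetric e. Proof. by case: Ht. Qed.
Lemma tree_irr x : e x x = false. Proof. by case: Ht => _ _ /(_ x). Qed.

Lemma dist_path x y : exists p, [/\ path e x p, last x p = y & size p = dist x y].
Proof.
rewrite /dist; case: pselect => [P|nP].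
  by case: ex_minnP => n /asboolP hn _; exact: hn.
case: Ht => _ _ _ C _; have [p [h1 h2 _]] := C x y Logic.I Logic.I.
by case: nP; exists (size p); apply/asboolP; exists p.
Qed.

Lemma dist_le x p : path e x p -> (dist x (last x p) <= size p)%N.
Proof.
move=> h; rewrite /dist; case: pselect => [P|nP //].
by case: ex_minnP => n _ m; apply: m; apply/asboolP; exists p.
Qed.

Lemma distxx x : dist x x = 0%N.
Proof. by apply/eqP; rewrite -leqn0; exact: (@dist_le x [::]). Qed.

Lemma dist0 x y : dist x y = 0%N -> x = y.
Proof. by have [[|a p] [_ <- <-]] := dist_path x y. Qed.

Lemma dist_tri x y z : (dist x z <= dist x y + dist y z)%N.
Proof.
have [p [h1 h2 <-]] := dist_path x y; have [q [h3 h4 <-]] := dist_path y z.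
rewrite -size_cat; have := @dist_le x (p ++ q).
by rewrite cat_path last_cat h1 h2 h3 h4; apply.
Qed.

Lemma dist_sym x y : dist x y = dist y x.
Proof.
suff H a b : (dist a b <= dist b a)%N by apply/eqP; rewrite eqn_leq !H.
have [p [h1 h2 <-]] := dist_path b a.
have := @dist_le (last b p) (rev (belast b p)).
rewrite rev_path (eq_path (e' := e)); last by move=> u v; rewrite tree_sym.
rewrite size_rev size_belast h1 => /(_ isT).
suff -> : last (last b p) (rev (belast b p)) = b by rewrite h2.
by case: (p) => //= u q; rewrite rev_cons last_rcons.
Qed.

Lemma dist_adj x y : e x y -> dist x y = 1%N.
Proof.
move=> h; have := @dist_le x [:: y]; rewrite /= h => /(_ isT).
case D: (dist x y) => [|[|n]] // _; move/dist0: D => E.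
by rewrite E tree_irr in h.
Qed.

Lemma dist1 x y : dist x y = 1%N -> e x y.
Proof.
by have [[|a [|b p]] [h1 <- <-]] := dist_path x y => //= _; move: h1 => /= /andP[].
Qed.

(** A path from outside [X] into [X] must use the bridge, so a geodesic splits there. *)
Lemma cut_dist (X : set V) x y z w : e x y -> cuts X x y -> ~ X z -> X w ->
  dist z w = (dist z x + dist y w).+1.
Proof.
move=> exy cX nz Xw; apply/eqP; rewrite eqn_leq; apply/andP; split.
  have := dist_tri z x w; have := dist_tri x y w; have := dist_adj exy; lia.
have [p [h1 h2 <-]] := dist_path z w.
have Xl : X (last z p) by rewrite h2.
have [p1 [b [p2 [E n1 Xb e1]]]] := path_cross h1 nz Xl.
have [E1 E2] := cX _ _ e1 n1 Xb.
move: h1 h2; rewrite E cat_path last_cat /= => /and3P[q1 _ q2] l2.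
have := dist_le q1; have := dist_le q2; rewrite size_cat /= E1 -E2 l2; lia.
Qed.

(* In a graph without long cycles, every edge is a bridge. *)
Lemma cut_ex x y : e x y -> exists X : set V, [/\ ~ X x, X y & cuts X x y].
Proof.
move=> exy; pose e' a b := [&& e a b, ~~ ((a == x) && (b == y)) & ~~ ((a == y) && (b == x))].
(* This is the component of [y] once the edge is deleted in both directions; a path without
   repetition from [y] back to [x] inside it would close up to a long cycle. *)
exists [set z | exists2 p, path e' y p & last y p = z]; split.
- move=> [p hp lp]; move: lp; case/shortenP: hp => p' hp' up' _ lp.
  have sub : subrel e' e by move=> a b /and3P[].
  have [_ _ _ _ /(_ (y :: p'))] := Ht.
  move=> H0; have {H0} H : uniq (y :: p') -> (size (y :: p') <= 2)%N by move=> u; apply: H0; rewrite /ucycle u /= rcons_path (sub_path sub hp') lp exy.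
  have := H up'; case: p' hp' up' lp {H} => [|a [|b p']] //=.
    by move=> _ _ E; rewrite E tree_irr in exy.
  by move=> h _ E; move: h; rewrite E /e' !eqxx /= !andbF.
- by exists [::].
- move=> a b eab na [p hp lp].
  case: (boolP ((a == x) && (b == y))) => [/andP[/eqP-> /eqP->] //|n1].
  case: na; case: (boolP ((a == y) && (b == x))) => [/andP[/eqP-> _]|n2].
    by exists [::].
  exists (rcons p a); last by rewrite last_rcons.
  rewrite rcons_path hp lp /e' tree_sym eab /=.
  by rewrite [(b == x) && _]andbC n2 [(b == y) && _]andbC n1.
Qed.

Lemma adj_step z x y : e x y -> dist z y = (dist z x).+1 \/ dist z x = (dist z y).+1.
Proof.
move=> exy; have [X [nx Xy cX]] := cut_ex exy.
case: (pselect (X z)) => [Xz|nz]; [right|left].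
  by have := cut_dist exy cX nx Xz; rewrite distxx (dist_sym z x) (dist_sym z y); lia.
by have := cut_dist exy cX nz Xy; rewrite distxx; lia.
Qed.

Lemma side_cuts x y : e x y -> [/\ ~ side x y x, side x y y & cuts (side x y) x y].
Proof.
move=> exy; have [X [nx Xy cX]] := cut_ex exy.
suff E : side x y = X by rewrite E.
apply/seteqP; split => z; rewrite /side /=.
  move=> h; apply: contrapT => nz; have := cut_dist exy cX nz Xy; rewrite distxx; lia.
move=> Xz; have := cut_dist exy cX nx Xz; rewrite distxx (dist_sym z x) (dist_sym z y); lia.
Qed.

(** A neighbour [y'] other than [y] lies on the side of [x] of the edge [(x, y)], so every path from
    [y'] to [z] passes through [x]. *)
Lemma closer_uniq z x y y' : e x y -> e x y' ->
  (dist z y < dist z x)%N -> (dist z y' < dist z x)%N -> y = y'.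
Proof.
move=> exy exy' h h'; have [nx yy cX] := side_cuts exy.
apply: contrapT => ne.
have ny' : ~ side x y y'.
  by move=> k; have [_ E] := cX _ _ exy' nx k; apply: ne.
have := cut_dist exy cX ny' h; have := cut_dist exy cX nx h; have := dist_adj exy'; move: h'.
by rewrite distxx !(dist_sym z) (dist_sym y' x); lia.
Qed.

Lemma btw_sym x z y : btw x z y -> btw y z x.
Proof. by rewrite /btw (dist_sym y z) (dist_sym z x) (dist_sym y x); lia. Qed.

Lemma btwl x y : btw x x y. Proof. by rewrite /btw distxx. Qed.
Lemma btwr x y : btw x y y. Proof. by rewrite /btw distxx addn0. Qed.

Lemma next_ex x y : x <> y -> exists x', [/\ e x x', btw x x' y & dist x y = (dist x' y).+1].
Proof.
move=> ne; have [[|x' p] [hp lp sp]] := dist_path x y; first by case: ne.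
move: hp lp sp => /= /andP[exx' hp] lp sp; exists x'; split => //.
all: have := dist_le hp; have := dist_tri x x' y; have := dist_adj exx'; rewrite /btw lp; lia.
Qed.

Lemma btw_uniq x y z z' : btw x z y -> btw x z' y -> dist x z = dist x z' -> z = z'.
Proof.
move E : (dist x z) => n; elim: n x E => [|n IH] x E b b' E'.
  by rewrite -(dist0 E) -(dist0 (esym E')).
have nz : x <> z by move=> k; rewrite k distxx in E.
have nz' : x <> z' by move=> k; rewrite k distxx in E'.
have [x1 [e1 _ d1]] := next_ex nz; have [x2 [e2 _ d2]] := next_ex nz'.
have T1 := dist_tri x x1 y; have T2 := dist_tri x1 z y.
have T3 := dist_tri x x2 y; have T4 := dist_tri x2 z' y.
have := dist_adj e1; have := dist_adj e2; move=> A1 A2; rewrite /btw in b b'.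
have E12 : x1 = x2.
  apply: (closer_uniq (z := y) e1 e2); rewrite !(dist_sym y); lia.
subst x2; apply: (IH x1); rewrite /btw; lia.
Qed.

(** The overlap of the two geodesics contains an edge leaving [b]; [a] and [f] lie on different
    sides of it, so gluing creates no backtracking. *)
Lemma btw_glue a b c f : btw a b c -> btw b c f -> b <> c -> btw a b f.
Proof.
move=> h1 h2 ne; have [b' [e1 h3 h4]] := next_ex ne.
have [nb bb cX] := side_cuts e1; have A := dist_adj e1.
rewrite /btw in h1 h2 h3 *.
have T := dist_tri b' c f; have T' := dist_tri b b' f.
have Xf : side b b' f by rewrite /side /= (dist_sym f b') (dist_sym f b); lia.
have nXa : ~ side b b' a.
  by rewrite /side /= => k; have := dist_tri a b' c; lia.
have := cut_dist e1 cX nXa Xf; have := cut_dist e1 cX nb Xf; rewrite distxx; lia.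
Qed.

Lemma btw_glue2 a b c f : btw a b c -> btw b c f -> b <> c -> btw a c f.
Proof.
by move=> h1 h2 ne; have := btw_glue h1 h2 ne; rewrite /btw in h1 h2 *; lia.
Qed.

(** The gate is a nearest point [p] of [S]: the next vertex towards [s] is in [S] by convexity,
    hence farther from [z], and [btw_glue] applies. *)
Lemma gate_ex (S : set V) z : S !=set0 -> convex S ->
  exists2 p, S p & forall s, S s -> btw z p s.
Proof.
move=> [s0 Ss0] cS.
have P : exists n, `[< exists2 p, S p & dist z p = n >] by exists (dist z s0); apply/asboolP; exists s0.
case: (ex_minnP P) => n /asboolP[p Sp Dp] m; exists p => // s Ss.
have {}m q : S q -> (n <= dist z q)%N by move=> h; apply: m; apply/asboolP; exists q.
case: (pselect (p = s)) => [->|ne]; first exact: btwr.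
have [p' [e1 h1 h2]] := next_ex ne.
have Sp' := cS _ _ _ Sp Ss h1.
apply: (btw_glue (c := p')) => //.
  by rewrite /btw; have := m _ Sp'; have := adj_step z e1; have := dist_adj e1; lia.
by move=> k; rewrite -k tree_irr in e1.
Qed.

Lemma gate_uniq (S : set V) z p p' : S p -> S p' ->
  (forall s, S s -> btw z p s) -> (forall s, S s -> btw z p' s) -> p = p'.
Proof.
move=> Sp Sp' h h'; have := h _ Sp'; have := h' _ Sp; rewrite /btw (dist_sym p' p) => a b.
apply: dist0; lia.
Qed.

Lemma btw_at x y k : (k <= dist x y)%N -> exists2 z, btw x z y & dist x z = k.
Proof.
elim: k => [|k IH] h; first by exists x; [exact: btwl|rewrite distxx].
have [z b D] := IH (ltnW h); rewrite /btw in b.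
have ne : z <> y by move=> E; rewrite E in D; lia.
have [z' [e1 b1 D1]] := next_ex ne.
have := dist_tri x z' y; have := dist_tri x z z'; have := dist_adj e1.
by move=> A T1 T2; exists z'; rewrite /btw; lia.
Qed.

Lemma btw_total a b x y : btw a x b -> btw a y b -> (dist a x <= dist a y)%N -> btw a x y.
Proof.
move=> hx hy le; have [x' h1 h2] := btw_at le.
suff -> : x = x' by [].
apply: (btw_uniq hx); last by [].
rewrite /btw in hy h1 *; have := dist_tri x' y b; have := dist_tri a x' b; lia.
Qed.

Lemma interval_convex a b : convex [set z | btw a z b].
Proof.
move=> x y z /= hx hy hz; wlog le : x y hx hy hz / (dist a x <= dist a y)%N.
  move=> H; case/orP: (leq_total (dist a x) (dist a y)) => le; first exact: (H x y).
  by apply: (H y x) => //; exact: btw_sym.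
have := btw_total hx hy le; rewrite /btw in hx hy hz * => k.
have := dist_tri a x z; have := dist_tri z y b; have := dist_tri a z b; lia.
Qed.

(** The median is the gate of [c] on the interval from [a] to [b]. *)
Lemma med_ex a b c : exists m, [/\ btw a m b, btw b m c & btw a m c].
Proof.
have [m h1 h2] := gate_ex c (S := [set z | btw a z b]) (ex_intro _ a (btwl a b)) (@interval_convex a b).
exists m; split => //; last by apply: btw_sym; apply: h2; exact: btwl.
by apply: btw_sym; apply: h2; exact: btwr.
Qed.

Lemma med_uniq a b c m m' : [/\ btw a m b, btw b m c & btw a m c] ->
  [/\ btw a m' b, btw b m' c & btw a m' c] -> m = m'.
Proof.
move=> [h1 h2 h3] [k1 k2 k3]; apply: (btw_uniq h1 k1).
move: h1 h2 h3 k1 k2 k3; rewrite /btw (dist_sym b m) (dist_sym b m') (dist_sym b c); lia.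
Qed.

(** A displacement shorter than the distance from [a] to [o] cannot leave the half-tree at [o] that
    contains [a]. This is why medians ignore bounded errors. *)
Lemma btw_perturb a a' o b : btw a o b -> (dist a a' < dist a o)%N -> btw a' o b.
Proof.
move=> h D; have ne : o <> a by move=> E; rewrite E distxx in D.
have [o1 [e1 h1 h2]] := next_ex ne; have [no oo cX] := side_cuts e1.
have Xa : side o o1 a by rewrite /side /= !(dist_sym a); lia.
have nb : ~ side o o1 b.
  rewrite /side /= => k; move: h; rewrite /btw (dist_sym a o) (dist_sym o b) => h.
  have := dist_tri a o1 b; rewrite (dist_sym a o1) (dist_sym o1 b); lia.
have Xa' : side o o1 a'.
  apply: contrapT => na; have := cut_dist e1 cX na Xa; rewrite (dist_sym a' a) (dist_sym a o) in D *.
  lia.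
have := cut_dist e1 cX nb Xa'; have := cut_dist e1 cX no Xa'; rewrite distxx => k1 k2.
rewrite /btw (dist_sym a' o) (dist_sym o b) (dist_sym a' b); lia.
Qed.

Lemma btw_perturb2 n a a' b b' o : btw a o b -> (dist a a' <= n)%N -> (dist b b' <= n)%N ->
  (n < dist a o)%N -> (n < dist b o)%N -> btw a' o b'.
Proof.
move=> h Da Db na nb; apply: btw_sym; apply: (btw_perturb (a := b)); last by lia.
by apply: btw_sym; apply: btw_perturb h _; lia.
Qed.

Lemma local_geodesic (s : nat -> V) : (forall n, s n <> s n.+1) ->
  (forall n, btw (s n) (s n.+1) (s n.+2)) -> forall i j, btw (s i) (s (i + j)) (s (i + j).+1).
Proof.
move=> ns bs i; elim=> [|j IH]; first by rewrite addn0; exact: btwl.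
by rewrite addnS; apply: btw_glue2 IH (bs _) (@ns _).
Qed.

Lemma nonbacktracking_dist (s : nat -> V) : (forall n, e (s n) (s n.+1)) ->
  (forall n, s n <> s n.+2) -> forall i j, dist (s i) (s (i + j)) = j.
Proof.
move=> es ns i j; have st n : s n <> s n.+1 by move=> E; have := es n; rewrite {1}E tree_irr.
have two n : btw (s n) (s n.+1) (s n.+2).
  rewrite /btw !(dist_adj (es _)); have [->|] := adj_step (s n) (es n.+1); rewrite (dist_adj (es n)) //.
  by move=> [/esym/dist0/ns].
elim: j => [|j IH]; first by rewrite addn0 distxx.
by have := local_geodesic st two i j; rewrite /btw IH addnS (dist_adj (es _)) => <-; rewrite addn1.
Qed.

Lemma connected_convex (S : set V) : connected e S -> convex S.
Proof.
move=> cS x y z Sx Sy h; case: (pselect (z = y)) => [-> //|ne].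
have [z' [e1 h1 h2]] := next_ex ne; have [nz zz cX] := side_cuts e1.
have Xy : side z z' y by rewrite /side /= !(dist_sym y); lia.
have nx : ~ side z z' x.
  rewrite /side /= => k; rewrite /btw in h; have := dist_tri x z' y; lia.
have [p [hp lp sp]] := cS _ _ Sx Sy; rewrite -lp in Xy.
have [p1 [b [p2 [E k1 k2 k3]]]] := path_cross hp nx Xy.
have [E1 _] := cX _ _ k3 k1 k2; rewrite -E1.
case: p1 E {k1 k3 E1} => [//|q p1] E /=; apply: sp; rewrite /= E mem_cat.
by rewrite mem_last.
Qed.

Lemma geodesic_btw x p : path e x p -> dist x (last x p) = size p ->
  forall z, z \in p -> btw x z (last x p).
Proof.
move=> hp D z zp; case/splitPr: zp hp D => p1 p2; rewrite cat_path last_cat /= size_cat /= => /and3P[h1 h2 h3] D.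
have h12 : path e x (rcons p1 z) by rewrite rcons_path h1.
have := dist_le h12; have := dist_le h3; rewrite last_rcons size_rcons.
have := dist_tri x z (last z p2); rewrite /btw; move: D; set a := dist x (last z p2); set b := dist z _; set c := dist x z; set u := size p1; set v := size p2; move: a b c u v => a b c u v; lia.
Qed.

Lemma convex_connected (S : set V) : convex S -> connected e S.
Proof.
move=> cS x y Sx Sy; have [p [h1 h2 h3]] := dist_path x y.
exists p; split => // z zp; apply: (cS x y) => //; rewrite -h2.
by apply: (@geodesic_btw x p); rewrite ?h2.
Qed.

Lemma side_convex x y : e x y -> convex (side x y).
Proof.
move=> exy a b z ha hb h; have [nx xy cX] := side_cuts exy; apply: contrapT => nz.
have := cut_dist exy cX nz ha; have := cut_dist exy cX nz hb; rewrite /btw (dist_sym a z) in h.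
move: ha hb; rewrite /side /= => _ _; have := dist_tri a y b; rewrite (dist_sym a y); lia.
Qed.

Lemma cut_btw X x y z w : e x y -> cuts X x y -> ~ X z -> X w -> btw z x w /\ btw z y w.
Proof.
move=> exy cX nz Xw; have := cut_dist exy cX nz Xw; have := dist_adj exy.
have := dist_tri z x y; have := dist_tri x y w; have := dist_tri z y w; have := dist_tri z x w.
rewrite /btw; lia.
Qed.

Lemma side_sym x y z : e x y -> ~ side x y z -> side y x z.
Proof. by move=> exy; rewrite /side /=; case: (adj_step z exy); lia. Qed.

End Dist.

Lemma connected_refine (V : choiceType) (e e' : rel V) (S : set V) : connected e S ->
  (forall a b, S a -> S b -> e a b ->
     exists p, [/\ path e' a p, last a p = b & [set` p] `<=` S]) -> connected e' S.
Proof.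
move=> cS H x y Sx Sy; have [p [hp lp sp]] := cS x y Sx Sy.
elim: p x Sx hp lp sp => [|a p IH] x Sx /=; first by move=> _ <- _; exists [::].
move=> /andP[xa hp] lp sp; have Sa : S a by apply: sp; exact: mem_head.
have [|q [hq lq sq]] := IH _ Sa hp lp; first by move=> w wp; apply: sp; rewrite /= inE wp orbT.
have [q0 [h0 l0 s0]] := H _ _ Sx Sa xa; exists (q0 ++ q).
rewrite cat_path h0 last_cat l0; split => // w; rewrite /= mem_cat => /orP[/s0|/sq] //.
Qed.

(** A cycle through [(x, y)] enters [X] at [y]; the rest of it cannot leave [X] without using the
    bridge again, so it never closes up at [x]. *)
Lemma bridges_acyclic (V : choiceType) (e : rel V) : symmetric e ->
  (forall x y, e x y -> exists X : set V, [/\ ~ X x, X y & cuts e X x y]) ->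
  forall c, ucycle e c -> (size c <= 2)%N.
Proof.
move=> sy H [//|x [//|y p]] /andP[] /= /andP[exy hp] /and3P[xy yp _].
have [X [nx Xy cX]] := H _ _ exy.
move: hp; rewrite rcons_path => /andP[hp el].
have Xp q : path e y q -> x \notin y :: q -> X (last y q).
  elim/last_ind: q => [//|q a IH]; rewrite rcons_path last_rcons => /andP[h1 h2].
  rewrite inE mem_rcons inE !negb_or => /and3P[n1 n2 n3]; apply: contrapT => na.
  have Xl : X (last y q) by apply: IH => //; rewrite inE negb_or n1.
  have [E _] := cX a (last y q) ltac:(by rewrite sy) na Xl.
  by rewrite E eqxx in n2.
have Xl := Xp _ hp xy; have [_ E] := cX x (last y p) ltac:(by rewrite sy) nx Xl.
by case: p yp E {hp el xy Xp Xl} => //= a p + E; rewrite -{1}E mem_last.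
Qed.

(** * Monotone maps and group actions *)

Section Mono.
Variables (V V' : choiceType) (e : rel V) (e' : rel V').
Hypotheses (Ht : simplicial_tree e) (Ht' : simplicial_tree e').

Definition lipschitz (c : V -> V') := forall x y, e x y -> c x = c y \/ e' (c x) (c y).
(** Metric form of a collapse map: edges go to edges or points, and fibers are convex. For
    equivariant surjections it amounts to [collapse_map], by [collapseP]. *)
Definition monotone (c : V -> V') :=
  lipschitz c /\ forall x y z, c x = c y -> btw e x z y -> c z = c x.

(** A discrete intermediate value theorem: the image of a geodesic cannot jump over [m]. *)
Lemma lipschitz_hits c x z m : lipschitz c -> btw e' (c x) m (c z) ->
  exists2 p, btw e x p z & c p = m.
Proof.
move=> Lc; move E : (dist e x z) => n; elim: n x E => [|n IH] x E hm.
  exists x; first exact: btwl.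
  move: hm; rewrite -(dist0 Ht E) /btw (distxx e' (c x)) => k.
  by apply: (dist0 Ht'); lia.
case: (pselect (c x = m)) => [<-|ne]; first by exists x; first exact: btwl.
have nz : x <> z by move=> k; rewrite k distxx in E.
have [x1 [e1 b1 d1]] := next_ex Ht nz.
suff hm1 : btw e' (c x1) m (c z).
  have [|p bp cp] := IH x1 _ hm1; first by lia.
  exists p => //; have := dist_tri Ht x x1 p; have := dist_tri Ht x p z; have := dist_adj Ht e1.
  by move: bp; rewrite /btw; lia.
case: (Lc _ _ e1) => [<- //|a1].
have [x2 [e2 b2 d2]] := next_ex Ht' ne.
have A := dist_adj Ht' a1; have A2 := dist_adj Ht' e2.
have T := dist_tri Ht' x2 m (c z).
case: (adj_step Ht' (c z) a1); rewrite !(dist_sym Ht' (c z)) => D.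
  have := dist_tri Ht' (c x1) (c x) m; have := dist_tri Ht' (c x1) m (c z).
  by move: hm; rewrite /btw (dist_sym Ht' (c x1) (c x)); lia.
have E12 : x2 = c x1.
  apply: (closer_uniq Ht' (z := c z) e2 a1); rewrite !(dist_sym Ht' (c z)); move: hm; rewrite /btw; lia.
by move: hm D; rewrite /btw -E12; lia.
Qed.

Lemma lipschitz_dist c x y : lipschitz c -> (dist e' (c x) (c y) <= dist e x y)%N.
Proof.
move=> L; move E : (dist e x y) => n; elim: n x E => [|n IH] x E.
  by rewrite (dist0 Ht E) distxx.
have nz : x <> y by move=> k; rewrite k distxx in E.
have [x1 [e1 b1 d1]] := next_ex Ht nz.
have := IH x1 ltac:(lia); have := dist_tri Ht' (c x) (c x1) (c y).
by case: (L _ _ e1) => [->|a1]; rewrite ?distxx ?(dist_adj Ht' a1); lia.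
Qed.

Variable c : V -> V'.
Hypothesis Mc : monotone c.

(** The median [m] of the three images is attained at some [p] before [z] and at some [q] after [z];
    since [z] lies between [p] and [q], convexity of the fiber forces [c z = m]. *)
Lemma mono_btw x z y : btw e x z y -> btw e' (c x) (c z) (c y).
Proof.
move=> h; have [L F] := Mc.
have [m [m1 m2 m3]] := med_ex Ht' (c x) (c z) (c y).
have [p bp cp] := lipschitz_hits L m1; have [q bq cq] := lipschitz_hits L m2.
suff -> : c z = m by [].
rewrite -cp; apply: (F p q); first by rewrite cp cq.
have T1 := dist_tri Ht x p q; have T2 := dist_tri Ht x q y; have T3 := dist_tri Ht p z q.
by rewrite /btw in h bp bq *; lia.
Qed.

Lemma preim_convex (S : set V') : convex e' S -> convex e (c @^-1` S).
Proof. by move=> cS x y z Sx Sy h; apply: (cS (c x) (c y)) => //; exact: mono_btw. Qed.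

Lemma fiber_convex u : convex e [set x | c x = u].
Proof. by move=> x y z /= xu yu h; have [_ F] := Mc; rewrite (F x y z) // xu. Qed.

Lemma image_convex (S : set V) : convex e S -> convex e' (c @` S).
Proof.
move=> cS _ _ w [x Sx <-] [y Sy <-] h; have [p bp <-] := lipschitz_hits (proj1 Mc) h.
by exists p => //; apply: (cS x y).
Qed.

Lemma lift_adj x y u v : c x = u -> c y = v -> e' u v ->
  exists a b, [/\ c a = u, c b = v & e a b].
Proof.
move=> cx cy auv; have [L _] := Mc.
have [nu vv cX] := side_cuts Ht' auv.
have [p [hp lp _]] := dist_path Ht x y.
have nx : ~ (c @^-1` side e' u v) x by rewrite /= cx.
have Xl : (c @^-1` side e' u v) (last x p) by rewrite /= lp cy.
have [p1 [b [p2 [_ k1 k2 k3]]]] := path_cross hp nx Xl.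
exists (last x p1), b; case: (L _ _ k3) => [E|a]; first by case: k1; rewrite /= E.
by have [-> ->] := cX _ _ a k1 k2.
Qed.

(** If the two lifts differed, [y] would lie between [x] and [x'], or [x] between [y] and [y'];
    convexity of fibers would then collapse the edge [(x, y)]. *)
Lemma lift_uniq x y x' y' : e x y -> e x' y' -> c x = c x' -> c y = c y' -> c x <> c y ->
  x = x' /\ y = y'.
Proof.
move=> exy exy' cx cy ne; have [nx yy cX] := side_cuts Ht exy.
have nx' : ~ side e x y x'.
  move=> k; have [b1 b2] := cut_btw Ht exy cX nx k.
  by apply: ne; rewrite (fiber_convex (u := c x) _ _ b2).
have yy' : side e x y y'.
  apply: contrapT => k; have [b1 b2] := cut_btw Ht exy cX k yy.
  by apply: ne; apply: (fiber_convex (u := c y) _ _ b1).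
by have [-> ->] := cX _ _ exy' nx' yy'.
Qed.

End Mono.

(** * Minimal actions: fixed points, orbits in half-trees, absence of leaves *)

Section Action.
Variables (G : groupType) (T : gtree G).
Implicit Types x y z : T.

Definition gd := gtree_tree T.
Definition stab x : set G := [set g | act T g x = x].

Lemma actK g x : act T g^-1 (act T g x) = x.
Proof. by rewrite -gtree_actM mulVg gtree_act1. Qed.
Lemma actVK g x : act T g (act T g^-1 x) = x.
Proof. by rewrite -gtree_actM mulgV gtree_act1. Qed.
Lemma act_inj g : injective (act T g).
Proof. by move=> x y E; rewrite -(actK g x) E actK. Qed.

Lemma act_path g x p : path (adj T) (act T g x) (map (act T g) p) = path (adj T) x p.
Proof. by elim: p x => //= y p IH x; rewrite gtree_act_adj IH. Qed.

Lemma act_dist g x y : dist (adj T) (act T g x) (act T g y) = dist (adj T) x y.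
Proof.
suff H h a b : (dist (adj T) (act T h a) (act T h b) <= dist (adj T) a b)%N.
  by apply/eqP; rewrite eqn_leq H /= -{1}(actK g x) -{1}(actK g y) H.
have [p [h1 h2 <-]] := dist_path gd a b.
have := @dist_le _ (adj T) (act T h a) (map (act T h) p).
by rewrite act_path last_map h2 size_map; apply.
Qed.

Lemma act_btw g x z y : btw (adj T) (act T g x) (act T g z) (act T g y) <-> btw (adj T) x z y.
Proof. by rewrite /btw !act_dist. Qed.

Lemma stab_conj g h x : stab (act T g x) h <-> stab x (g^-1 * h * g).
Proof.
rewrite /stab /= !gtree_actM; split=> [->|E]; first by rewrite actK.
by rewrite -[in RHS]E actVK.
Qed.

Lemma fix_btw g x y z : stab x g -> stab y g -> btw (adj T) x z y -> stab z g.
Proof.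
rewrite /stab /= => ex ey h; apply: (btw_uniq gd (x := x) (y := y)) => //.
  by rewrite -{1}ex -{1}ey; apply/act_btw.
by rewrite -{1}ex act_dist.
Qed.

Lemma fix_gate (S : set T) g z p : (forall x, S x -> S (act T g x)) -> stab z g ->
  S p -> (forall s, S s -> btw (adj T) z p s) -> stab p g.
Proof.
move=> Sg gz Sp H; apply: (btw_uniq gd (x := z) (y := act T g p)); last by rewrite -{1}gz act_dist.
  exact: btwr.
by apply: H; exact: Sg.
Qed.

Lemma minimal_convex (S : set T) : S !=set0 -> convex (adj T) S ->
  (forall g x, S x -> S (act T g x)) -> S = setT.
Proof. by move=> S0 cS gS; apply: gtree_minimal => //; apply: convex_connected => //; exact: gd. Qed.

(** The points without a translate in the half-tree form an invariant convex set. If it contained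
    [z] it would be everything by minimality, but it misses [y]. *)
Lemma side_orbit x y z : adj T x y -> exists g, side (adj T) x y (act T g z).
Proof.
move=> exy; apply: contrapT => N.
pose S := [set w | forall g, ~ side (adj T) x y (act T g w)].
have [nx yy cX] := side_cuts gd exy.
have cS : convex (adj T) S.
  move=> a b w Sa Sb h g k; have h' := (act_btw g a w b).2 h.
  have [_ b1] := cut_btw gd exy cX (Sa g) k; have [b2 _] := cut_btw gd exy cX (Sb g) k.
  have := dist_adj gd exy; have := cut_dist gd exy cX (Sa g) k; have := cut_dist gd exy cX (Sb g) k.
  have := dist_tri gd (act T g a) x (act T g b).
  move: h'; rewrite /btw (dist_sym gd (act T g w) (act T g b)) (dist_sym gd (act T g b) x); lia.
have ST : S = setT.
  apply: minimal_convex => //; first by exists z => g h; apply: N; exists g.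
  by move=> g w Sw h; rewrite -gtree_actM; exact: Sw.
have : S y by rewrite ST.
by move=> /(_ 1); rewrite gtree_act1.
Qed.

(** Removing the orbit of a leaf [x] leaves an invariant convex set, against minimality unless the
    neighbour [y] is itself in that orbit; in that case the edge [(x, y)] is inverted. *)
Lemma no_leaf x y : ~ fixed_point T -> exists2 y', adj T x y' & y' <> y.
Proof.
move=> nf; apply: contrapT => N.
have only w : adj T x w -> w = y by move=> a; apply: contrapT => ne; apply: N; exists w.
have Nx : exists y0, adj T x y0.
  apply: contrapT => N0; apply: nf; exists x => g; apply: contrapT => ne.
  by have [w [aw _ _]] := next_ex gd (not_eq_sym ne); apply: N0; exists w.
have exy : adj T x y by have [y0 a0] := Nx; rewrite -(only _ a0).
pose S := [set w : T | forall g, w <> act T g x].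
have Sg g w : S w -> S (act T g w).
  by move=> Sw h E; apply: (Sw (g^-1 * h)); rewrite gtree_actM -E actK.
have leaf g w : adj T (act T g x) w -> w = act T g y.
  by rewrite -{1}(actVK g w) gtree_act_adj => /only <-; rewrite actVK.
have cS : convex (adj T) S.
  move=> a b w Sa Sb h g E; subst w.
  have n1 : act T g x <> a by apply/not_eq_sym; exact: Sa.
  have n2 : act T g x <> b by apply/not_eq_sym; exact: Sb.
  have [a1 [e1 _ d1]] := next_ex gd n1; have [b1 [e2 _ d2]] := next_ex gd n2.
  rewrite (leaf _ _ e1) in d1; rewrite (leaf _ _ e2) in d2.
  have := dist_tri gd a (act T g y) b; move: h; rewrite /btw (dist_sym gd a (act T g x)) (dist_sym gd a (act T g y)); lia.
case: (pselect (S y)) => [Sy|nS].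
  have ST : S = setT by apply: minimal_convex => //; exists y.
  have : S x by rewrite ST.
  by move=> /(_ 1); rewrite gtree_act1.
have [g Eg] : exists g, y = act T g x.
  by apply: contrapT => k; apply: nS => g E; apply: k; exists g.
have E2 : act T g y = x.
  by apply/esym; apply: leaf; rewrite -Eg (tree_sym gd).
by apply: (gtree_noinv exy (g := g)).
Qed.

Lemma extend_side x y n : ~ fixed_point T -> adj T x y ->
  exists2 z, side (adj T) x y z & dist (adj T) x z = n.+1.
Proof.
move=> nf exy; elim: n => [|n [z sz dz]].
  exists y; last exact: (dist_adj gd exy).
  by rewrite /side /= distxx (dist_sym gd) (dist_adj gd exy).
have nz : z <> x by move=> E; rewrite E distxx in dz.
have [z1 [e1 b1 d1]] := next_ex gd nz; have [z2 e2 ne] := no_leaf z z1 nf.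
have D : dist (adj T) x z2 = (dist (adj T) x z).+1.
  case: (adj_step gd x e2) => // D; case: ne; apply: (closer_uniq gd (z := x) e2 e1); first by lia.
  by rewrite !(dist_sym gd x); lia.
exists z2; last by rewrite D dz.
have := adj_step gd y e2; have := adj_step gd z2 exy; have := adj_step gd z exy.
by move: sz; rewrite /side /= !(dist_sym gd _ x) !(dist_sym gd _ y); lia.
Qed.

End Action.

Section Maps.
Variables (G : groupType).

(** The collapsed edges are recovered as those whose ends have the same image, so the relation [E]
    never has to be carried along. *)
Lemma collapseP (T T' : gtree G) (f : T -> T') : collapse_map f <->
  [/\ equivariant idfun f, forall u, exists x, f x = u & monotone (adj T) (adj T') f].
Proof.
have [HT HT'] := (gd T, gd T'); split.
- move=> [eqf [E [[sE subE gE] [sf fE aE]]]]; split => //; split.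
    move=> x y a; case: (boolP (E x y)) => h; [left|right].
      by apply/fE; exists [:: y]; rewrite /= ?h.
    by apply/aE; exists x, y.
  move=> x y z; suff C : convex (adj T) [set w | f w = f x] by move=> h; apply: (C x y).
  apply: (connected_convex HT) => {z} a b /= fa fb.
  have [p hp lp] := (fE a b).1 (etrans fa (esym fb)).
  exists p; split => //; first exact: sub_path hp.
  move=> z /= zp; rewrite -fa; apply/esym/fE; case/splitPr: zp hp {lp} => p1 p2.
  rewrite cat_path /= => /and3P[h1 h2 _]; exists (rcons p1 z); last by rewrite last_rcons.
  by rewrite rcons_path h1.
- move=> [eqf sf Mf]; split => //.
  exists (fun x y => adj T x y && (f x == f y)); split; split => //.
  + by move=> x y; rewrite (tree_sym HT) eq_sym.
  + by move=> x y /andP[].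
  + by move=> g x y; rewrite gtree_act_adj !eqf (inj_eq (@act_inj _ _ _)).
  + move=> x y; split; last first.
      move=> [p hp <-]; elim: p x hp => //= w p IH x /andP[/andP[_ /eqP->]]; exact: IH.
    move=> fxy; have [p [hp lp sp]] := dist_path HT x y; exists p => //.
    apply: (sub_in_path (P := [pred w | f w == f x]) _ _ hp).
      by move=> u v /eqP fu /eqP fv a; rewrite a fu fv eqxx.
    apply/allP => w; rewrite inE => /orP[/eqP->|wp]; first exact: eqxx.
    apply/eqP; apply: (proj2 Mf x y) => //.
    by rewrite -lp; apply: (@geodesic_btw _ _ HT x p); rewrite ?lp.
  + move=> u v; split.
      move=> a; have [[x fx] [y fy]] := (sf u, sf v).
      have [x' [y' [Ex Ey a']]] := lift_adj HT HT' Mf fx fy a.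
      exists x', y'; split => //; rewrite a' Ex Ey /=; apply/eqP => E.
      by rewrite E (tree_irr HT') in a.
    move=> [x [y [<- <- a]]]; rewrite a /= => /eqP ne.
    by case: (proj1 Mf _ _ a).
Qed.

End Maps.

(** * Collapse maps *)

Section Collapse.
Variable G : groupType.
Implicit Types T R S : gtree G.

Lemma collapse_monotone T T' (f : T -> T') : collapse_map f -> monotone (adj T) (adj T') f.
Proof. by case/collapseP. Qed.
Lemma collapse_surj T T' (f : T -> T') : collapse_map f -> forall u, exists x, f x = u.
Proof. by case/collapseP. Qed.
Lemma collapse_equiv T T' (f : T -> T') : collapse_map f -> forall g x, f (act T g x) = act T' g (f x).
Proof. by case/collapseP. Qed.

Lemma collapse_id T : collapse_map (@id T).
Proof.
apply/collapseP; split => //; first by move=> u; exists u.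
split; first by move=> x y; right.
move=> x y z ->; rewrite /btw distxx (dist_sym (gd T) z y) => E.
by apply: (dist0 (gd T)); rewrite (dist_sym (gd T)); lia.
Qed.

Lemma collapse_comp T1 T2 T3 (f : T1 -> T2) (g : T2 -> T3) :
  collapse_map f -> collapse_map g -> collapse_map (g \o f).
Proof.
move=> Cf Cg; have Mf := collapse_monotone Cf; have Mg := collapse_monotone Cg.
apply/collapseP; split.
- by move=> h x /=; rewrite !collapse_equiv.
- move=> u; have [y <-] := collapse_surj Cg u; have [x <-] := collapse_surj Cf y.
  by exists x.
- split => [x y a|x y z /= E h].
    case: (proj1 Mf _ _ a) => [|a'] /=; first by move=> ->; left.
    exact: (proj1 Mg).
  by apply: (proj2 Mg _ (f y)) => //; apply: mono_btw h => //; exact: gd.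
Qed.

Lemma collapse_bij_iso T T' (f : T -> T') : collapse_map f -> bijective f -> equivariant_iso idfun f.
Proof.
move=> Cf bf; split => //; last exact: collapse_equiv.
move=> x y; apply/idP/idP => a; last first.
  case: (proj1 (collapse_monotone Cf) _ _ a) => // /(bij_inj bf) E.
  by rewrite E (tree_irr (gd T)) in a.
have [x' [y' [E1 E2 a']]] := lift_adj (gd T) (gd T') (collapse_monotone Cf) (erefl (f x)) (erefl (f y)) a.
by rewrite -(bij_inj bf E1) -(bij_inj bf E2).
Qed.

Lemma iso_btw T T' (f : T -> T') : bijective f -> (forall x y, adj T' (f x) (f y) = adj T x y) ->
  monotone (adj T) (adj T') f.
Proof.
move=> bf af; split => [x y|x y z /(bij_inj bf)->]; first by rewrite -af; right.
move=> h; congr f; apply/esym/(dist0 (gd T)); move: h.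
by rewrite /btw distxx (dist_sym (gd T) z); lia.
Qed.

Lemma iso_collapse T T' (f : T -> T') : equivariant_iso idfun f -> collapse_map f.
Proof.
move=> [bf af ef]; apply/collapseP; split => //; last exact: iso_btw.
by case: bf => h _ hK u; exists (h u).
Qed.

Lemma collapse_factor T T' T1 (c : T -> T') (c1 : T -> T1) : collapse_map c -> collapse_map c1 ->
  (forall x y, c x = c y -> c1 x = c1 y) ->
  exists2 c' : T' -> T1, collapse_map c' & forall x, c' (c x) = c1 x.
Proof.
move=> Cc C1 H; pose s u := projT1 (cid (collapse_surj Cc u)).
have sK u : c (s u) = u by rewrite /s; case: cid.
have E x : c1 (s (c x)) = c1 x by apply: H; rewrite sK.
exists (c1 \o s) => //; apply/collapseP; split.
- by move=> g u /=; rewrite -collapse_equiv // -{1}(sK u) -collapse_equiv.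
- by move=> v; have [x <-] := collapse_surj C1 v; exists (c x) => /=.
- split => [u v a|u v w /= Euv h].
    have [x [y [<- <- a']]] := lift_adj (gd T) (gd T') (collapse_monotone Cc) (sK u) (sK v) a.
    by rewrite /= !E; apply: (proj1 (collapse_monotone C1)).
  rewrite -(sK u) -(sK v) in h.
  have [p bp <-] := lipschitz_hits (gd T) (gd T') (proj1 (collapse_monotone Cc)) h.
  by rewrite E; apply: (proj2 (collapse_monotone C1) _ (s v)).
Qed.

Lemma collapse_fixed T T' (c : T -> T') : collapse_map c -> fixed_point T -> fixed_point T'.
Proof. by move=> Cc [x fx]; exists (c x) => g; rewrite -collapse_equiv // fx. Qed.

(** An element fixing [z] and [u] preserves the fiber over [u], hence fixes the gate of [z] on
    it. *)
Lemma fix_fiber T T' (c : T -> T') z u : collapse_map c ->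
  exists2 p, c p = u & forall g, @stab G T z g -> stab u g -> stab p g.
Proof.
move=> Cc; have [p cp H] := gate_ex (gd T) z (collapse_surj Cc u) (fiber_convex (collapse_monotone Cc) (u := u)).
exists p => // g hz hu; apply: (fix_gate _ hz cp H) => x /= Ex.
by rewrite collapse_equiv // Ex.
Qed.

(** An equivariant map is a choice of images on orbit representatives, subject only to inclusion of
    stabilizers. Domination thus becomes a statement about point stabilizers. *)
Lemma dominatesP T T' : dominates T T' <-> forall x : T, exists y : T', stab x `<=` stab y.
Proof.
split=> [[f ef] x|H]; first by exists (f x) => g gx; rewrite /stab /= -[act T' g _]ef gx.
(* [choose] depends on its predicate only up to extensional equality, so [rep] is constant on
   orbits. *)
pose P (x : T) := [pred y : T | `[< exists g, y = act T g x >]].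
have Px x : P x x by apply/asboolP; exists 1; rewrite gtree_act1.
pose rep x := choose (P x) x.
have repP x : exists g, x = act T g (rep x).
  have /asboolP[g ->] : P x (rep x) by apply: chooseP.
  by exists g^-1; rewrite actK.
have rep_act h x : rep (act T h x) = rep x.
  rewrite /rep; have E : P (act T h x) =1 P x.
    move=> y; apply/asboolP/asboolP => -[g ->]; first by exists (g * h); rewrite gtree_actM.
    by exists (g * h^-1); rewrite gtree_actM actK.
  rewrite (eq_choose E); apply: choose_id => //; rewrite -E; exact: Px.
pose gx x := projT1 (cid (repP x)); have gxE x : x = act T (gx x) (rep x) by rewrite /gx; case: cid.
pose h x := projT1 (cid (H x)); have hS x : stab x `<=` stab (h x) by rewrite /h; case: cid.
exists (fun x => act T' (gx x) (h (rep x))) => g x; rewrite -gtree_actM rep_act.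
have E1 : act T (gx (act T g x)) (rep x) = act T (g * gx x) (rep x).
  by rewrite gtree_actM -gxE -{1}(rep_act g x) -gxE.
have /hS E : stab (rep x) ((g * gx x)^-1 * gx (act T g x)) by rewrite /stab /= gtree_actM E1 actK.
by rewrite -[in RHS]E -gtree_actM mulgA mulgV mul1g.
Qed.

Lemma dominates_trans T1 T2 T3 : dominates T1 T2 -> dominates T2 T3 -> dominates T1 T3.
Proof. by move=> [f ef] [h eh]; exists (h \o f) => g x /=; rewrite ef eh. Qed.

Lemma collapse_dominates T T' (c : T -> T') : collapse_map c -> dominates T T'.
Proof. by move=> Cc; exists c; exact: collapse_equiv. Qed.

Hypothesis fgG : finitely_generated G.

(** Translates of the geodesics from [p0] to its images under the generators form a connected
    invariant subgraph, which contains all vertices by minimality. *)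
Lemma finite_edges T : exists l : seq (T * T),
  (forall a b, (a, b) \in l -> adj T a b) /\
  forall x y, adj T x y -> exists g a b, [/\ (a, b) \in l, x = act T g a & y = act T g b].
Proof.
have HT := gd T; have [[p0 _] _ _ _ _] := HT; have [gens gensP] := fgG.
pose pth g := projT1 (cid (dist_path HT p0 (act T g p0))).
have pthP g : path (adj T) p0 (pth g) /\ last p0 (pth g) = act T g p0.
  by rewrite /pth; case: cid => p [].
have [vs [vs0 vsP]] : exists vs : seq T, p0 \in vs /\ forall g w, g \in gens -> w \in pth g -> w \in vs.
  exists (p0 :: flatten [seq pth g | g <- gens]); rewrite mem_head; split => // g w hg hw.
  by rewrite inE; apply/orP; right; apply/flattenP; exists (pth g) => //; exact: map_f.
pose l := [seq e <- [seq (a, b) | a <- vs, b <- vs] | adj T e.1 e.2].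
exists l; split; first by move=> a b; rewrite mem_filter => /andP[].
pose E0 := [rel x y : T | `[< exists g a b, [/\ (a, b) \in l, x = act T g a & y = act T g b] >]].
have E0adj : subrel E0 (adj T).
  by move=> x y /asboolP[g [a [b [+ -> ->]]]]; rewrite mem_filter gtree_act_adj => /andP[].
have E0sym x y : E0 x y -> E0 y x.
  move=> /asboolP[g [a [b [+ -> ->]]]]; rewrite mem_filter => /andP[/= ab /allpairsP[[u v] /= [hu hv [Ea Eb]]]].
  apply/asboolP; exists g, b, a; split => //; rewrite mem_filter /= (tree_sym HT b a) ab Ea Eb.
  by apply/allpairsP; exists (v, u).
have E0act g x y : E0 x y -> E0 (act T g x) (act T g y).
  move=> /asboolP[h [a [b [hl -> ->]]]]; apply/asboolP; exists (g * h), a, b.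
  by rewrite !gtree_actM.
pose C x y := exists2 p, path E0 x p & last x p = y.
have Ct x y z : C x y -> C y z -> C x z.
  by move=> [p hp <-] [q hq <-]; exists (p ++ q); rewrite ?cat_path ?hp ?last_cat.
have C1 x y : E0 x y -> C x y by move=> h; exists [:: y] => //; apply/andP.
have Cs x y : C x y -> C y x.
  move=> [p hp <-]; elim: p x hp => [|w p IH] x /=; first by exists [::].
  by move=> /andP[a /IH h]; apply: Ct h _; apply: C1; exact: E0sym.
have Ca g x y : C x y -> C (act T g x) (act T g y).
  move=> [p hp <-]; elim: p x hp => [|w p IH] x /=; first by exists [::].
  by move=> /andP[a /IH h]; apply: Ct h; apply: C1; exact: E0act.
have CG g : C p0 (act T g p0).
  suff : [set g | C p0 (act T g p0)] = setT by move=> E; have : setT g by []; rewrite -E.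
  apply: gensP; first split => /=.
  - by exists [::] => //=; rewrite gtree_act1.
  - by move=> h k ch ck; rewrite gtree_actM; apply: Ct ch _; exact: Ca.
  - by move=> h ch; apply: Cs; rewrite -{2}(actK h p0); exact: Ca.
  - move=> h hg /=; have [h1 h2] := pthP h; exists (pth h) => //.
    apply: (sub_in_path (P := [pred w | w \in vs]) _ _ h1).
      move=> u v hu hv a; apply/asboolP; exists 1, u, v; rewrite !gtree_act1; split => //.
      by rewrite mem_filter a; apply/allpairsP; exists (u, v).
    apply/allP => w; rewrite inE => /orP[/eqP->|wp]; first exact: vs0.
    exact: (vsP h).
have CT z : C p0 z.
  suff : [set z | C p0 z] = setT by move=> E; have : setT z by []; rewrite -E.
  apply: gtree_minimal.
  - by exists p0; exists [::].
  - move=> x y /= /Cs cx cy; have [p hp lp] := Ct _ _ _ cx cy.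
    exists p; split => //; first exact: (sub_path E0adj).
    move=> w /= wp; apply: Ct (Cs _ _ cx) _; case/splitPr: wp hp {lp} => p1 p2.
    rewrite cat_path /= => /and3P[h1 h2 _]; exists (rcons p1 w); last by rewrite last_rcons.
    by rewrite rcons_path h1.
  - by move=> g x /= cx; apply: Ct (CG g) _; exact: Ca.
(* A path of translated edges from [x] to [y] must cross the bridge [(x, y)], which is therefore one
   of these translates. *)
move=> x y a; have [p hp lp] := Ct _ _ _ (Cs _ _ (CT x)) (CT y).
have [nx yy cX] := side_cuts HT a.
have Xl : side (adj T) x y (last x p) by rewrite lp.
have [p1 [b [p2 [E k1 k2 k3]]]] := path_cross (sub_path E0adj hp) nx Xl.
have [E1 E2] := cX _ _ k3 k1 k2; move: hp; rewrite E cat_path /= E1 E2 => /and3P[_ /asboolP h _].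
exact: h.
Qed.

Lemma finite_orbits T : exists s : seq T, forall x, exists g y, y \in s /\ x = act T g y.
Proof.
have [[p0 _] _ _ _ _] := gd T; have [l [_ lP]] := finite_edges T.
exists (p0 :: map fst l) => x; case: (pselect (x = p0)) => [->|ne].
  by exists 1, p0; rewrite mem_head gtree_act1.
have [y [a _ _]] := next_ex (gd T) ne; have [g [u [v [h1 h2 _]]]] := lP _ _ a.
by exists g, u; split => //; rewrite inE; apply/orP; right; apply/mapP; exists (u, v).
Qed.

Lemma equivariant_close T R (f1 f2 : T -> R) : equivariant idfun f1 -> equivariant idfun f2 ->
  exists C, forall z, (dist (adj R) (f1 z) (f2 z) <= C)%N.
Proof.
move=> e1 e2; have [s sP] := finite_orbits T.
have [C HC] : exists C, forall z, z \in s -> (dist (adj R) (f1 z) (f2 z) <= C)%N.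
  elim: s {sP} => [|a s [C HC]]; first by exists 0%N.
  exists (maxn C (dist (adj R) (f1 a) (f2 a))) => z; rewrite inE => /orP[/eqP->|/HC]; lia.
by exists C => z; have [g [y [ys ->]]] := sP z; rewrite e1 e2 act_dist HC.
Qed.

(** Take [q1] and [q2] whose images are far from that of [p] in opposite directions, with [p]
    between them. Once [p] is translated into the half-tree, at least one of the two translated
    branches leads away from [x]. *)
Lemma far_in_side T R (c : T -> R) x y n : collapse_map c -> ~ fixed_point R -> adj T x y ->
  exists2 a, side (adj T) x y a & (n < dist (adj R) (c x) (c a))%N.
Proof.
move=> Cc nf a; have Mc := collapse_monotone Cc; have [HT HR] := (gd T, gd R).
have [[p' _] _ _ _ _] := HR.
have [y1 a1 _] := no_leaf p' p' nf; have [y2 a2 ne] := no_leaf p' y1 nf.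
have [q1' s1 d1] := extend_side n nf a1; have [q2' s2 d2] := extend_side n nf a2.
have n1 : ~ side (adj R) p' y1 q2' by move=> k; apply: ne; exact: (closer_uniq HR a2 a1 s2 k).
have [_ _ cX] := side_cuts HR a1; have [b _] := cut_btw HR a1 cX n1 s1.
have [[q1 Q1] [q2 Q2]] := (collapse_surj Cc q1', collapse_surj Cc q2').
rewrite -Q1 -Q2 in b; have [p bp cp] := lipschitz_hits HT HR (proj1 Mc) b.
have [g sg] := side_orbit p a.
have [q [dq bq]] : exists q, dist (adj R) p' (c q) = n.+1 /\ btw (adj T) x (act T g p) (act T g q).
  case: (pselect (x = act T g p)) => [->|nx]; first by exists q1; rewrite Q1; split => //; exact: btwl.
  have [p1 [e1 _ D1]] := next_ex HT (not_eq_sym nx); have [_ _ cY] := side_cuts HT e1.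
  have sx : side (adj T) (act T g p) p1 x by rewrite /side /= !(dist_sym HT x); lia.
  case: (pselect (side (adj T) (act T g p) p1 (act T g q1))) => h1; last first.
    by exists q1; rewrite Q1; split => //; apply: (btw_sym HT); have [] := cut_btw HT e1 cY h1 sx.
  case: (pselect (side (adj T) (act T g p) p1 (act T g q2))) => h2; last first.
    by exists q2; rewrite Q2; split => //; apply: (btw_sym HT); have [] := cut_btw HT e1 cY h2 sx.
  have := side_convex HT e1 h2 h1 ((act_btw g q2 p q1).2 bp).
  by have [] := side_cuts HT e1.
exists (act T g q).
  move: bq sg; rewrite /side /btw /= !(dist_sym HT _ x) !(dist_sym HT _ y).
  by have := dist_tri HT y (act T g p) (act T g q); lia.
have := mono_btw HT HR Mc bq; rewrite /btw !collapse_equiv // act_dist cp dq; lia.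
Qed.

(** Go far for [c1], then continue beyond that point [a] until far for [c2]: since [a] lies between
    [x] and the new point, the distance gained for [c1] is kept. *)
Lemma far_in_side2 T R1 R2 (c1 : T -> R1) (c2 : T -> R2) x y n :
  collapse_map c1 -> collapse_map c2 -> ~ fixed_point R1 -> ~ fixed_point R2 -> adj T x y ->
  exists a, [/\ side (adj T) x y a, (n < dist (adj R1) (c1 x) (c1 a))%N
                & (n < dist (adj R2) (c2 x) (c2 a))%N].
Proof.
move=> C1 C2 n1 n2 exy; have HT := gd T.
have nT : ~ fixed_point T by move=> /(collapse_fixed C1).
have [a sa da] := far_in_side n C1 n1 exy.
have nx : a <> x by move=> E; move: sa; have [k _ _] := side_cuts HT exy; rewrite E => /k.
have [a0 [e0 b0 D0]] := next_ex HT nx; have [a1 e1 ne] := no_leaf a a0 nT.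
have [b sb db] := far_in_side n C2 n2 e1.
have sx : ~ side (adj T) a a1 x.
  rewrite /side /= => k; apply: ne; apply: (closer_uniq HT (z := x) e1 e0) => //.
  by rewrite !(dist_sym HT x); lia.
have [_ _ cX] := side_cuts HT e1; have [B _] := cut_btw HT e1 cX sx sb.
exists b; split.
- move: B sa; rewrite /side /btw /= !(dist_sym HT _ x) !(dist_sym HT _ y).
  by have := dist_tri HT y a b; lia.
- by have := mono_btw HT (gd R1) (collapse_monotone C1) B; rewrite /btw; lia.
- by have := mono_btw HT (gd R2) (collapse_monotone C2) B; rewrite /btw; lia.
Qed.

Lemma collapse_fix_uniq T R (c : T -> R) g x r : collapse_map c ->
  (forall y, act T g y = y <-> y = x) -> act R g r = r -> r = c x.
Proof.
move=> Cc H gr; have gx : stab x g by apply/H.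
by have [p cp /(_ g gx gr)/H E] := fix_fiber x r Cc; rewrite -cp E.
Qed.

(* For a vertex [x] of valence at least 3, [x'] is the median of the images under [f] of three far away points. *)
Lemma match_vertex T T' R1 R2 (f : T -> T') (c1 : T -> R1) (c2 : T -> R2) (d1 : T' -> R1) (d2 : T' -> R2) :
  equivariant idfun f -> collapse_map c1 -> collapse_map c2 -> collapse_map d1 -> collapse_map d2 ->
  ~ fixed_point R1 -> ~ fixed_point R2 -> forall x, exists x', d1 x' = c1 x /\ d2 x' = c2 x.
Proof.
move=> ef C1 C2 D1 D2 n1 n2 x; have [HT HT'] := (gd T, gd T').
(* At a vertex of valence 2 no median is available, but some element fixes [x] only; it then has a
   single fixed vertex in each collapse of [T], which identifies the images. *)
case: (pselect (valence2 (adj T) x)) => [/gtree_nonredundant[g gx]|nv].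
  have E : act T' g (f x) = f x by rewrite -[act T' g _]ef; congr f; apply/gx.
  by exists (f x); split; apply: (collapse_fix_uniq (g := g)) => //; rewrite -collapse_equiv // E.
have nT : ~ fixed_point T by move=> /(collapse_fixed C1).
have [y1 a1 _] := no_leaf x x nT; have [y2 a2 ne12] := no_leaf x y1 nT.
have [y3 [a3 ne31 ne32]] : exists y3, [/\ adj T x y3, y3 <> y1 & y3 <> y2].
  apply: contrapT => N; apply: nv; exists y1, y2; split; first by apply/eqP => E; apply: ne12.
  move=> w; apply/idP/idP => [a|/orP[]/eqP-> //].
  apply: contrapT => /negP; rewrite negb_or => /andP[/eqP h1 /eqP h2].
  by apply: N; exists w.
have ed1 : equivariant idfun (d1 \o f) by move=> g z /=; rewrite ef collapse_equiv.
have ed2 : equivariant idfun (d2 \o f) by move=> g z /=; rewrite ef collapse_equiv.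
have [K1 H1] := equivariant_close (collapse_equiv C1) ed1.
have [K2 H2] := equivariant_close (collapse_equiv C2) ed2.
(* A single error bound for both targets; the three points are taken farther than [K] so that
   [btw_perturb] applies. *)
pose K := (K1 + K2)%N.
have [z1 [s1 p1 q1]] := far_in_side2 K C1 C2 n1 n2 a1.
have [z2 [s2 p2 q2]] := far_in_side2 K C1 C2 n1 n2 a2.
have [z3 [s3 p3 q3]] := far_in_side2 K C1 C2 n1 n2 a3.
have B y y' z z' : adj T x y -> adj T x y' -> y <> y' -> side (adj T) x y z -> side (adj T) x y' z' ->
    btw (adj T) z x z'.
  move=> a a' ne s s'; have [_ _ cX] := side_cuts HT a'.
  have ns : ~ side (adj T) x y' z by move=> k; apply: ne; exact: (closer_uniq HT a a' s k).
  by have [] := cut_btw HT a' cX ns s'.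
have P R (c : T -> R) (d : T' -> R) z z' : collapse_map c ->
    (forall z, (dist (adj R) (c z) (d (f z)) <= K)%N) -> btw (adj T) z x z' ->
    (K < dist (adj R) (c x) (c z))%N -> (K < dist (adj R) (c x) (c z'))%N ->
    btw (adj R) (d (f z)) (c x) (d (f z')).
  move=> Cc HK b k k'; have HR := gd R; have b' := mono_btw HT HR (collapse_monotone Cc) b.
  have h1 := HK z; have h2 := HK z'.
  have b2 : btw (adj R) (d (f z)) (c x) (c z').
    by apply: (btw_perturb HR b'); rewrite (dist_sym HR (c z) (c x)); lia.
  apply: (btw_sym HR); apply: (btw_perturb HR (btw_sym HR b2)).
  by rewrite (dist_sym HR (c z') (c x)); lia.
have B12 := B _ _ _ _ a1 a2 (not_eq_sym ne12) s1 s2.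
have B23 := B _ _ _ _ a2 a3 (not_eq_sym ne32) s2 s3.
have B13 := B _ _ _ _ a1 a3 (not_eq_sym ne31) s1 s3.
have [m [m12 m23 m13]] := med_ex HT' (f z1) (f z2) (f z3).
have H1' z : (dist (adj R1) (c1 z) (d1 (f z)) <= K)%N by rewrite /K; have /= := H1 z; lia.
have H2' z : (dist (adj R2) (c2 z) (d2 (f z)) <= K)%N by rewrite /K; have /= := H2 z; lia.
exists m; split.
  have M := collapse_monotone D1.
  apply: (med_uniq (gd R1) (a := d1 (f z1)) (b := d1 (f z2)) (c := d1 (f z3))).
    by split; apply: (mono_btw HT' (gd R1) M).
  by split; apply: (P R1 c1).
have M := collapse_monotone D2.
apply: (med_uniq (gd R2) (a := d2 (f z1)) (b := d2 (f z2)) (c := d2 (f z3))).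
  by split; apply: (mono_btw HT' (gd R2) M).
by split; apply: (P R2 c2).
Qed.

(** Case of [match_vertex] where the first target is [T] itself with identity maps, which forces
    [x' = x]. *)
Lemma collapse_uniq T R (c c' : T -> R) : ~ fixed_point R -> collapse_map c -> collapse_map c' -> c = c'.
Proof.
move=> nR Cc Cc'; apply/funext => x; have nT : ~ fixed_point T by move=> /(collapse_fixed Cc).
have [x' [/= -> ->]] // := match_vertex (f := id) (fun _ _ => erefl)
  (collapse_id T) Cc (collapse_id T) Cc' nT nR x.
Qed.

End Collapse.

(** * Quotients of trees *)

Section Quotient.
Variables (G : groupType) (T : gtree G) (r : T -> T -> Prop).
Hypotheses (r_refl : forall x, r x x) (r_sym : forall x y, r x y -> r y x)
  (r_trans : forall x y z, r x y -> r y z -> r x z)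
  (r_act : forall g x y, r x y -> r (act T g x) (act T g y))
  (r_convex : forall x y z, r x y -> btw (adj T) x z y -> r z x).
Let HT := gd T.

(** Classes are encoded by canonical representatives, so that the quotient is a subtype of the
    vertices and again a [choiceType]. *)
Definition class_rep (x : T) : T := choose [pred y : T | `[< r x y >]] x.

Lemma class_repP x : r x (class_rep x).
Proof. by apply/asboolP; apply: (@chooseP _ [pred y : T | `[< r x y >]]); apply/asboolP. Qed.

Lemma class_rep_eq x y : r x y -> class_rep x = class_rep y.
Proof.
move=> h; rewrite /class_rep.
have E : [pred z : T | `[< r x z >]] =1 [pred z : T | `[< r y z >]].
  by move=> z; apply/asboolP/asboolP; apply: r_trans => //; exact: r_sym.
by rewrite (eq_choose E); apply: choose_id; apply/asboolP => //; exact: r_sym.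
Qed.

Definition quotient := {x : T | class_rep x == x}.

Lemma class_repK x : class_rep (class_rep x) == class_rep x.
Proof. by apply/eqP/esym/class_rep_eq/class_repP. Qed.

Definition proj (x : T) : quotient := exist _ (class_rep x) (class_repK x).

Lemma projP x y : proj x = proj y <-> r x y.
Proof.
split=> [[E]|h]; last by apply: val_inj; exact: class_rep_eq.
by apply: r_trans (class_repP x) _; rewrite E; apply: r_sym; exact: class_repP.
Qed.

Lemma val_proj (u : quotient) : proj (val u) = u.
Proof. by apply: val_inj; apply/eqP; exact: (valP u). Qed.

Definition quotient_act g (u : quotient) := proj (act T g (val u)).
Definition quotient_adj : rel quotient := fun u v =>
  `[< u <> v /\ exists x y, [/\ proj x = u, proj y = v & adj T x y] >].

Lemma act_proj g x : quotient_act g (proj x) = proj (act T g x).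
Proof. by apply/projP/r_act/projP; exact: val_proj. Qed.

Lemma proj_lipschitz x y : adj T x y -> proj x = proj y \/ quotient_adj (proj x) (proj y).
Proof.
move=> a; case: (pselect (proj x = proj y)) => h; [by left|right].
by apply/asboolP; split => //; exists x, y.
Qed.

(** The half-tree of a lifted edge is a union of classes: a class meeting both sides would contain
    both ends by convexity. So it descends to a bridge certificate. *)
Lemma quotient_tree : simplicial_tree quotient_adj.
Proof.
have sy : symmetric quotient_adj.
  by move=> u v; apply/asboolP/asboolP => -[ne [x [y [h1 h2 a]]]];
    (split; first by exact: not_eq_sym); exists y, x; rewrite (tree_sym HT).
split => //.
- by have [[x _] _ _ _ _] := HT; exists (proj x).
- by move=> u; apply/asboolP => -[].
- move=> u v _ _; rewrite -(val_proj u) -(val_proj v).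
  have [p [hp lp _]] := dist_path HT (val u) (val v).
  rewrite -lp; elim: p (val u) hp {lp} => [|y p IH] x /=; first by exists [::].
  move=> /andP[a /IH[q [hq lq _]]]; case: (proj_lipschitz a) => [->|a']; first by exists q.
  by exists (proj y :: q); rewrite /= a' hq.
- apply: bridges_acyclic => // u v /asboolP[ne [x [y [Eu Ev a]]]].
  have [nx yy cX] := side_cuts HT a.
  have same z z' : proj z = proj z' -> side (adj T) x y z -> side (adj T) x y z'.
    move=> E sz; apply: contrapT => nz'; have [b1 b2] := cut_btw HT a cX nz' sz.
    have rz : r z' z by apply/projP.
    by apply: ne; rewrite -Eu -Ev; apply/projP; apply: r_trans (r_convex rz b1) (r_sym (r_convex rz b2)).
  exists [set w | exists2 z, side (adj T) x y z & proj z = w]; split => /=.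
  + by move=> [z sz E]; apply: nx; apply: (same z) => //; rewrite E.
  + by exists y.
  + move=> u' v' /asboolP[_ [z [w [<- <- a']]]] nz [w' sw' Ew].
    have nsz : ~ side (adj T) x y z by move=> sz; apply: nz; exists z.
    by have [-> ->] := cX _ _ a' nsz (same _ _ Ew sw').
Qed.
Let HQ := quotient_tree.

Lemma proj_monotone : monotone (adj T) quotient_adj proj.
Proof.
split; first exact: proj_lipschitz.
by move=> x y z /projP h b; apply/projP; exact: r_convex h b.
Qed.
Let MQ := proj_monotone.

Lemma quotient_act1 u : quotient_act 1 u = u.
Proof. by rewrite -(val_proj u) act_proj gtree_act1. Qed.
Lemma quotient_actM g h u : quotient_act (g * h) u = quotient_act g (quotient_act h u).
Proof. by rewrite -(val_proj u) !act_proj gtree_actM. Qed.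

Lemma quotient_act_adj g u v : quotient_adj (quotient_act g u) (quotient_act g v) = quotient_adj u v.
Proof.
have H h a b : quotient_adj a b -> quotient_adj (quotient_act h a) (quotient_act h b).
  move=> /asboolP[ne [x [y [Ea Eb e]]]]; apply/asboolP; split.
    move=> E; apply: ne; rewrite -(quotient_act1 a) -(quotient_act1 b) -(mulVg h).
    by rewrite !quotient_actM E.
  by exists (act T h x), (act T h y); rewrite -!act_proj Ea Eb gtree_act_adj.
apply/idP/idP; last exact: H.
by move=> /(H g^-1); rewrite -!quotient_actM mulVg !quotient_act1.
Qed.

Lemma quotient_noinv g u v : quotient_adj u v -> ~ (quotient_act g u = v /\ quotient_act g v = u).
Proof.
move=> /[dup] a /asboolP[ne [x [y [Eu Ev e]]]] [guv gvu].
have e' : adj T (act T g y) (act T g x) by rewrite gtree_act_adj (tree_sym HT).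
have [E1 E2] : x = act T g y /\ y = act T g x.
  by apply: (lift_uniq HT MQ e e'); rewrite -?act_proj Eu Ev.
by apply: (gtree_noinv e (g := g)).
Qed.

Lemma quotient_minimal (S : set quotient) : S !=set0 -> connected quotient_adj S ->
  (forall g u, S u -> S (quotient_act g u)) -> S = setT.
Proof.
move=> [u Su] cS gS; have E : proj @^-1` S = setT.
  apply: minimal_convex.
  - by exists (val u); rewrite /= val_proj.
  - by apply: (preim_convex HT HQ MQ); exact: (connected_convex HQ).
  - by move=> g x /= Sx; rewrite -act_proj; exact: gS.
apply/seteqP; split => // w _; rewrite -(val_proj w).
by have : (proj @^-1` S) (val w) by rewrite E.
Qed.

(** If no element fixing [u] exchanges its two neighbours, the stabilizer of [u] fixes the two
    lifted edges leaving the fiber. Minimality reduces the fiber to the segment [[y1, y2]], so [y1]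
    has valence 2 in [T]; the element fixing only [y1] would also fix [z1]. *)
Lemma quotient_nonredundant u : valence2 quotient_adj u ->
  exists g, forall v, quotient_act g v = v <-> v = u.
Proof.
move=> [u1 [u2 [/eqP ne12 H]]].
have a1 : quotient_adj u u1 by rewrite H eqxx.
have a2 : quotient_adj u u2 by rewrite H eqxx orbT.
have HV w : quotient_adj u w -> w = u1 \/ w = u2.
  by rewrite H => /orP[/eqP|/eqP]; [left|right].
have Qinj g : injective (quotient_act g).
  by move=> v w E; rewrite -(quotient_act1 v) -(quotient_act1 w) -(mulVg g) !quotient_actM E.
case: (pselect (exists g, quotient_act g u = u /\ quotient_act g u1 = u2)) => [[g [gu g12]]|N].
  (* An element exchanging the neighbours fixes nothing else: it would fix the neighbour of [u] in
     the direction of another fixed vertex. *)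
  exists g => v; split => [gv|-> //]; apply: contrapT => nv.
  have [u' [e' b' d']] := next_ex HQ (not_eq_sym nv).
  have gu' : quotient_act g u' = u'.
    apply: (closer_uniq HQ (z := v) (x := u)) => //; first by rewrite -{1}gu quotient_act_adj.
      have L : lipschitz quotient_adj quotient_adj (quotient_act g).
        by move=> x y xy; right; rewrite quotient_act_adj.
      have := lipschitz_dist HQ HQ v u' L; rewrite gv (dist_sym HQ v u) (dist_sym HQ v u'); lia.
    by rewrite !(dist_sym HQ v); lia.
  case: (HV _ e') => E; rewrite E in gu'; first by rewrite g12 in gu'; case: ne12.
  by apply: ne12; apply: (Qinj g); rewrite g12.
have fixu g : quotient_act g u = u -> quotient_act g u1 = u1 /\ quotient_act g u2 = u2.
  move=> gu; have h1 : quotient_act g u1 = u1.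
    case: (HV (quotient_act g u1)) => //; first by rewrite -{1}gu quotient_act_adj.
    by move=> k; case: N; exists g.
  split => //; case: (HV (quotient_act g u2)) => //; first by rewrite -{1}gu quotient_act_adj.
  by rewrite -h1 => /Qinj E; case: ne12.
have [y1 [z1 [Y1 Z1 b1]]] := lift_adj HT HQ MQ (val_proj u) (val_proj u1) a1.
have [y2 [z2 [Y2 Z2 b2]]] := lift_adj HT HQ MQ (val_proj u) (val_proj u2) a2.
have n1 : u <> u1 by move=> E; rewrite -E (tree_irr HQ) in a1.
have n2 : u <> u2 by move=> E; rewrite -E (tree_irr HQ) in a2.
have fixl g : quotient_act g u = u -> act T g y1 = y1 /\ act T g z1 = z1.
  move=> /[dup] gu /fixu[g1 _]; have a : adj T (act T g y1) (act T g z1) by rewrite gtree_act_adj.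
  by apply: (lift_uniq HT MQ a b1); rewrite -!act_proj ?Y1 ?Z1 ?gu ?g1.
have proju x y : proj x = u -> proj y = u -> forall z, btw (adj T) x z y -> proj z = u.
  by move=> hx hy z b; rewrite (proj2 MQ x y z) // hx.
(* Geodesics leave the fiber of [u] only through [y1] or [y2]. *)
have exit x p i yi zi : proj x = u -> proj yi = u -> proj zi = i -> adj T yi zi -> u <> i ->
    btw quotient_adj u i (proj p) -> btw (adj T) x yi p.
  move=> hx hyi hzi bi ni bq; have [nX XX cX] := side_cuts HT bi.
  have nx : ~ side (adj T) yi zi x.
    move=> k; have [_ b] := cut_btw HT bi cX nX k.
    by apply: ni; rewrite -hzi (proju _ _ hyi hx _ b).
  suff Xp : side (adj T) yi zi p by have [] := cut_btw HT bi cX nx Xp.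
  apply: contrapT => nXp; rewrite -hx in bq.
  have [w bw hw] := lipschitz_hits HT HQ (proj1 MQ) bq.
  have bi' : adj T zi yi by rewrite (tree_sym HT).
  have nw : ~ side (adj T) yi zi w.
    have sw := side_convex HT bi' (side_sym HT bi nx) (side_sym HT bi nXp) bw.
    by move: sw; rewrite /side /=; lia.
  have [b _] := cut_btw HT bi cX nw XX.
  have E : proj w = proj zi by rewrite hw hzi.
  by apply: ni; rewrite -hyi (proj2 MQ _ _ _ E b) hw.
(* For convexity of [W]: from a point of the fiber, geodesics to translates of points of [W] pass
   through its gate [m] on [[y1, y2]]. A point lying between two such translates is therefore equal
   to [m]. *)
pose W := [set x : T | forall g, proj (act T g x) = u -> btw (adj T) y1 (act T g x) y2].
have WT : W = setT.
  apply: minimal_convex.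
  - exists y1 => g; rewrite -act_proj Y1 => /fixl[-> _]; exact: btwl.
  - move=> a b x Wa Wb bx g gx; apply: contrapT => nb.
    have bx' := (act_btw g a x b).2 bx.
    have [m /= bm Hm] := gate_ex HT (act T g x) (ex_intro _ y1 (btwl (adj T) y1 y2)) (@interval_convex _ _ HT y1 y2).
    have toward p : W p -> btw (adj T) (act T g x) m (act T g p).
      move=> Wp; case: (pselect (proj (act T g p) = u)) => [/Wp/Hm //|np].
      have [i [ei bi _]] := next_ex HQ (not_eq_sym np).
      have [y by1 by2] : exists2 y, btw (adj T) y1 y y2 & btw (adj T) (act T g x) y (act T g p).
        case: (HV _ ei) => E; rewrite E in bi.
          by exists y1; [exact: btwl|apply: (exit _ _ u1 y1 z1)].
        by exists y2; [exact: btwr|apply: (exit _ _ u2 y2 z2)].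
      have := Hm _ by1; have := dist_tri HT (act T g x) m (act T g p).
      have := dist_tri HT m y (act T g p); rewrite /btw in by2 *; lia.
    have ta := toward _ Wa; have tb := toward _ Wb.
    have d0 : dist (adj T) (act T g x) m <> 0%N by move=> /(dist0 HT) E; apply: nb; rewrite E.
    have := dist_tri HT (act T g a) m (act T g b); move: bx' ta tb.
    rewrite /btw (dist_sym HT (act T g a) (act T g x)) (dist_sym HT (act T g a) m); lia.
  - by move=> g x Wx h; rewrite -gtree_actM; exact: Wx.
have fib x : proj x = u -> btw (adj T) y1 x y2.
  have : W x by rewrite WT.
  by move=> /(_ 1); rewrite gtree_act1.
have nbr w : adj T y1 w -> [\/ proj w = u, w = z1 | y1 = y2 /\ w = z2].
  move=> a; case: (proj1 MQ _ _ a) => [<-|]; first by rewrite Y1; constructor 1.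
  rewrite Y1 => /HV[] E.
    constructor 2; have [//|||_ ->] // := lift_uniq HT MQ a b1 => //; rewrite ?Y1 ?E ?Z1 //.
  constructor 3; apply: (lift_uniq HT MQ a b2); by rewrite ?Y1 ?Y2 ?E ?Z2.
have V1 : valence2 (adj T) y1.
  case: (pselect (y1 = y2)) => E12.
    exists z1, z2; split; first by apply/eqP => E; apply: ne12; rewrite -Z1 -Z2 E.
    move=> w; apply/idP/idP => [a|/orP[]/eqP-> //]; last by rewrite E12.
    case: (nbr _ a) => [/fib|->|[_ ->]]; rewrite ?eqxx ?orbT //.
    rewrite -E12 /btw distxx (dist_sym HT w) (dist_adj HT a); lia.
  have [n [en bn dn]] := next_ex HT E12.
  exists z1, n; split; first by apply/eqP => E; apply: n1; rewrite -Z1 E (proju _ _ Y1 Y2 _ bn).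
  move=> w; apply/idP/idP => [a|/orP[]/eqP-> //].
  case: (nbr _ a) => [/fib b|->|[/E12]] //; last by rewrite eqxx.
  apply/orP; right; apply/eqP; apply: (closer_uniq HT (z := y2) a en).
    by rewrite !(dist_sym HT y2); move: b; rewrite /btw (dist_adj HT a); lia.
  by rewrite !(dist_sym HT y2); lia.
have [g gP] := gtree_nonredundant V1.
have gy : act T g y1 = y1 by apply/gP.
have gu : quotient_act g u = u by rewrite -Y1 act_proj gy.
have [_ /gP E] := fixl _ gu.
by rewrite E (tree_irr HT) in b1.
Qed.

Definition quotient_gtree : gtree G :=
  GTree quotient_tree quotient_act1 quotient_actM quotient_act_adj quotient_noinv
    quotient_minimal quotient_nonredundant.

Lemma quotient_ex : exists (T' : gtree G) (c : T -> T'),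
  collapse_map c /\ forall x y, c x = c y <-> r x y.
Proof.
exists quotient_gtree, proj; split; last exact: projP.
apply/collapseP; split; [by move=> g x; rewrite /= act_proj| |exact: proj_monotone].
by move=> u; exists (val u); exact: val_proj.
Qed.

End Quotient.

(** * Least common refinements *)

Section Lcm.
Variable G : groupType.
Implicit Types T R S : gtree G.

(** Joint injectivity expresses leastness: no edge is collapsed by both maps. *)
Definition is_lcm T1 T2 T (c1 : T -> T1) (c2 : T -> T2) :=
  [/\ collapse_map c1, collapse_map c2 & forall x y, c1 x = c1 y -> c2 x = c2 y -> x = y].

Lemma lcm_of_refinement S T1 T2 (f1 : S -> T1) (f2 : S -> T2) : collapse_map f1 -> collapse_map f2 ->
  exists T (c : S -> T) (c1 : T -> T1) (c2 : T -> T2), collapse_map c /\ is_lcm c1 c2.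
Proof.
move=> C1 C2; have [M1 M2] := (collapse_monotone C1, collapse_monotone C2).
pose r x y := f1 x = f1 y /\ f2 x = f2 y.
have [|||||T [c [Cc Ec]]] := @quotient_ex G S r; rewrite /r //.
- by move=> x y [-> ->].
- by move=> x y z [-> ->].
- by move=> g x y [h1 h2]; rewrite !collapse_equiv // h1 h2.
- by move=> x y z [h1 h2] b; rewrite (proj2 M1 x y z) // (proj2 M2 x y z).
have [c1 Cc1 E1] := collapse_factor Cc C1 (fun x y h => ((Ec x y).1 h).1).
have [c2 Cc2 E2] := collapse_factor Cc C2 (fun x y h => ((Ec x y).1 h).2).
exists T, c, c1, c2; split => //; split => // u v.
have [[x <-] [y <-]] := (collapse_surj Cc u, collapse_surj Cc v).
by rewrite !E1 !E2 => h1 h2; apply/Ec.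
Qed.

Lemma lcm_ex T1 T2 : compatible T1 T2 -> exists T (c1 : T -> T1) (c2 : T -> T2), is_lcm c1 c2.
Proof.
by move=> [S [f1 [f2 [C1 C2]]]]; have [T [_ [c1 [c2 [_ H]]]]] := lcm_of_refinement C1 C2; exists T, c1, c2.
Qed.

(** The stabilizer of [x] fixes [f1 x], hence preserves the fiber over it, which [c2] embeds as a
    convex subset of [T2]. The gate of [f2 x] on this subset is fixed and lifts to a fixed vertex of
    [T]. *)
Lemma lcm_dominated T1 T2 T T' (c1 : T -> T1) (c2 : T -> T2) : is_lcm c1 c2 ->
  dominates T' T1 -> dominates T' T2 -> dominates T' T.
Proof.
move=> [C1 C2 J] [f1 e1] [f2 e2]; apply/dominatesP => x.
have [y0 Y0] := collapse_surj C1 (f1 x).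
have cS := image_convex (gd T) (gd T2) (collapse_monotone C2) (fiber_convex (collapse_monotone C1) (u := f1 x)).
have [_ [p cp <-] H] := gate_ex (gd T2) (f2 x) (ex_intro _ (c2 y0) (ex_intro2 _ _ y0 Y0 erefl)) cS.
exists p => g gx; rewrite /stab /= in gx cp *.
have gp : c1 (act T g p) = f1 x by rewrite collapse_equiv // cp -[act _ _ _]e1 gx.
apply: J; first by rewrite gp cp.
have h : stab (c2 p) g.
  apply: (fix_gate (S := c2 @` [set x0 | c1 x0 = f1 x]) (z := f2 x)) => //.
  - move=> _ [y /= cy <-]; exists (act T g y); last exact: collapse_equiv.
    by rewrite /= collapse_equiv // cy -[act _ _ _]e1 gx.
  - by rewrite /stab /= -[act _ _ _]e2 gx.
by rewrite collapse_equiv.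
Qed.

Lemma btw_lipschitz (T T' : gtree G) (f : T -> T') (h : T' -> T) : cancel f h -> cancel h f ->
  (forall x y z, btw (adj T') x z y -> btw (adj T) (h x) (h z) (h y)) ->
  forall x y, adj T x y -> adj T' (f x) (f y).
Proof.
move=> fK hK H x y a; have [HT HT'] := (gd T, gd T').
have ne : f x <> f y by move=> /(can_inj fK) E; rewrite E (tree_irr HT) in a.
have [n [en bn _]] := next_ex HT' ne; have := H _ _ _ bn; rewrite !fK /btw (dist_adj HT a) => D.
case D1: (dist (adj T) x (h n)) => [|k].
  by move: en; rewrite -(hK n) -(dist0 HT D1) (tree_irr HT').
have /(dist0 HT) E : dist (adj T) (h n) y = 0%N by lia.
by rewrite -E hK.
Qed.

Hypothesis fgG : finitely_generated G.

(** [match_vertex], used in both directions, gives inverse vertex maps. They preserve betweenness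
    because medians are determined by their images in [T1] and [T2]; adjacency follows. *)
Lemma lcm_uniq T1 T2 T T' (c1 : T -> T1) (c2 : T -> T2) (d1 : T' -> T1) (d2 : T' -> T2) :
  ~ fixed_point T1 -> ~ fixed_point T2 -> is_lcm c1 c2 -> is_lcm d1 d2 ->
  exists f : T -> T', equivariant_iso idfun f.
Proof.
move=> n1 n2 L L'; have [C1 C2 J] := L; have [D1 D2 J'] := L'.
have [k ek] := lcm_dominated L' (collapse_dominates C1) (collapse_dominates C2).
have [k' ek'] := lcm_dominated L (collapse_dominates D1) (collapse_dominates D2).
have M := match_vertex fgG ek C1 C2 D1 D2 n1 n2.
have M' := match_vertex fgG ek' D1 D2 C1 C2 n1 n2.
pose f x := projT1 (cid (M x)); pose h y := projT1 (cid (M' y)).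
have fP x : d1 (f x) = c1 x /\ d2 (f x) = c2 x by rewrite /f; case: cid.
have hP y : c1 (h y) = d1 y /\ c2 (h y) = d2 y by rewrite /h; case: cid.
have fK : cancel f h.
  by move=> x; have [a b] := fP x; have [a' b'] := hP (f x); apply: J; rewrite ?a' ?a ?b' ?b.
have hK : cancel h f.
  by move=> x; have [a b] := hP x; have [a' b'] := fP (h x); apply: J'; rewrite ?a' ?a ?b' ?b.
have [HT HT'] := (gd T, gd T').
have B (S S' : gtree G) (a1 : S -> T1) (a2 : S -> T2) (b1 : S' -> T1) (b2 : S' -> T2) (u : S -> S') :
    is_lcm a1 a2 -> is_lcm b1 b2 -> (forall x, b1 (u x) = a1 x /\ b2 (u x) = a2 x) ->
    forall x y z, btw (adj S) x z y -> btw (adj S') (u x) (u z) (u y).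
  move=> [A1 A2 _] [B1 B2 Jb] uP x y z b.
  have [m [m1 m2 m3]] := med_ex (gd S') (u x) (u z) (u y).
  suff -> : u z = m by [].
  have E R (a : S -> R) (b' : S' -> R) : collapse_map a -> collapse_map b' ->
      (forall x, b' (u x) = a x) -> b' (u z) = b' m.
    move=> Ca Cb E; have [Ma Mb] := (collapse_monotone Ca, collapse_monotone Cb).
    apply: (med_uniq (gd R) (a := b' (u x)) (b := b' (u z)) (c := b' (u y))).
      split; [exact: btwr|exact: btwl|rewrite !E]; exact: (mono_btw (gd S) (gd R) Ma).
    by split; apply: (mono_btw (gd S') (gd R) Mb).
  apply: Jb; [apply: (E _ a1) => // w|apply: (E _ a2) => // w]; by have [] := uP w.
have Bf := B _ _ _ _ _ _ f L L' fP; have Bh := B _ _ _ _ _ _ h L' L hP.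
exists f; split; first by exists h.
  move=> x y; apply/idP/idP; last exact: (btw_lipschitz fK hK Bh).
  by move=> /(btw_lipschitz hK fK Bf); rewrite !fK.
move=> g x; have [a b] := fP (act T g x); have [a' b'] := fP x.
by apply: J'; rewrite ?a ?b !collapse_equiv // ?a' ?b'.
Qed.

(** * Universal compatibility of refinements and uniqueness of the JSJ space *)

Section Family.
Variable A : set (set G).
Hypothesis admA : admissible_family A.

Lemma edge_stabilizer_subgroup T (x y : T) : subgroup (edge_stabilizer x y).
Proof.
split=> [|g h [gx gy] [hx hy]|g [gx gy]]; split; rewrite ?gtree_act1 ?gtree_actM ?hx ?hy //.
  by rewrite -[in LHS]gx actK.
by rewrite -[in LHS]gy actK.
Qed.

Lemma A_edge T T' (x y : T) (u v : T') : A (edge_stabilizer u v) ->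
  edge_stabilizer x y `<=` edge_stabilizer u v -> A (edge_stabilizer x y).
Proof. by move=> Au s; have [_ _ H] := admA; apply: H Au _ s; exact: edge_stabilizer_subgroup. Qed.

Lemma lcm_A_tree T1 T2 T (c1 : T -> T1) (c2 : T -> T2) : is_lcm c1 c2 ->
  A_tree A T1 -> A_tree A T2 -> A_tree A T.
Proof.
move=> [C1 C2 J] A1 A2 x y a.
case: (proj1 (collapse_monotone C1) _ _ a) => [E1|a1]; last first.
  by apply: A_edge (A1 _ _ a1) _ => g [gx gy]; split; rewrite -collapse_equiv // ?gx ?gy.
case: (proj1 (collapse_monotone C2) _ _ a) => [E2|a2]; last first.
  by apply: A_edge (A2 _ _ a2) _ => g [gx gy]; split; rewrite -collapse_equiv // ?gx ?gy.
by rewrite (J x y) // (tree_irr (gd T)) in a.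
Qed.

Lemma collapse_A_tree T T' (c : T -> T') : collapse_map c -> A_tree A T -> A_tree A T'.
Proof.
move=> Cc AT u v a; have M := collapse_monotone Cc.
have [[x cx] [y cy]] := (collapse_surj Cc u, collapse_surj Cc v).
have [x' [y' [Ex Ey a']]] := lift_adj (gd T) (gd T') M cx cy a.
apply: A_edge (AT _ _ a') _ => g [gu gv].
have ga : adj T (act T g x') (act T g y') by rewrite gtree_act_adj.
have ne : u <> v by move=> E; rewrite E (tree_irr (gd T')) in a.
by have [] := lift_uniq (gd T) M ga a'; rewrite ?collapse_equiv ?Ex ?Ey ?gu ?gv.
Qed.

Lemma UC_collapse T T' (c : T -> T') : collapse_map c -> universally_compatible A T ->
  universally_compatible A T'.
Proof.
move=> Cc [AT UT]; split; first exact: collapse_A_tree Cc AT.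
move=> S AS; have [R [f1 [f2 [C1 C2]]]] := UT S AS.
by exists R, (c \o f1), f2; split => //; exact: collapse_comp.
Qed.

Lemma UC_compatible T T' : universally_compatible A T -> universally_compatible A T' -> compatible T T'.
Proof. by move=> [_ U] [AT' _]; exact: U. Qed.

(** Refine [S] by [T1], then the result by [T2]. The common refinement [S2] collapses onto some lcm
    of [T1] and [T2], which is [T] by uniqueness. *)
Lemma lcm_UC T1 T2 T (c1 : T -> T1) (c2 : T -> T2) : is_lcm c1 c2 ->
  ~ fixed_point T1 -> ~ fixed_point T2 ->
  universally_compatible A T1 -> universally_compatible A T2 -> universally_compatible A T.
Proof.
move=> L n1 n2 [A1 U1] [A2 U2]; split; first exact: lcm_A_tree L A1 A2.
move=> S AS; have [S1 [a [b Lab]]] := lcm_ex (U1 S AS).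
have [Ca Cb _] := Lab.
have [S2 [u [v [Cu Cv]]]] := U2 S1 (lcm_A_tree Lab A1 AS).
have [T' [c [d1 [d2 [Cc L']]]]] := lcm_of_refinement (collapse_comp Cv Ca) Cu.
have [f isof] := lcm_uniq n1 n2 L' L.
exists S2, (f \o c), (b \o v); split; apply: collapse_comp => //; exact: iso_collapse.
Qed.

Definition space_of T := fun T' => deformation_space T T' /\ A_tree A T'.

Lemma deformation_sym T T' : deformation_space T T' -> deformation_space T' T.
Proof. by move=> []. Qed.
Lemma deformation_trans T1 T2 T3 : deformation_space T1 T2 -> deformation_space T2 T3 -> deformation_space T1 T3.
Proof. by move=> [a b] [c d]; split; [exact: dominates_trans a c|exact: dominates_trans d b]. Qed.
Lemma deformation_refl T : deformation_space T T.
Proof. by split; exists id. Qed.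

Lemma A_deformation_spaceE D T : A_deformation_space A D -> D T -> D = space_of T.
Proof.
move=> [T0 A0 ->] [d AT]; apply/funext => T'; apply/propext; split => -[d' AT']; split => //.
  exact: deformation_trans (deformation_sym d) d'.
exact: deformation_trans d d'.
Qed.

Lemma space_not_fixed D T : A_deformation_space A D -> irreducible_space D -> D T -> ~ fixed_point T.
Proof.
move=> AD [T0 D0 [nf _ _]] DT [x fx]; apply: nf.
move: D0; rewrite (A_deformation_spaceE AD DT) => -[[[f ef] _] _].
by exists (f x) => g; rewrite -[act _ _ _]ef fx.
Qed.

Lemma lcm_space D T1 T2 T (c1 : T -> T1) (c2 : T -> T2) : is_lcm c1 c2 ->
  A_deformation_space A D -> D T1 -> D T2 -> D T.
Proof.
move=> L AD; move=> /[dup] /(A_deformation_spaceE AD) -> D1 [[d1 d2] A2].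
have [C1 C2 _] := L; have [_ A1] := D1.
split; last exact: lcm_A_tree L A1 A2.
split; last exact: collapse_dominates C1.
by apply: lcm_dominated L _ d1; exists id.
Qed.

(** The definition only asks for a maximal element. The lcm of universally compatible trees of the
    two spaces lies in a space dominating both, hence equal to both. *)
Lemma JSJ_uniq D1 D2 : compatibility_JSJ_space A D1 -> irreducible_space D1 ->
  compatibility_JSJ_space A D2 -> irreducible_space D2 -> D1 = D2.
Proof.
move=> [[AD1 [T1 DT1 U1]] M1] I1 [[AD2 [T2 DT2 U2]] M2] I2.
have n1 := space_not_fixed AD1 I1 DT1; have n2 := space_not_fixed AD2 I2 DT2.
have [T [c1 [c2 L]]] := lcm_ex (UC_compatible U1 U2).
have UT := lcm_UC L n1 n2 U1 U2; have [C1 C2 _] := L.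
have US : universally_compatible_space A (space_of T).
  split; first by exists T => //; exact: UT.1.
  by exists T => //; split; [exact: deformation_refl|exact: UT.1].
have E1 : space_of T = D1.
  apply: M1 => // T' T'' [[_ d] _]; rewrite (A_deformation_spaceE AD1 DT1) => -[[d' _] _].
  exact: dominates_trans d (dominates_trans (collapse_dominates C1) d').
suff <- : space_of T = D2 by rewrite E1.
apply: M2 => // T' T'' [[_ d] _]; rewrite (A_deformation_spaceE AD2 DT2) => -[[d' _] _].
exact: dominates_trans d (dominates_trans (collapse_dominates C2) d').
Qed.

End Family.
End Lcm.

(** * Sliding an edge twice around an ascending loop *)

Lemma cuts_compl (V : choiceType) (e : rel V) (X : set V) x y : symmetric e -> cuts e X x y -> cuts e (~` X) y x.
Proof.
move=> sy cX a b eab nna nb; have Xa : X a by apply: contrapT.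
by have [-> ->] := cX b a ltac:(by rewrite sy) nb Xa.
Qed.

Section Slide.
Variables (G : groupType) (T : gtree G) (t : G) (v x : T).
Let HT := gd T.
Local Notation "g *> a" := (act T g a) (at level 30, right associativity).
Hypotheses (avt : adj T v (t *> v)) (up : stab v `<=` stab (t *> v))
  (strict : exists2 g, stab (t *> v) g & ~ stab v g)
  (avx : adj T v x) (xup : x <> t *> v) (xdown : forall h, stab v h -> x <> h *> t^-1 *> v).
Let y := t *> t *> v.
Let X := side (adj T) v x.
Let cX : cuts (adj T) X v x. Proof. by case: (side_cuts HT avx). Qed.
Let nXv : ~ X v. Proof. by case: (side_cuts HT avx). Qed.
Let Xx : X x. Proof. by case: (side_cuts HT avx). Qed.

Definition moved a b := exists2 g, a = g *> v & b = g *> x.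
Definition moved_to a b := exists2 g, a = g *> y & b = g *> x.
(** Vertices and action are kept; only the orbit of the edge [(v, x)] is reattached, at [t^2 v]. By
    [fix_y], the stabilizer of the old edge also fixes the new one. *)
Definition slide_adj : rel T := fun a b =>
  `[< [/\ adj T a b, ~ moved a b & ~ moved b a] \/ (moved_to a b \/ moved_to b a) >].

Lemma up2 h : stab (t *> v) h -> stab y h.
Proof.
move=> s; rewrite /y; apply/stab_conj; apply: up.
by move: s => /stab_conj.
Qed.
Lemma fix_y h : stab v h -> stab y h. Proof. by move=> /up/up2. Qed.

Lemma v_neq_y : v <> y.
Proof. by move=> E; apply: (gtree_noinv avt (g := t)). Qed.

Lemma up_not_moved g : ~ moved (g *> v) (g *> t *> v).
Proof.
move=> [h E1 E2]; apply: xup; have s : stab v (h^-1 * g) by rewrite /stab /= gtree_actM E1 actK.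
by have := up s; rewrite /stab /= gtree_actM E2 actK.
Qed.

Lemma down_not_moved g : ~ moved (g *> t *> v) (g *> v).
Proof.
move=> [h E1 E2]; apply: (xdown (h := h^-1 * g * t)).
  by rewrite /stab /= !gtree_actM E1 actK.
by rewrite !gtree_actM actVK E2 actK.
Qed.

Lemma X_step a b : adj T a b -> ~ moved a b -> ~ moved b a -> X a -> X b.
Proof.
move=> ab n1 n2 Xa; apply: contrapT => nXb; apply: n2.
have ba : adj T b a by rewrite (tree_sym HT).
by have [-> ->] := cX ba nXb Xa; exists 1; rewrite gtree_act1.
Qed.

Lemma adj_up g : adj T (g *> v) (g *> t *> v). Proof. by rewrite gtree_act_adj. Qed.
Lemma adj_down g : adj T (g *> t *> v) (g *> v). Proof. by rewrite (tree_sym HT) adj_up. Qed.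

Lemma X_up g : X (g *> v) <-> X (g *> t *> v).
Proof.
split; apply: X_step; rewrite ?adj_up ?adj_down //; [exact: up_not_moved|exact: down_not_moved|
  exact: down_not_moved|exact: up_not_moved].
Qed.

Lemma X_y g : X (g *> y) <-> X (g *> v).
Proof. by rewrite /y -(gtree_actM g) -X_up gtree_actM -X_up. Qed.

Lemma nXy : ~ X y.
Proof. by have := X_y 1; rewrite !gtree_act1 => -[h _] /h. Qed.

Lemma X_moved_to g : X (g *> y) -> X (g *> x).
Proof.
move=> /X_y Xg; apply: contrapT => nX.
have a : adj T (g *> x) (g *> v) by rewrite gtree_act_adj (tree_sym HT).
have [E1 E2] := cX a nX Xg; exact: (gtree_noinv avx (g := g)).
Qed.

(** [v], [tv] and [y] are joined by loop edges, none of which crosses into [X]; so the half-tree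
    carried by the edge is unchanged by the slide. *)
Lemma X_cuts : cuts slide_adj X y x.
Proof.
move=> a b /asboolP[[ab n1 n2]|[[g -> ->]|[g -> ->]]] na Xb.
- by case: na; apply: X_step Xb => //; rewrite (tree_sym HT).
- have [Ev Ex] : g *> v = v /\ g *> x = x.
    by apply: cX => //; [rewrite gtree_act_adj|move=> /X_y].
  by split => //; exact: fix_y.
- by case: na; exact: X_moved_to.
Qed.

Lemma slide_sym : symmetric slide_adj.
Proof.
by move=> a b; apply/asboolP/asboolP => -[[ab n1 n2]|[h|h]];
  [left; rewrite (tree_sym HT)|right; right|right; left|left; rewrite (tree_sym HT)|right; right|right; left].
Qed.

Lemma slide_act g a b : slide_adj (g *> a) (g *> b) = slide_adj a b.
Proof.
have H h c d z : (exists2 k, c = k *> z & d = k *> x) -> exists2 k, h *> c = k *> z & h *> d = k *> x.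
  by move=> [k -> ->]; exists (h * k); rewrite gtree_actM.
have H' h c d z : (exists2 k, h *> c = k *> z & h *> d = k *> x) -> exists2 k, c = k *> z & d = k *> x.
  by move=> /(H h^-1); rewrite !actK.
apply/asboolP/asboolP => -[[ab n1 n2]|[h|h]].
- left; rewrite gtree_act_adj in ab; split => // h; [apply: n1|apply: n2]; exact: H.
- by right; left; apply: H' h.
- by right; right; apply: H' h.
- left; rewrite gtree_act_adj; split => // /H' h; [exact: n1|exact: n2].
- by right; left; apply: H h.
- by right; right; apply: H h.
Qed.

Lemma slide_up g : slide_adj (g *> v) (g *> t *> v).
Proof.
by apply/asboolP; left; split; [exact: adj_up|exact: up_not_moved|exact: down_not_moved].
Qed.
Lemma slide_down g : slide_adj (g *> t *> v) (g *> v).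
Proof. by rewrite slide_sym slide_up. Qed.
Lemma slide_new g : slide_adj (g *> y) (g *> x).
Proof. by apply/asboolP; right; left; exists g. Qed.

Lemma cuts_translate (Z : set T) a b g : cuts slide_adj Z a b ->
  cuts slide_adj [set z | Z (g^-1 *> z)] (g *> a) (g *> b).
Proof.
move=> cZ c d cd nc Zd; rewrite -(slide_act g^-1) in cd.
by have [<- <-] := cZ _ _ cd nc Zd; rewrite !actVK.
Qed.

Let Z := side (adj T) v (t *> v).
Let cZ : cuts (adj T) Z v (t *> v). Proof. by case: (side_cuts HT avt). Qed.
Let nZv : ~ Z v. Proof. by case: (side_cuts HT avt). Qed.
Let Ztv : Z (t *> v). Proof. by case: (side_cuts HT avt). Qed.

Lemma Z_up g : Z (g *> v) -> Z (g *> t *> v).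
Proof.
move=> Zg; apply: contrapT => nZ; have [E1 E2] := cZ (adj_down g) nZ Zg.
by apply: (gtree_noinv avt (g := g)).
Qed.

Lemma Zy : Z y.
Proof. by have := Z_up (g := t) Ztv. Qed.

Lemma Z_moved g : Z (g *> v) <-> Z (g *> x).
Proof.
have a : adj T (g *> v) (g *> x) by rewrite gtree_act_adj.
split=> h; apply: contrapT => n.
  have a' : adj T (g *> x) (g *> v) by rewrite (tree_sym HT).
  by have [E1 E2] := cZ a' n h; case: (@down_not_moved 1); rewrite !gtree_act1; exists g.
by have [E1 E2] := cZ a n h; case: (@up_not_moved 1); rewrite !gtree_act1; exists g.
Qed.

(* The side of the edge [(v, tv)] in the new tree: the branches slid across this edge change sides. *)
Let Z' : set T := [set z | Z z \/ exists2 g, X (g^-1 *> z) & g *> v = v \/ g *> t *> v = v].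

Lemma Z'_cuts : cuts slide_adj Z' v (t *> v).
Proof.
have ysZ g : g *> v = v \/ g *> t *> v = v -> Z (g *> y).
  move=> [E|E].
    by have -> : g *> y = y by [exact: fix_y]; exact: Zy.
  have s : stab v (g * t) by rewrite /stab /= gtree_actM.
  by rewrite /y -(gtree_actM g) (up s).
move=> a b ab na [Zb|[g Xg sg]]; last first.
  have [E1 E2] := cuts_translate (g := g) X_cuts ab (fun h => na (or_intror (ex_intro2 _ _ g h sg))) Xg.
  by case: na; left; rewrite E1; exact: ysZ.
have nZa : ~ Z a by move=> h; apply: na; left.
move: ab => /asboolP[[ab _ _]|[[g Ea Eb]|[g Eb Ea]]]; first exact: cZ.
  have Zg : Z (g *> v) by apply/Z_moved; rewrite -Eb.
  by case: nZa; rewrite Ea; have := Z_up Zg; rewrite -gtree_actM => /Z_up; rewrite gtree_actM.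
have nZg : ~ Z (g *> v) by move=> /Z_moved; rewrite -Ea.
case: na; right; exists g; first by rewrite Ea actK.
(* The path from [gv] through [gtv] to [gy] enters [Z] by one of its two edges, which must be
   [(v, tv)]; this gives the two alternatives in [Z']. *)
case: (pselect (Z (g *> t *> v))) => h.
  by have [] := cZ (adj_up g) nZg h; left.
have Zg : Z ((g * t) *> t *> v) by rewrite gtree_actM -Eb.
have h' : ~ Z ((g * t) *> v) by rewrite gtree_actM.
by have [] := cZ (adj_up (g * t)) h' Zg; rewrite gtree_actM; right.
Qed.

(** Three kinds of edges: translates of the new edge are cut by [X], those of the loop by [Z']. Any
    other edge keeps its half-tree, as both ends of each new edge lie on the same side of it. *)
Lemma slide_cut_ex a b : slide_adj a b -> exists W : set T, [/\ ~ W a, W b & cuts slide_adj W a b].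
Proof.
pose P a b := exists W : set T, [/\ ~ W a, W b & cuts slide_adj W a b].
have Psym c d : P c d -> P d c.
  by move=> [W [h1 h2 h3]]; exists (~` W); split; [by move=> k; exact: k|exact: h1|exact: cuts_compl slide_sym h3].
have Pact g c d : P c d -> P (g *> c) (g *> d).
  move=> [W [h1 h2 h3]]; exists [set z | W (g^-1 *> z)]; rewrite /= !actK; split => //.
  exact: cuts_translate.
have Pnew : P y x by exists X; split; [exact: nXy|exact: Xx|exact: X_cuts].
have Pup : P v (t *> v).
  exists Z'; split; [|by left|exact: Z'_cuts].
  move=> [/nZv //|[g Xg [E|E]]].
    by rewrite -{1}E actK in Xg.
  by rewrite -{1}E actK in Xg; case: nXv; have := X_up 1; rewrite !gtree_act1 => -[_ /(_ Xg)].
move=> /asboolP[[ab n1 n2]|[[g -> ->]|[g -> ->]]]; last 2 first.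
- exact: Pact.
- by apply: Psym; exact: Pact.
case: (pselect (exists g, a = g *> v /\ b = g *> t *> v)) => [[g [-> ->]]|m1]; first exact: Pact.
case: (pselect (exists g, b = g *> v /\ a = g *> t *> v)) => [[g [-> ->]]|m2]; first by apply: Psym; exact: Pact.
have [na Wb cW] := side_cuts HT ab; exists (side (adj T) a b); split => //.
have Wup g : side (adj T) a b (g *> v) <-> side (adj T) a b (g *> t *> v).
  split=> h; apply: contrapT => n.
    by have [E1 E2] := cW _ _ (adj_down g) n h; apply: m2; exists g.
  by have [E1 E2] := cW _ _ (adj_up g) n h; apply: m1; exists g.
have Wy g : side (adj T) a b (g *> y) <-> side (adj T) a b (g *> x).
  rewrite /y -(gtree_actM g) -Wup gtree_actM -Wup; have e : adj T (g *> v) (g *> x) by rewrite gtree_act_adj.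
  have e' : adj T (g *> x) (g *> v) by rewrite (tree_sym HT).
  split=> h; apply: contrapT => n.
    by have [E1 E2] := cW _ _ e' n h; apply: n2; exists g.
  by have [E1 E2] := cW _ _ e n h; apply: n1; exists g.
move=> c d /asboolP[[cd _ _]|[[g -> ->]|[g -> ->]]] nc Wd; first exact: cW.
  by case: nc; apply/Wy.
by case: nc; apply/Wy.
Qed.

Lemma moved_path a b : moved a b -> exists h1 h2, [/\ slide_adj a h1, slide_adj h1 h2, slide_adj h2 b &
  exists k1 k2, h1 = k1 *> a /\ h2 = k2 *> a].
Proof.
move=> [g -> ->]; exists (g *> t *> v), (g *> y); split.
- exact: slide_up.
- by rewrite slide_act; exact: (slide_up t).
- exact: slide_new.
- by exists (g * t * g^-1), (g * t * t * g^-1); rewrite /y !gtree_actM !actK.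
Qed.

Lemma slide_tree : simplicial_tree slide_adj.
Proof.
split.
- by exists v.
- exact: slide_sym.
- move=> a; apply/asboolP => -[[aa _ _]|]; first by rewrite (tree_irr HT) in aa.
  have nyx g : g *> y <> g *> x.
    by move=> /act_inj E; apply: nXy; rewrite E.
  by move=> [] [g -> /nyx].
- have [_ _ _ cT _] := HT; apply: (connected_refine cT) => a b _ _ ab.
  case: (pselect (moved a b)) => [/moved_path[h1 [h2 [e1 e2 e3 _]]]|n1].
    by exists [:: h1; h2; b]; rewrite /= e1 e2 e3.
  case: (pselect (moved b a)) => [/moved_path[h1 [h2 [e1 e2 e3 _]]]|n2].
    by exists [:: h2; h1; b]; rewrite /= slide_sym e3 slide_sym e2 slide_sym e1.
  by exists [:: b]; split => //=; rewrite andbT; apply/asboolP; left.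
- apply: bridges_acyclic; [exact: slide_sym|exact: slide_cut_ex].
Qed.
Let HS := slide_tree.

Lemma slide_noinv g a b : slide_adj a b -> ~ (g *> a = b /\ g *> b = a).
Proof.
have H h : ~ (g *> h *> y = h *> x /\ g *> h *> x = h *> y).
  move=> [E1 E2]; apply: nXy.
  have -> : y = (h^-1 * g * h) *> x by rewrite !gtree_actM E2 actK.
  by apply: X_moved_to; rewrite !gtree_actM E1 actK.
move=> /asboolP[[ab _ _]|[[h -> ->]|[h -> ->]]]; first exact: gtree_noinv.
  exact: H.
by move=> [E1 E2]; apply: (H h).
Qed.

Lemma slide_minimal (W : set T) : W !=set0 -> connected slide_adj W ->
  (forall g a, W a -> W (g *> a)) -> W = setT.
Proof.
move=> W0 cW gW; apply: gtree_minimal => //; apply: (connected_refine cW) => a b Wa Wb.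
have new g : W (g *> v) -> W (g *> x) -> exists p, [/\ path (adj T) (g *> y) p, last (g *> y) p = g *> x & [set` p] `<=` W].
  move=> Wv Wx; have Wt : W (g *> t *> v) by have := gW (g * t * g^-1) _ Wv; rewrite !gtree_actM actK.
  exists [:: g *> t *> v; g *> v; g *> x]; split => //=.
    by apply/and4P; split; rewrite // ?adj_down // gtree_act_adj //; exact: (adj_down t).
  by move=> w /=; rewrite !inE => /or3P[] /eqP->.
have new' g : W (g *> v) -> W (g *> y) -> exists p, [/\ path (adj T) (g *> x) p, last (g *> x) p = g *> y & [set` p] `<=` W].
  move=> Wv Wy; have Wt : W (g *> t *> v) by have := gW (g * t * g^-1) _ Wv; rewrite !gtree_actM actK.
  exists [:: g *> v; g *> t *> v; g *> y]; split => //=.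
    by apply/and4P; split; rewrite // ?adj_up // gtree_act_adj ?(tree_sym HT x) //; exact: (adj_up t).
  by move=> w /=; rewrite !inE => /or3P[] /eqP->.
have yv g : W (g *> y) -> W (g *> v).
  by move=> /(gW (g * (t * t)^-1 * g^-1)); rewrite /y -(gtree_actM t) !gtree_actM actK -(gtree_actM t) actK.
move=> /asboolP[[ab _ _]|[[g Ea Eb]|[g Eb Ea]]].
- by exists [:: b]; split => //=; [rewrite ab|move=> w; rewrite /= inE => /eqP->].
- by rewrite Ea Eb in Wa Wb *; apply: new => //; exact: yv.
- by rewrite Ea Eb in Wa Wb *; apply: new' => //; exact: yv.
Qed.

(** In the orbit of [v], strict ascent provides three neighbours. Elsewhere, neighbours in the two
    trees correspond bijectively, and the element given by [T] serves again since the action is the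
    same. *)
Lemma slide_nonredundant a : valence2 slide_adj a -> exists g, forall b, g *> b = b <-> b = a.
Proof.
move=> [b1 [b2 [/eqP ne12 H]]].
case: (pselect (exists g, a = g *> v)) => [[g Ea]|na].
  have [g0 s0 ns0] := strict.
  (* This conjugate fixes [v] but moves [t^-1 v], because [g0] fixes [tv] but moves [v]. *)
  pose h := t^-1 * g0 * t.
  have sh : stab v h by rewrite /stab /= /h !gtree_actM s0 actK.
  have d1 : slide_adj v (t^-1 *> v).
    by have := slide_down t^-1; rewrite actK.
  have d2 : slide_adj v (h *> t^-1 *> v).
    by have := slide_act h v (t^-1 *> v); rewrite d1 sh.
  have d3 : slide_adj v (t *> v) by have := slide_up 1; rewrite !gtree_act1.
  have n12 : t^-1 *> v <> h *> t^-1 *> v.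
    move=> E; apply: ns0; rewrite /stab /=; apply: (@act_inj _ T t^-1).
    by rewrite [RHS]E /h !gtree_actM actVK.
  have n13 : t^-1 *> v <> t *> v by move=> E; apply: v_neq_y; rewrite /y -E actVK.
  have n23 : h *> t^-1 *> v <> t *> v.
    by move=> E; apply: n13; apply: (@act_inj _ T h); rewrite E; apply/esym; exact: up.
  have [P1 P2 P3] : [/\ slide_adj a (g *> t^-1 *> v), slide_adj a (g *> h *> t^-1 *> v) & slide_adj a (g *> t *> v)].
    by rewrite Ea !slide_act.
  move: P1 P2 P3; rewrite !H => /orP[]/eqP E1 /orP[]/eqP E2 /orP[]/eqP E3;
    solve [ case: n12; apply: (@act_inj _ T g); rewrite E1 E2 //
             | case: n13; apply: (@act_inj _ T g); rewrite E1 E3 //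
             | case: n23; apply: (@act_inj _ T g); rewrite E2 E3 // ].
have nav g : a <> g *> v by move=> E; apply: na; exists g.
have nay g : a <> g *> y by move=> E; apply: (nav (g * t * t)); rewrite E !gtree_actM.
(* [M w b]: the edge from [a] to [w] becomes the edge from [a] to [b] *)
pose M w b := [/\ w = b, adj T a b & ~ moved b a] \/ exists g, [/\ a = g *> x, w = g *> v & b = g *> y].
have M1 w b b' : M w b -> M w b' -> b = b'.
  move=> [[<- h n]|[g [Ea Ew Eb]]] [[<- h' n']|[g' [Ea' Ew' Eb']]] //.
  - by case: n; exists g'.
  - by case: n'; exists g.
  - have s : stab v (g^-1 * g') by rewrite /stab /= gtree_actM -Ew' Ew actK.
    by rewrite Eb Eb' -{1}(fix_y s) gtree_actM actVK.
have M2 w w' b : M w b -> M w' b -> w = w'.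
  have Q g : a = g *> x -> adj T a (g *> y) -> False.
    move=> ->; rewrite gtree_act_adj (tree_sym HT) => yx.
    by have [E _] := cX yx nXy Xx; apply: v_neq_y.
  move=> [[-> h n]|[g [Ea Ew Eb]]] [[-> h' n']|[g' [Ea' Ew' Eb']]] //.
  - by case: (Q g') => //; rewrite -Eb'.
  - by case: (Q g) => //; rewrite -Eb.
  - have sx : stab x (g^-1 * g') by rewrite /stab /= gtree_actM -Ea' Ea actK.
    have sy : stab y (g^-1 * g') by rewrite /stab /= gtree_actM -Eb' Eb actK.
    have [b0 _] := cut_btw HT avx cX nXy Xx; have := fix_btw sy sx b0.
    by rewrite /stab /= gtree_actM Ew Ew' => E; rewrite -[in LHS]E actVK.
have toM w : adj T a w -> exists2 b, M w b & slide_adj a b.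
  move=> aw; case: (pselect (moved w a)) => [[g -> Ea]|n].
    exists (g *> y); first by right; exists g.
    by rewrite Ea slide_sym slide_new.
  by exists w; [left|apply/asboolP; left; split => // -[g /nav]].
have ofM b : slide_adj a b -> exists2 w, M w b & adj T a w.
  move=> /asboolP[[ab _ n]|[[g /nay //]|[g Eb Ea]]]; first by exists b => //; left.
  by exists (g *> v); [right; exists g|rewrite Ea gtree_act_adj (tree_sym HT)].
have [w1 m1 a1] : exists2 w, M w b1 & adj T a w by apply: ofM; rewrite H eqxx.
have [w2 m2 a2] : exists2 w, M w b2 & adj T a w by apply: ofM; rewrite H eqxx orbT.
apply: gtree_nonredundant; exists w1, w2; split.
  by apply/eqP => E; rewrite E in m1; apply: ne12; exact: M1 m1 m2.
move=> w; apply/idP/idP => [/toM[b mb]|/orP[]/eqP-> //].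
by rewrite H => /orP[]/eqP E; rewrite E in mb; apply/orP; [left|right]; apply/eqP; [exact: M2 mb m1|exact: M2 mb m2].
Qed.

Definition slide_gtree : gtree G :=
  GTree slide_tree (@gtree_act1 _ T) (@gtree_actM _ T) slide_act slide_noinv slide_minimal slide_nonredundant.

Let S := slide_gtree.

(** In [T], the vertex [gv] lies between [gy] and [gx], so the stabilizer of a new edge is contained
    in that of the old one. *)
Lemma slide_A_tree (A : set (set G)) : admissible_family A -> A_tree A T -> A_tree A S.
Proof.
move=> admA AT a b /asboolP[[ab _ _]|H].
  exact: (A_edge admA (AT _ _ ab) (x := a : S) (y := b : S)).
have vyx g h : stab (g *> y) h -> stab (g *> x) h -> stab (g *> v) h.
  move=> sy sx; apply: (fix_btw sy sx); apply/act_btw.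
  by have [] := cut_btw HT avx cX nXy Xx.
case: H => -[g Ea Eb]; rewrite Ea Eb.
  have e : adj T (g *> v) (g *> x) by rewrite gtree_act_adj.
  apply: (A_edge admA (AT _ _ e) (x := (g *> y) : S)) => h [h1 h2]; split => //.
  exact: vyx.
have e : adj T (g *> x) (g *> v) by rewrite gtree_act_adj (tree_sym HT).
apply: (A_edge admA (AT _ _ e) (x := (g *> x) : S)) => h [h1 h2]; split => //.
exact: vyx.
Qed.

(** The factor 3 is the length of the path [y], [tv], [v], [x] of [T] that replaces a new edge. *)
Lemma slide_dist a b : (dist (adj T) a b <= 3 * dist slide_adj a b)%N.
Proof.
have e3 c d : slide_adj c d -> (dist (adj T) c d <= 3)%N.
  have yx g : (dist (adj T) (g *> y) (g *> x) <= 3)%N.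
    rewrite act_dist; have := dist_tri HT y v x; have := dist_tri HT y (t *> v) v.
    by rewrite (dist_adj HT avx) (dist_adj HT (adj_down t)) (dist_sym HT (t *> v) v) (dist_adj HT avt); lia.
  move=> /asboolP[[cd _ _]|[[g -> ->]|[g -> ->]]]; first by rewrite (dist_adj HT cd).
    exact: yx.
  by rewrite (dist_sym HT); exact: yx.
have [p [hp <- <-]] := dist_path HS a b; elim: p a hp => [|c p IH] a /=; first by rewrite distxx.
by move=> /andP[/e3 ac /IH]; have := dist_tri HT a c (last c p); lia.
Qed.

(* In a common refinement [R], the projections to the axis of [t] of the branch at [x] and of a
   translate of the axis branching off at [tv] would have opposite orders in [T] and in [S]. *)
Lemma slide_incompatible : finitely_generated G -> ~ fixed_point T -> ~ compatible T S.
Proof.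
move=> fgG nf /lcm_ex[R [c [d L]]]; have [Cc Cd _] := L.
have [h eh] : dominates T R.
  by apply: lcm_dominated L _ _; exists id.
have [K1 H1] := @equivariant_close _ fgG T T id (c \o h) (fun _ _ => erefl)
   (fun g z => etrans (congr1 c (eh g z)) (collapse_equiv Cc g (h z))).
have [K2 H2] := @equivariant_close _ fgG T S id (d \o h) (fun _ _ => erefl)
   (fun g z => etrans (congr1 d (eh g z)) (collapse_equiv Cd g (h z))).
(* Going to [R] by [h] and back by [c] or [d] moves points by at most [K]; [N] is chosen larger, so
   that ends of axis segments stay in their half-trees. *)
pose K := (K1 + K2)%N; have [N EN] : exists N, N = K.+3 by exists K.+3.
have {}H1 z : (dist (adj T) z (c (h z)) <= K)%N by rewrite /K; have /= := H1 z; lia.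
have {}H2 z : (dist slide_adj z (d (h z)) <= K)%N by rewrite /K; have /= := H2 z; lia.
(* A segment of the axis of [t], indexed by natural numbers and shifted so that [s N = v]. *)
pose s i := (t^-1 ^+ N * t ^+ i) *> v.
have sN : s N = v by rewrite /s expVgn mulVg gtree_act1.
have sS i : s i.+1 = (t^-1 ^+ N * t ^+ i) *> t *> v by rewrite /s expgSr mulgA gtree_actM.
have adjs i : adj T (s i) (s i.+1) by rewrite sS; exact: adj_up.
have slides i : slide_adj (s i) (s i.+1) by rewrite sS; exact: slide_up.
have ns i : s i <> s i.+2.
  rewrite sS expgSr mulgA gtree_actM => /act_inj; exact: v_neq_y.
have dT := nonbacktracking_dist HT adjs ns.
have dS := nonbacktracking_dist HS slides ns.
have sN1 : s N.+1 = t *> v by rewrite sS /= expVgn mulVg gtree_act1.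
have sN2 : s N.+2 = y by rewrite sS expgSr mulgA expVgn mulVg mul1g.
have [g0 s0 ns0] := strict; pose al := s 0%N; pose al' := g0 *> al; pose be := s (N.+1 + N.+1)%N.
have fixs k : stab (t *> v) `<=` stab (s (N.+1 + k)%N).
  elim: k => [|k IH] g sg; first by rewrite addn0 sN1.
  rewrite addnS sS; set k' := t^-1 ^+ N * _; apply/stab_conj/up/stab_conj; exact: IH.
have g0b : g0 *> be = be by exact: fixs.
(* The axis and the action are the same in both trees, so one computation covers both: [al], [al']
   and [be] form a tripod centred at [tv]. *)
have gen (e : rel T) : simplicial_tree e -> (forall i j, dist e (s i) (s (i + j)%N) = j) ->
    (forall g a b, dist e (g *> a) (g *> b) = dist e a b) ->
    [/\ btw e al (t *> v) al', btw e al (t *> v) be, btw e al' (t *> v) be &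
        [/\ dist e al (t *> v) = N.+1, dist e al' (t *> v) = N.+1 & dist e (t *> v) be = N.+1]].
  move=> He De ie.
  have D1 : dist e al (t *> v) = N.+1 by rewrite -sN1; exact: (De 0%N N.+1).
  have D2 : dist e (t *> v) be = N.+1 by rewrite -sN1 De.
  have D3 : dist e al v = N by rewrite -sN; exact: (De 0%N N).
  have D4 : dist e v (t *> v) = 1%N by have := De N 1%N; rewrite addn1 sN sN1.
  have D5 : dist e al be = (N.+1 + N.+1)%N by exact: (De 0%N (N.+1 + N.+1)%N).
  have g0tv : g0 *> t *> v = t *> v by [].
  have B2 : btw e al (t *> v) be by rewrite /btw D1 D2 D5.
  have D8 : dist e al' (t *> v) = N.+1 by rewrite -D1 -{1}g0tv ie.
  have D9 : dist e al' be = (N.+1 + N.+1)%N by rewrite -D5 -{1}g0b ie.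
  have B3 : btw e al' (t *> v) be by rewrite /btw D8 D9 D2.
  have B : btw e al v (t *> v) by rewrite /btw D1 D3 D4 addn1.
  have D6 : dist e (t *> v) (g0 *> v) = 1%N by rewrite -{1}g0tv ie (dist_sym He).
  have D7 : dist e v (g0 *> v) = 2%N.
    have [->|] := adj_step He v (dist1 He D6); rewrite D4 // => -[/esym/(dist0 He) E].
    by case: ns0; rewrite /stab /= -E.
  have B1 : btw e al (t *> v) (g0 *> v).
    apply: (btw_glue2 He B); first by rewrite /btw D4 D6 D7.
    by move=> E; rewrite -E distxx in D4.
  have B4 : btw e (t *> v) (g0 *> v) al'.
    by rewrite /btw D6 (dist_sym He _ al') ie D3 (dist_sym He _ al') D8 add1n.
  by split => //; apply: (btw_glue He B1 B4) => E; rewrite -E distxx in D6.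
have [T1 T2 T3 [T4 T5 T6]] := gen _ HT dT (@act_dist _ T).
have [S1 S2 S3 [S4 S5 S6]] := gen _ HS dS (@act_dist _ S).
have [HR Mc Md] : [/\ simplicial_tree (adj R), monotone (adj R) (adj T) c & monotone (adj R) slide_adj d].
  by split; [exact: gd|exact: collapse_monotone Cc|exact: collapse_monotone Cd].
have cmed o a1 a2 a3 m : [/\ btw (adj R) (h a1) m (h a2), btw (adj R) (h a2) m (h a3) & btw (adj R) (h a1) m (h a3)] ->
    [/\ btw (adj T) a1 o a2, btw (adj T) a2 o a3 & btw (adj T) a1 o a3] ->
    [/\ (K < dist (adj T) a1 o)%N, (K < dist (adj T) a2 o)%N & (K < dist (adj T) a3 o)%N] -> c m = o.
  move=> [m1 m2 m3] [o1 o2 o3] [k1 k2 k3].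
  apply: (med_uniq HT (a := c (h a1)) (b := c (h a2)) (c := c (h a3))).
    by split; apply: (mono_btw HR HT Mc).
  by split; [apply: (btw_perturb2 HT (n := K) o1)|apply: (btw_perturb2 HT (n := K) o2)|apply: (btw_perturb2 HT (n := K) o3)].
have dmed o a1 a2 a3 m : [/\ btw (adj R) (h a1) m (h a2), btw (adj R) (h a2) m (h a3) & btw (adj R) (h a1) m (h a3)] ->
    [/\ btw slide_adj a1 o a2, btw slide_adj a2 o a3 & btw slide_adj a1 o a3] ->
    [/\ (K < dist slide_adj a1 o)%N, (K < dist slide_adj a2 o)%N & (K < dist slide_adj a3 o)%N] -> d m = o.
  move=> [m1 m2 m3] [o1 o2 o3] [k1 k2 k3].
  apply: (med_uniq HS (a := d (h a1)) (b := d (h a2)) (c := d (h a3))).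
    by split; apply: (mono_btw HR HS Md).
  by split; [apply: (btw_perturb2 HS (n := K) o1)|apply: (btw_perturb2 HS (n := K) o2)|apply: (btw_perturb2 HS (n := K) o3)].
have [q Q] := med_ex HR (h al) (h al') (h be).
have nK : (K < N.+1)%N by lia.
have cq : c q = t *> v.
  by apply: (cmed _ _ _ _ _ Q); split; rewrite // ?T4 ?T5 // (dist_sym HT) T6.
have dq : d q = t *> v.
  by apply: (dmed _ _ _ _ _ Q); split; rewrite // ?S4 ?S5 // (dist_sym HS) S6.
(* By [slide_dist], distances may shrink by a factor 3 in the slid tree; the margin 20 also absorbs
   the distance from [v] to [y]. *)
have [z Xz Dz] := extend_side (3 * K + 20) nf avx.
have nXs i : ~ X (s i).
  elim: i => [|i IH]; last by rewrite sS => /X_up.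
  suff H j : X (s 0%N) -> X (s j) by move=> /(H N); rewrite sN.
  by move=> X0; elim: j => // j; rewrite [in X in _ -> X]sS => /X_up.
have Tz i : btw (adj T) z v (s i).
  by apply: (btw_sym HT); have [] := cut_btw HT avx cX (nXs i) Xz.
have eyx : slide_adj y x by have := slide_new 1; rewrite !gtree_act1.
have Sz i : btw slide_adj z y (s i).
  by apply: (btw_sym HS); have [] := cut_btw HS eyx X_cuts (nXs i) Xz.
have Bs (e : rel T) i j k : (forall i j, dist e (s i) (s (i + j)%N) = j) -> btw e (s i) (s (i + j)%N) (s (i + j + k)%N).
  by move=> De; rewrite /btw !De -addnA De.
have [p P] := med_ex HR (h z) (h al) (h be).
have cp : c p = v.
  apply: (cmed _ _ _ _ _ P); split; [exact: Tz| |exact: Tz|by rewrite (dist_sym HT) Dz; lia| |].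
  - rewrite -sN; have := Bs _ 0%N N (N.+2)%N dT; rewrite add0n.
    by have -> : (N + N.+2 = N.+1 + N.+1)%N by lia.
  - by rewrite -sN -(add0n N) dT; lia.
  - rewrite (dist_sym HT) -{1}sN /be; have -> : (N.+1 + N.+1 = N + N.+2)%N by lia.
    by rewrite dT; lia.
have dp : d p = y.
  apply: (dmed _ _ _ _ _ P); split; [exact: Sz| |exact: Sz| | |].
  - rewrite -sN2; have := Bs _ 0%N N.+2 N dS; rewrite add0n.
    by have -> : (N.+2 + N = N.+1 + N.+1)%N by lia.
  - have := slide_dist z y; have := dist_tri HT v y z; have := dist_tri HT v (t *> v) y.
    rewrite Dz (dist_adj HT avt) (dist_adj HT (adj_up t)) (dist_sym HT y z); lia.
  - by rewrite -sN2 -(add0n N.+2) dS; lia.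
  - rewrite (dist_sym HS) -{1}sN2 /be; have -> : (N.+1 + N.+1 = N.+2 + N)%N by lia.
    by rewrite dS; lia.
have [_ Pab _] := P; have [_ _ Qab] := Q.
(* If [p] comes before [q], applying [d] puts [y] before [tv] in the slid tree; otherwise applying
   [c] puts [tv] before [v] in [T]. Both contradict the order of the axis. *)
case/orP: (leq_total (dist (adj R) (h al) p) (dist (adj R) (h al) q)) => le.
  have := mono_btw HR HS Md (btw_total HR Pab Qab le); rewrite dp dq => B1.
  have B0 : btw slide_adj al (t *> v) y.
    by have := Bs _ 0%N N.+1 1%N dS; rewrite add0n addn1 sN1 sN2.
  have B2 : btw slide_adj (d (h al)) (t *> v) y.
    by apply: (btw_perturb HS B0); rewrite S4; have := H2 al; lia.
  move: B1 B2; rewrite /btw => B1 B2.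
  have D : dist slide_adj (t *> v) y = 1%N by have := dS N.+1 1%N; rewrite addn1 sN1 sN2.
  by rewrite (dist_sym HS y) D in B1 B2; lia.
have := mono_btw HR HT Mc (btw_total HR Qab Pab le); rewrite cp cq => B1.
have B0 : btw (adj T) al v (t *> v).
  by have := Bs _ 0%N N 1%N dT; rewrite add0n addn1 sN sN1.
have D0 : dist (adj T) al v = N by rewrite -sN -(add0n N) dT.
have B2 : btw (adj T) (c (h al)) v (t *> v).
  by apply: (btw_perturb HT B0); rewrite D0; have := H1 al; lia.
move: B1 B2; rewrite /btw (dist_sym HT _ v) (dist_adj HT avt); lia.
Qed.

End Slide.

(** * Ascending loops *)

Section Ascending.
Variables (G : groupType).
Implicit Types T R S : gtree G.

(** Choose [o] with least displacement [l]. If the segment from [o] to [to] were retraced after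
    [to], its first vertex after [o] would be moved less than [o], or an edge would be inverted. So
    the segments concatenate to an axis. *)
Lemma axis_dist R (t : G) : (forall x : R, act R t x <> x) ->
  exists (o : R) (l : nat), (0 < l)%N /\ forall n, dist (adj R) o (act R (t ^+ n) o) = (n * l)%N.
Proof.
move=> nf; have HR := gd R; have [[o0 _] _ _ _ _] := HR.
have P : exists n, `[< exists o : R, dist (adj R) o (act R t o) = n >].
  by exists (dist (adj R) o0 (act R t o0)); apply/asboolP; exists o0.
case: (ex_minnP P) => l /asboolP[o Do] ml.
have {}ml w : (l <= dist (adj R) w (act R t w))%N by apply: ml; apply/asboolP; exists w.
have l0 : (0 < l)%N by case: l Do {ml} => // /(dist0 HR)/esym/nf.
exists o, l; split => //.
have bo : btw (adj R) o (act R t o) (act R t (act R t o)).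
  have [m [m1 m2 m3]] := med_ex HR o (act R t o) (act R t (act R t o)).
  case: (pselect (m = act R t o)) => [Em|nm]; first by move: m3; rewrite {1}Em.
  have [u [eu bu du]] := next_ex HR (not_eq_sym nm).
  have du1 : (dist (adj R) o u < dist (adj R) o (act R t o))%N.
    have := dist_tri HR o m u; move: m1; rewrite /btw (dist_sym HR m (act R t o)) (dist_sym HR m u) ; lia.
  have du2 : (dist (adj R) u (act R t (act R t o)) < dist (adj R) (act R t o) (act R t (act R t o)))%N.
    by have := dist_tri HR u m (act R t (act R t o)); move: m2; rewrite /btw; lia.
  pose w := act R t^-1 u; have wE : act R t w = u by rewrite /w actVK.
  have dw : (dist (adj R) w (act R t o) < dist (adj R) o (act R t o))%N by rewrite -(act_dist t w) -(act_dist t o) wE.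
  have ow : dist (adj R) o w = 1%N by rewrite -(act_dist t) wE; exact: (dist_adj HR eu).
  have eow := dist1 HR ow.
  case: l Do ml l0 => // l Do ml _.
  have E : (dist (adj R) w (act R t o) = l)%N by have := dist_tri HR o w (act R t o); lia.
  have dou : dist (adj R) o u = l.
    by have := dist_tri HR o u (act R t o); rewrite (dist_sym HR u) (dist_adj HR eu); lia.
  have := ml w; rewrite wE.
  case: l Do E dou ml => [|l] Do E dou ml.
    move: (dist0 HR E) (dist0 HR dou) => E1 E2 _.
    by case: (gtree_noinv (dist1 HR Do) (g := t)); split => //; rewrite -E1 wE E2.
  have bw : btw (adj R) o w u.
    apply: (btw_total HR (b := act R t o)); last by lia.
      by rewrite /btw ow E Do.
    by rewrite /btw dou (dist_sym HR u) (dist_adj HR eu) Do addn1.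
  by move: bw; rewrite /btw ow dou; lia.
pose s n := act R (t ^+ n) o; have sS n : s n.+1 = act R (t ^+ n) (act R t o) by rewrite /s expgSr gtree_actM.
have s1 k : s k <> s k.+1 by move=> E; apply: (nf o); apply: (@act_inj _ R (t ^+ k)); rewrite -sS -E.
have s2 k : btw (adj R) (s k) (s k.+1) (s k.+2) by rewrite !sS expgSr gtree_actM; apply/act_btw.
elim=> [|n IH]; first by rewrite expg0 gtree_act1 distxx.
have := local_geodesic HR s1 s2 0%N n.
by rewrite /btw add0n /s expg0 gtree_act1 IH expgSr gtree_actM act_dist Do => <-; rewrite mulSn addnC.
Qed.

Lemma same_end_mul T (r : nat -> T) g h : same_end (act T g \o r) r -> same_end (act T h \o r) r ->
  same_end (act T (g * h) \o r) r.
Proof.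
move=> [m [n E]] [m' [n' E']]; exists (m' + m)%N, (n + n')%N => k.
rewrite /= gtree_actM -addnA [act T h _]E' addnA (addnC n') -addnA [act T g _]E.
by rewrite addnA.
Qed.

Lemma same_end_inv T (r : nat -> T) g : same_end (act T g \o r) r -> same_end (act T g^-1 \o r) r.
Proof. by move=> [m [n E]]; exists n, m => k; rewrite /= -[r (n + k)%N]E /= actK. Qed.

(* The group is then an ascending HNN extension, which fixes the attracting end of [t]. *)
Lemma ascending_fixed_end T R (t : G) (v : T) : dominates T R -> dominates R T -> adj T v (act T t v) ->
  stab v `<=` stab (act T t v) ->
  (forall x, adj T v x -> x = act T t v \/ exists2 h, stab v h & x = act T h (act T t^-1 v)) ->
  fixed_end R.
Proof.
move=> [f ef] [f' ef'] avt up nbr; have [HT HR] := (gd T, gd R).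
have nt2 : v <> act T t (act T t v) by move=> E; apply: (gtree_noinv avt (g := t)).
pose s n := act T (t ^+ n) v; have sS n : s n.+1 = act T (t ^+ n) (act T t v) by rewrite /s expgSr gtree_actM.
have ds : forall n, dist (adj T) v (s n) = n.
  have s1 k : adj T (s k) (s k.+1) by rewrite sS gtree_act_adj.
  have s2 k : s k <> s k.+2 by rewrite sS expgSr gtree_actM => /act_inj.
  by move=> n; have := nonbacktracking_dist HT s1 s2 0%N n; rewrite add0n {1}/s expg0 gtree_act1.
(* A fixed vertex in [R] would give one in [T], where the powers of [t] move [v] arbitrarily far. *)
have nfix (w : R) : act R t w <> w.
  move=> E; have E' : act T t (f' w) = f' w by rewrite -[act _ _ _]ef' E.
  have En n : act T (t ^+ n) (f' w) = f' w.
    by elim: n => [|n IH]; [rewrite expg0 gtree_act1|rewrite expgSr gtree_actM E'].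
  pose n := (dist (adj T) v (f' w) + dist (adj T) v (f' w)).+1.
  have := dist_tri HT v (f' w) (s n); rewrite ds -{2}(En n) /s act_dist (dist_sym HT _ v) /n; lia.
have [o [l [l0 dl]]] := axis_dist nfix.
have dl2 i j : dist (adj R) (act R (t ^+ i) o) (act R (t ^+ (i + j)) o) = (j * l)%N.
  by rewrite expgnDr gtree_actM act_dist dl.
have ex k : exists2 w, btw (adj R) o w (act R (t ^+ k) o) & dist (adj R) o w = k.
  by apply: (btw_at HR); rewrite dl; nia.
(* The candidate ray: [r k] is at distance [k] from [o] on the segment towards [t^k o], which is
   long enough since [l > 0]. *)
pose r k := projT1 (cid2 (ex k)).
have rb k : btw (adj R) o (r k) (act R (t ^+ k) o) by rewrite /r; case: cid2.
have rd k : dist (adj R) o (r k) = k by rewrite /r; case: cid2.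
have rB k m : (k <= m)%N -> btw (adj R) o (r k) (act R (t ^+ m) o).
  move=> km; have := rb k; have := dl2 k (m - k)%N; rewrite subnKC // /btw !dl.
  have := dist_tri HR (r k) (act R (t ^+ k) o) (act R (t ^+ m) o).
  have := dist_tri HR o (r k) (act R (t ^+ m) o); rewrite dl rd; nia.
have ru k m w : (k <= m)%N -> btw (adj R) o w (act R (t ^+ m) o) -> dist (adj R) o w = k -> w = r k.
  by move=> km b d; apply: (btw_uniq HR b (rB _ _ km)); rewrite d rd.
have rr : ray r.
  split => [i j E|n]; first by rewrite -(rd i) E rd.
  apply: (dist1 HR); have := btw_total HR (rB n n.+1 (leqnSn n)) (rb n.+1).
  by rewrite !rd leqnSn => /(_ isT); rewrite /btw !rd; lia.
have Kt : same_end (act R t \o r) r.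
  exists 0%N, l => k /=; rewrite add0n; pose m := (l + k)%N.
  have b1 := rB k m ltac:(rewrite /m; lia); move: (b1).
  rewrite -(act_btw t) -gtree_actM -expgS => b2.
  have d1 := dl2 1%N m; have d0 := dl 1%N; rewrite add1n expg1 in d1 d0.
  have T1 := dist_tri HR o (act R t o) (act R t (r k)).
  have T2 := dist_tri HR o (act R t (r k)) (act R (t ^+ m.+1) o).
  move: b2 T1 T2; rewrite /btw d1 d0 act_dist rd dl mul1n mulSn => b2 T1 T2.
  have D : dist (adj R) o (act R t (r k)) = (l + k)%N.
    move: b2 T1 T2; set a := dist _ o _; set b := dist _ _ _; move: (m * l)%N a b => M a b b2 T1 T2; lia.
  apply: (ru _ m.+1 _ _ _ D); first by rewrite /m; lia.
  rewrite /btw D dl mulSn; move: b2; set b := dist _ _ _; move: (m * l)%N b => M b; lia.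
(* By ascent, [h] fixes every [t^n v], hence every [t^n (f v)] in [R]. These points stay at bounded
   distance from the axis, so [h] fixes the part of the ray lying between two of them. *)
have Kh h : stab v h -> same_end (act R h \o r) r.
  move=> hv; have hs n : stab (s n) h.
    elim: n => [|n]; first by rewrite /s /stab /= expg0 gtree_act1.
    by move=> IH; rewrite sS; apply/stab_conj/up/stab_conj; exact: IH.
  have hf n : stab (act R (t ^+ n) (f v)) h.
    by rewrite /stab /= -[act R (t ^+ n) _]ef -[act R h _]ef; congr f; exact: hs.
  pose dlt := dist (adj R) o (f v).
  exists dlt.+1, dlt.+1 => k /=; set i := (dlt.+1 + k)%N; pose m := (i + dlt.+1)%N.
  have h0 := hf 0%N; rewrite expg0 gtree_act1 in h0.
  apply: (fix_btw h0 (hf m)).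
  have bm := rB i m ltac:(rewrite /m; lia).
  apply: (btw_perturb2 HR (n := dlt) bm); rewrite ?act_dist ?rd //; first by rewrite /i; lia.
  move: bm; rewrite /btw (dist_sym HR (r i)) rd dl /m; nia.
exists r => // g.
have [p [hp lp _]] := dist_path HT v (act T g v).
(* Following a path from [v] to [gv] writes [g], up to the stabilizer of [v], as a product of
   letters [t] and [h t^-1] with [h] fixing [v]. *)
have H q w : path (adj T) w q -> (exists2 k, w = act T k v & same_end (act R k \o r) r) ->
    exists2 k, last w q = act T k v & same_end (act R k \o r) r.
  elim: q w => [|w' q IH] w //= /andP[a /IH H] [k Ew Ek]; apply: H.
  have a' : adj T v (act T k^-1 w') by rewrite -(gtree_act_adj k) actVK -Ew.
  have [E|[h sh E]] := nbr _ a'.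
    by exists (k * t); [rewrite gtree_actM -E actVK|exact: same_end_mul].
  exists (k * (h * t^-1)); first by rewrite !gtree_actM -E actVK.
  apply: same_end_mul => //; apply: same_end_mul; [exact: Kh|exact: same_end_inv].
have [|k Ek Kk] := H p v hp.
  by exists 1; [rewrite gtree_act1|apply: Kh; rewrite /stab /= gtree_act1].
have sk : stab v (k^-1 * g) by rewrite /stab /= gtree_actM -lp Ek actK.
by rewrite -[g](mulVKg k); apply: same_end_mul => //; exact: Kh.
Qed.

(** Either some edge at [v] is outside the orbit of the loop and can be slid, against universal
    compatibility, or there is none and an end is fixed. *)
Lemma no_ascending_loop (A : set (set G)) D T (t : G) (v : T) : finitely_generated G ->
  admissible_family A -> A_deformation_space A D -> irreducible_space D -> D T ->
  universally_compatible A T -> adj T v (act T t v) -> stab v `<=` stab (act T t v) ->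
  stab (act T t v) `<=` stab v.
Proof.
move=> fgG admA AD ID DT [AT UT] avt up; apply: contrapT => ns.
have strict : exists2 g, stab (act T t v) g & ~ stab v g.
  by apply: contrapT => N; apply: ns => g sg; apply: contrapT => n; apply: N; exists g.
have nf := space_not_fixed AD ID DT.
case: (pselect (exists x, [/\ adj T v x, x <> act T t v & forall h, stab v h -> x <> act T h (act T t^-1 v)])).
  move=> [x [avx xup xdown]]; apply: (@slide_incompatible G T t v x avt up strict avx xup xdown fgG nf).
  by apply: UT; exact: (slide_A_tree admA AT).
move=> N; have [R DR [_ nfe _]] := ID; apply: nfe.
move: DR; rewrite (A_deformation_spaceE AD DT) => -[[d1 d2] _].
apply: (ascending_fixed_end d1 d2 avt up) => x avx; apply: contrapT => M; apply: N; exists x; split => //.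
  by move=> E; apply: M; left.
by move=> h sh E; apply: M; right; exists h.
Qed.

End Ascending.

(** * Trees without collapsible edges *)

Section Lists.

Lemma size_le_inj (X Y : eqType) (r : X -> Y -> Prop) (l : seq X) (l' : seq Y) : uniq l ->
  (forall x, x \in l -> exists2 y, y \in l' & r x y) ->
  (forall x x' y, x \in l -> x' \in l -> r x y -> r x' y -> x = x') -> (size l <= size l')%N.
Proof.
move=> ul H inj; case: l => [//|x0 l0] in ul H inj *; set l := x0 :: l0 in ul H inj *.
have [y0 _ _] := H x0 (mem_head _ _).
have K x : exists y, x \in l -> y \in l' /\ r x y.
  case: (boolP (x \in l)) => [/H[y h1 h2]|_]; first by exists y.
  by exists y0.
have [f fP] := choice K; rewrite -(size_map f); apply: uniq_leq_size.
  rewrite map_inj_in_uniq // => x x' hx hx' E.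
  by have [[_ h1] [_ h2]] := (fP x hx, fP x' hx'); rewrite -E in h2; exact: inj h1 h2.
by move=> _ /mapP[x hx ->]; have [] := fP x hx.
Qed.

Definition inequivalent (X : eqType) (r : X -> X -> Prop) (l : seq X) :=
  uniq l /\ forall x y, x \in l -> y \in l -> r x y -> x = y.

(** Take a longest list of pairwise inequivalent elements; lengths are bounded by [size s]. *)
Lemma transversal_list (X : eqType) (r : X -> X -> Prop) (P : X -> Prop) (s : seq X) :
  (forall x, r x x) -> (forall x y, r x y -> r y x) -> (forall x y z, r x y -> r y z -> r x z) ->
  (forall x, P x -> exists2 y, y \in s & r x y) ->
  exists l, [/\ inequivalent r l, forall x, x \in l -> P x & forall x, P x -> exists2 y, y \in l & r x y].
Proof.
move=> rr rs rt H.
pose Q n := `[< exists l, [/\ inequivalent r l, forall x, x \in l -> P x & size l = n] >].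
have Q0 : exists n, Q n by exists 0%N; apply/asboolP; exists [::]; split => //; split.
have Qs n : Q n -> (n <= size s)%N.
  move=> /asboolP[l [[ul il] Pl <-]]; apply: (size_le_inj (r := r)) => //; first by move=> x /Pl/H.
  by move=> x x' y hx hx' h h'; apply: il => //; apply: rt h (rs _ _ h').
case: (ex_maxnP Q0 Qs) => n /asboolP[l [[ul il] Pl sl]] mx; exists l; split => // x Px.
apply: contrapT => N; have nr y : y \in l -> ~ r x y by move=> yl h; apply: N; exists y.
suff /mx : Q n.+1 by rewrite ltnn.
apply/asboolP; exists (x :: l); split; last by rewrite /= sl.
  split; first by rewrite /= ul andbT; apply/negP => /nr; apply; exact: rr.
  move=> a b; rewrite !inE => /orP[/eqP->|al] /orP[/eqP->|bl] // h.
  - by case: (nr _ bl h).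
  - by case: (nr _ al (rs _ _ h)).
  - exact: il.
by move=> a; rewrite inE => /orP[/eqP->|/Pl].
Qed.

End Lists.

Section Core.
Variables (G : groupType).
Hypothesis fgG : finitely_generated G.
Implicit Types T R S : gtree G.

Definition collapsible_edge T (w u : T) :=
  [/\ adj T w u, stab w `<=` stab u, forall z, adj T w z -> stab w `<=` stab z -> z = u &
      forall g, u <> act T g w].

Definition edge_orbit T (e f : T * T) := exists2 g, f.1 = act T g e.1 & f.2 = act T g e.2.

Definition edge_cover T (l : seq (T * T)) :=
  forall x y, adj T x y -> exists2 e, e \in l & edge_orbit e (x, y).

Lemma edge_cover_ex T : exists2 l : seq (T * T), edge_cover l & forall e, e \in l -> adj T e.1 e.2.
Proof.
have [l [la lP]] := finite_edges fgG T; exists l; last by move=> [a b]; exact: la.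
by move=> x y a; have [g [u [w [h1 h2 h3]]]] := lP _ _ a; exists (u, w) => //; exists g.
Qed.

Lemma orbit_refl T (e : T * T) : edge_orbit e e.
Proof. by exists 1; rewrite gtree_act1. Qed.
Lemma orbit_sym T (e f : T * T) : edge_orbit e f -> edge_orbit f e.
Proof. by move=> [g E1 E2]; exists g^-1; rewrite ?E1 ?E2 actK. Qed.
Lemma orbit_trans T (e f h : T * T) : edge_orbit e f -> edge_orbit f h -> edge_orbit e h.
Proof. by move=> [g E1 E2] [k F1 F2]; exists (k * g); rewrite gtree_actM -?E1 -?E2. Qed.

(** The map [q] sends [gw] to [gu], consistently since the stabilizer of [w] fixes [u], and is
    idempotent since [u] is not in the orbit of [w]. Identifying points with the same [q] leaves [q]
    as an equivariant way back to [T]. *)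
Lemma collapse_edge T (w u : T) : collapsible_edge w u -> exists T' (c : T -> T'),
  [/\ collapse_map c, dominates T' T & c w = c u].
Proof.
move=> [a su _ nu]; have HT := gd T.
have qE z : exists z', (forall g, z = act T g w -> z' = act T g u) /\
    ((forall g, z <> act T g w) -> z' = z).
  case: (pselect (exists g, z = act T g w)) => [[g ->]|N]; last first.
    by exists z; split => // g E; case: N; exists g.
  exists (act T g u); split; last by move=> /(_ g).
  move=> h E; have s : stab w (h^-1 * g) by rewrite /stab /= gtree_actM E actK.
  by rewrite -{2}(su _ s) gtree_actM actVK.
have [q qP] := choice qE.
have q_out z : (forall g, z <> act T g w) -> q z = z by have [] := qP z.
have q_in g : q (act T g w) = act T g u by have [+ _] := qP (act T g w); apply.
have qcase z : (exists g, z = act T g w) \/ (forall g, z <> act T g w).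
  case: (pselect (exists g, z = act T g w)) => h; [by left|right => g E; apply: h; by exists g].
have nq z g : q z <> act T g w.
  case: (qcase z) => [[h ->]|nz]; last by rewrite q_out.
  by rewrite q_in => E; apply: (nu (h^-1 * g)); rewrite gtree_actM -E actK.
have qq z : q (q z) = q z by apply: q_out => g; exact: nq.
have qadj z : q z = z \/ adj T z (q z).
  case: (qcase z) => [[h ->]|/q_out]; [right|by left].
  by rewrite q_in gtree_act_adj.
have qact g z : q (act T g z) = act T g (q z).
  case: (qcase z) => [[h ->]|nz]; first by rewrite -gtree_actM !q_in gtree_actM.
  rewrite (q_out z) // q_out // => h E; apply: (nz (g^-1 * h)).
  by rewrite gtree_actM -E actK.
have [|||||T' [c [Cc Ec]]] := @quotient_ex G T (fun x y => q x = q y) => //.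
- by move=> x y z ->.
- by move=> g x y E; rewrite !qact E.
- move=> x y z E b; suff C : convex (adj T) [set p | q p = q x] by apply: (C x y).
  apply: (connected_convex HT) => {z b} x1 y1 /= h1 h2.
  have step u' p : q u' = q x -> path (adj T) (q u') p -> [set` p] `<=` [set z | q z = q x] ->
      exists p', [/\ path (adj T) u' p', last u' p' = last (q u') p & [set` p'] `<=` [set z | q z = q x]].
    move=> hu hp sp; case: (qadj u') => [<-|a']; first by exists p; rewrite qq.
    exists (q u' :: p); rewrite /= a'; split => // z; rewrite /= inE => /orP[/eqP->|/sp //].
    by rewrite /= qq.
  case: (qadj y1) => [E1|a']; last first.
    have [||p' [hp' lp' sp']] := step x1 [:: y1] h1; first by rewrite /= h1 -h2 (tree_sym HT) a'.
      by move=> z; rewrite /= inE => /eqP->.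
    by exists p'.
  have [||p' [hp' lp' sp']] := step x1 [::] h1 => //.
  by exists p'; split => //; rewrite lp' /= h1 -h2 E1.
exists T', c; split => //; last by apply/Ec; rewrite -[w in LHS](gtree_act1 w) q_in gtree_act1 q_out.
apply/dominatesP => v; have [x cx] := collapse_surj Cc v; exists (q x) => g gv.
have : c (act T g (q x)) = c (q x).
  have E : c (q x) = v by rewrite -cx; apply/Ec; rewrite qq.
  by rewrite collapse_equiv // E.
by move=> /Ec; rewrite qact !qq.
Qed.

Section Spaces.
Variables (A : set (set G)) (D : gtree G -> Prop).
Hypotheses (admA : admissible_family A) (AD : A_deformation_space A D) (ID : irreducible_space D).

Definition core T := [/\ D T, universally_compatible A T & forall w u : T, ~ collapsible_edge w u].

Lemma space_dominates_each T T' : D T -> D T' -> dominates T T'.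
Proof. by move=> DT; rewrite (A_deformation_spaceE AD DT) => -[[]]. Qed.

Lemma core_not_fixed T : core T -> ~ fixed_point T.
Proof. by move=> [DT _ _]; exact: space_not_fixed AD ID DT. Qed.

(* Excluding strictly ascending loops ensures that the endpoints of the image are in different orbits. *)
Lemma collapsible_image R T (c : R -> T) (w v : R) : D R -> D T -> universally_compatible A T ->
  collapse_map c -> c w <> c v -> collapsible_edge w v -> collapsible_edge (c w) (c v).
Proof.
move=> DR DT UT Cc ne [a sv only nv]; have M := collapse_monotone Cc; have [HR HT] := (gd R, gd T).
have stabc : stab w `<=` stab (c w) by move=> g gw; rewrite /stab /= -collapse_equiv // gw.
(* If the stabilizer of [w] fixed [z], it would fix the first edge from [w] to [z], which is then
   the edge to [v]. *)
have leave z : z <> w -> ~ btw (adj R) w v z -> exists2 g, stab w g & ~ stab z g.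
  move=> nz nb; apply: contrapT => N; have sz : stab w `<=` stab z.
    by move=> g gw; apply: contrapT => n; apply: N; exists g.
  have [u [eu bu _]] := next_ex HR (not_eq_sym nz).
  apply: nb; suff <- : u = v by [].
  by apply: only => // g gw; apply: (fix_btw gw (sz _ gw) bu).
(* The stabilizer of [c w] fixes some [r] in the fiber, because the two trees dominate each other.
   By [leave], [r] is [w] or lies beyond [v]; the latter would put [v] in the fiber. *)
have eqs : stab (c w) `<=` stab w.
  have [f ef] := space_dominates_each DT DR.
  have [r cr H] := fix_fiber (f (c w)) (c w) Cc.
  have sr : stab (c w) `<=` stab r.
    by move=> g gc; apply: H => //; rewrite /stab /= -[act _ _ _]ef gc.
  case: (pselect (r = w)) => [Er|nr]; first by rewrite Er in sr.
  have [|g gw ngr] := leave r nr; last by case: ngr; apply/sr/stabc.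
  by move=> b; apply: ne; rewrite (proj2 M w r v).
have acv : adj T (c w) (c v) by case: (proj1 M _ _ a).
have onlyc z : adj T (c w) z -> stab (c w) `<=` stab z -> z = c v.
  move=> az sz; apply: contrapT => nz.
  have [r cr H] := fix_fiber w z Cc.
  have nr : r <> w by move=> E; rewrite -E cr (tree_irr HT) in az.
  have [|g gw ngr] := leave r nr; last by apply: ngr; apply: H => //; apply/sz/stabc.
  move=> /(mono_btw HR HT M); rewrite cr /btw (dist_adj HT az) (dist_adj HT acv) => E.
  have /(dist0 HT) E0 : dist (adj T) (c v) z = 0%N by lia.
  by apply: nz.
have up : stab (c w) `<=` stab (c v) by move=> g /eqs/sv gv; rewrite /stab /= -collapse_equiv // gv.
(* If [c v = t (c w)], the edge is an ascending loop, so the stabilizers are equal. Then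
   [t^-1 (c w)] is also fixed by the stabilizer of [c w], hence equals [c v], and [t] inverts the
   edge. *)
split => // t E; have avt : adj T (c w) (act T t (c w)) by rewrite -E.
have upt : stab (c w) `<=` stab (act T t (c w)) by rewrite -E.
have down := no_ascending_loop fgG admA AD ID DT UT avt upt.
have E' : act T t^-1 (c w) = c v.
  apply: onlyc; first by rewrite -(gtree_act_adj t) actVK (tree_sym HT).
  move=> g gw; apply/stab_conj; rewrite invgK; apply: down; apply/stab_conj.
  by rewrite -!mulgA mulKg mulVg mulg1.
apply: (gtree_noinv avt (g := t)); split => //.
by rewrite -E -E' actVK.
Qed.

(** An edge of the lcm survives in one of the two trees, and a collapsible one has collapsible image
    there. *)
Lemma lcm_core T1 T2 T (c1 : T -> T1) (c2 : T -> T2) : is_lcm c1 c2 -> core T1 -> core T2 -> core T.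
Proof.
move=> L K1 K2; have [[D1 U1 N1] [D2 U2 N2]] := (K1, K2); have [C1 C2 J] := L.
have DT := lcm_space admA L AD D1 D2.
split => //; first exact: (lcm_UC fgG admA L (core_not_fixed K1) (core_not_fixed K2)).
move=> w v bad; case: (pselect (c1 w = c1 v)) => [E1|n1]; last first.
  exact: (N1 _ _ (collapsible_image DT D1 U1 C1 n1 bad)).
case: (pselect (c2 w = c2 v)) => [E2|n2]; last first.
  exact: (N2 _ _ (collapsible_image DT D2 U2 C2 n2 bad)).
by have [a _ _ _] := bad; rewrite (J _ _ E1 E2) (tree_irr (gd T)) in a.
Qed.

Lemma core_ex T0 : D T0 -> universally_compatible A T0 -> exists T, core T.
Proof.
move=> D0 U0; pose P n := `[< exists T (l : seq (T * T)),
  [/\ D T, universally_compatible A T, edge_cover l & size l = n] >].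
have exP : exists n, P n.
  by have [l cl _] := edge_cover_ex T0; exists (size l); apply/asboolP; exists T0, l.
case: (ex_minnP exP) => n /asboolP[T [l [DT UT cl sl]]] mn; exists T; split => // w u bad.
have [T' [c [Cc dT' Ec]]] := collapse_edge bad; have M := collapse_monotone Cc.
have UT' := UC_collapse admA Cc UT.
have DT' : D T'.
  rewrite (A_deformation_spaceE AD DT); split; last exact: UT'.1.
  by split => //; exact: collapse_dominates Cc.
pose p := [pred e : T * T | c e.1 != c e.2].
pose l' := [seq (c e.1, c e.2) | e <- l & p e].
suff : (n <= size l')%N.
  rewrite size_map size_filter -sl -(count_predC p l) -{2}[count p l]addn0 leq_add2l leqn0.
  have [a _ _ _] := bad; have [e el [g E1 E2]] := cl _ _ a.
  rewrite eqn0Ngt -has_count => /hasPn /(_ e el); rewrite /= negbK => /negP; apply.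
  apply/eqP; apply: (@act_inj _ T' g); rewrite -!collapse_equiv //.
  by move: E1 E2 => /= <- <-.
apply: mn; apply/asboolP; exists T', l'; split => // x y a.
have [[x0 cx] [y0 cy]] := (collapse_surj Cc x, collapse_surj Cc y).
have [x1 [y1 [Ex Ey a1]]] := lift_adj (gd T) (gd T') M cx cy a.
have [e el [g /= E1 E2]] := cl _ _ a1; exists (c e.1, c e.2).
  apply/mapP; exists e => //; rewrite mem_filter el andbT /=; apply/eqP => E.
  by move: a; rewrite -Ex -Ey E1 E2 !collapse_equiv // E (tree_irr (gd T')).
by exists g; rewrite /= -collapse_equiv // -?E1 -?E2.
Qed.

End Spaces.
End Core.

(** * Bounding the number of orbits of edges *)

Section Count.
Variables (G : groupType).
Hypothesis fgG : finitely_generated G.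
Implicit Types T R S : gtree G.

(** Send [a] to the gate of [f a] on its fiber; uniqueness of gates gives equivariance. These are
    the roots of the fibers. *)
Lemma fiber_section T R (c : T -> R) : collapse_map c -> dominates R T ->
  exists2 s : R -> T, equivariant idfun s & forall a, c (s a) = a.
Proof.
move=> Cc [f ef]; have HT := gd T.
have ex a : exists p, c p = a /\ forall s, c s = a -> btw (adj T) (f a) p s.
  have [p h1 h2] := gate_ex HT (f a) (collapse_surj Cc a) (fiber_convex (collapse_monotone Cc) (u := a)).
  by exists p.
have [s sP] := choice ex; exists s => [g a|a]; last by have [] := sP a.
have [h1 h2] := sP a; have [h3 h4] := sP (act R g a).
apply: (gate_uniq HT (S := [set x | c x = act R g a]) (z := f (act R g a)) h3 _ h4).
  by rewrite /= collapse_equiv // h1.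
move=> x /= cx; rewrite -[act R g a]/(act R (idfun g) a) ef -(actVK g x); apply/act_btw/h2.
by rewrite collapse_equiv // cx actK.
Qed.

Section Bound.
Variables (R T : gtree G) (c : T -> R) (l0 : seq (R * R)).
Hypotheses (Cc : collapse_map c) (dRT : dominates R T)
  (nc : forall w u : T, ~ collapsible_edge w u)
  (cl0 : edge_cover l0) (al0 : forall e, e \in l0 -> adj R e.1 e.2).
Let HT := gd T.
Let M := collapse_monotone Cc.

(* With [n] orbits of vertices outside the section [s] and [N] the size of [l0], three edges at each
   of these vertices give [3 n <= 2 n + N]. *)
Lemma edge_count (l : seq (T * T)) : inequivalent (@edge_orbit G T) l ->
  (forall e, e \in l -> adj T e.1 e.2) -> (size l <= 3 * size l0)%N.
Proof.
have [s es cs] := fiber_section Cc dRT.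
pose root w := s (c w); have rootg g w : root (act T g w) = act T g (root w).
  by rewrite /root collapse_equiv // es.
have croot w : c (root w) = c w by rewrite /root cs.
pose W w := w <> root w.
have upE w : exists u, W w -> [/\ adj T w u, c u = c w & dist (adj T) w (root w) = (dist (adj T) u (root w)).+1].
  case: (pselect (W w)) => [Ww|nW]; last by exists w.
  have [u [h1 h2 h3]] := next_ex HT Ww; exists u => _; split => //.
  by apply: (proj2 M _ (root w)).
have [up upP] := choice upE.
have up_uniq w u : W w -> adj T w u -> (dist (adj T) u (root w) < dist (adj T) w (root w))%N -> u = up w.
  move=> Ww a d; have [a' _ d'] := upP w Ww.
  by apply: (closer_uniq HT (z := root w) a a'); rewrite !(dist_sym HT (root w)); lia.
have Wg g w : W w -> W (act T g w) by move=> Ww; rewrite /W rootg => /act_inj.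
have upg g w : W w -> up (act T g w) = act T g (up w).
  move=> Ww; have [a cu d] := upP w Ww; apply/esym/up_uniq; first exact: Wg.
    by rewrite gtree_act_adj.
  by rewrite rootg !act_dist d.
have nbE w : exists n : nat -> T, W w -> n 0%N = up w /\ (forall i, (i < 3)%N -> adj T w (n i)) /\
    forall g i j, stab w g -> (i < 3)%N -> (j < 3)%N -> act T g (n i) = n j -> i = j.
  case: (pselect (W w)) => [Ww|nW]; last by exists (fun=> w).
  have [a cu d] := upP w Ww.
  have sup : stab w `<=` stab (up w) by move=> g gw; rewrite /stab /= -upg // gw.
  (* If [g w = up w], then [g] fixes the common root, so it preserves the distance to the root,
     while [up w] is strictly closer. *)
  have nup g : up w <> act T g w.
    move=> E; have Ec : stab (root w) g.
      by rewrite /stab /= -rootg -E /root cu.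
    by move: d; rewrite E -{2}Ec act_dist; lia.
  (* [u1] exists because the edge to [up w] is not collapsible, [u2] because [w] is not redundant.
     The stabilizer of [w] fixes the first two neighbours, so the three edges are in distinct
     orbits. *)
  have [u1 [a1 s1 n1]] : exists u1, [/\ adj T w u1, stab w `<=` stab u1 & u1 <> up w].
    apply: contrapT => N; apply: (nc (w := w) (u := up w)); split => // z az sz.
    by apply: contrapT => nz; apply: N; exists z.
  have [u2 [a2 n2 n3]] : exists u2, [/\ adj T w u2, u2 <> up w & u2 <> u1].
    apply: contrapT => N; suff V2 : valence2 (adj T) w.
      have [g gP] := gtree_nonredundant V2.
      have /sup/gP E : stab w g by apply/gP.
      by rewrite E (tree_irr HT) in a.
    exists (up w), u1; split; first by apply/eqP => E; apply: n1.
    move=> z; apply/idP/idP => [az|/orP[]/eqP-> //].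
    apply: contrapT => /negP; rewrite negb_or => /andP[/eqP h1 /eqP h2].
    by apply: N; exists z.
  exists (fun i => if i is 0%N then up w else if i is 1%N then u1 else u2) => _; split => //; split.
    by case=> [|[|[|]]].
  move=> g i j gw; have g0 := sup _ gw; have g1 := s1 _ gw; rewrite /stab /= in g0 g1.
  case: i => [|[|[|]]] //; case: j => [|[|[|]]] // _ _; rewrite ?g0 ?g1 //.
  - by move=> E; case: n1.
  - by move=> E; case: n2.
  - by move=> E; case: n3.
  - by rewrite -{1}g0 => /act_inj E; case: n2.
  - by rewrite -{1}g1 => /act_inj E; case: n3.
have [nb nbP] := choice nbE.
have [orb orbP] := finite_orbits fgG T.
pose eqv (x y : T) := exists g, x = act T g y.
have eqv_sym x y : eqv x y -> eqv y x by move=> [g ->]; exists g^-1; rewrite actK.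
have [|||x Wx|L [[uL iL] PL cL]] := @transversal_list T eqv W orb.
- by move=> x; exists 1; rewrite gtree_act1.
- exact: eqv_sym.
- by move=> x y z [g ->] [h ->]; exists (g * h); rewrite gtree_actM.
- by have [g [y [yo E]]] := orbP x; exists y => //; exists g.
have liftE (e : R * R) : exists f : T * T, e \in l0 -> adj T f.1 f.2 /\ e = (c f.1, c f.2).
  case: (boolP (e \in l0)) => [el|_]; last by have [[p _] _ _ _ _] := HT; exists (p, p).
  case: e el => a b el; have [[x0 cx] [y0 cy]] := (collapse_surj Cc a, collapse_surj Cc b).
  have [x1 [y1 [Ex Ey a1]]] := lift_adj HT (gd R) M cx cy (al0 el).
  by exists (x1, y1) => _; rewrite /= Ex Ey.
have [lift liftP] := choice liftE.
(* Edges are oriented, so each edge of a fiber occurs in both directions; the others are lifted from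
   [R]. *)
pose l2 := [seq (w, up w) | w <- L] ++ [seq (up w, w) | w <- L] ++ [seq lift e | e <- l0].
have sl2 : size l2 = (size L + (size L + size l0))%N by rewrite !size_cat !size_map.
have cover : edge_cover l2.
  have upcase x y : W x -> y = up x -> exists2 w, w \in L & exists g, x = act T g w /\ y = act T g (up w).
    move=> Wx ->; have [w wL [g E]] := cL x Wx; exists w => //; exists g; split => //.
    by rewrite E upg //; exact: PL.
  move=> x y a; case: (pselect (c x = c y)) => [E|ne].
    have rxy : root x = root y by rewrite /root E.
    have [d|d] := adj_step HT (root x) a.
      have Wy : W y by move=> k; rewrite rxy -k distxx in d.
      have Ex : x = up y.
        apply: up_uniq => //; first by rewrite (tree_sym HT).
        by rewrite -rxy !(dist_sym HT _ (root x)) d.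
      have [w wL [g [E1 E2]]] := upcase y x Wy Ex; exists (up w, w); last by exists g.
      by rewrite !mem_cat; apply/or3P; constructor 2; apply/mapP; exists w.
    have Wx : W x by move=> k; rewrite -k distxx in d.
    have Ey : y = up x.
      by apply: up_uniq => //; rewrite !(dist_sym HT _ (root x)) d.
    have [w wL [g [E1 E2]]] := upcase x y Wx Ey; exists (w, up w); last by exists g.
    by rewrite !mem_cat; apply/or3P; constructor 1; apply/mapP; exists w.
  case: (proj1 M _ _ a) => // ac; have [e el [g /= E1 E2]] := cl0 ac.
  have [af Ee] := liftP e el; exists (lift e).
    by rewrite !mem_cat; apply/or3P; constructor 3; exact: map_f.
  have ag : adj T (act T g (lift e).1) (act T g (lift e).2) by rewrite gtree_act_adj.
  have [F1 F2] : x = act T g (lift e).1 /\ y = act T g (lift e).2.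
    have Ee1 : e.1 = c (lift e).1 by exact: (congr1 fst Ee).
    have Ee2 : e.2 = c (lift e).2 by exact: (congr1 snd Ee).
    have Ex : c x = c (act T g (lift e).1) by rewrite collapse_equiv // E1 Ee1.
    have Ey : c y = c (act T g (lift e).2) by rewrite collapse_equiv // E2 Ee2.
    by apply: (lift_uniq HT M a ag).
  by exists g.
have szL : (3 * size L <= size l2)%N.
  pose l1 := [seq (w, i) | w <- L, i <- iota 0 3].
  have i3 i : i \in iota 0 3 -> (i < 3)%N by rewrite mem_iota.
  have <- : size l1 = (3 * size L)%N by rewrite size_allpairs mulnC.
  apply: (size_le_inj (r := fun wi e => edge_orbit e (wi.1, nb wi.1 wi.2))).
  - by apply: allpairs_uniq => // -[? ?] [? ?].
  - move=> _ /allpairsP[[w i] /= [wL il ->]]; apply: cover.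
    have [_ [+ _]] := nbP w (PL w wL); apply; exact: i3.
  - move=> _ _ e /allpairsP[[w i] /= [wL il ->]] /allpairsP[[w' i'] /= [wL' il' ->]].
    move=> [g /= E1 E2] [g' /= E1' E2'].
    have Eww : w' = act T (g' * g^-1) w by rewrite gtree_actM E1 actK.
    have E : w = w' by apply/esym/iL => //; exists (g' * g^-1).
    rewrite -E in Eww E2' *; congr pair; have [_ [_ H]] := nbP w (PL w wL).
    apply: (H (g' * g^-1)); first exact: (esym Eww).
    + exact: i3.
    + exact: i3.
    + by rewrite gtree_actM E2 actK -E2'.
move=> [ul il] al.
suff : (size l <= size l2)%N by rewrite sl2 in szL *; lia.
apply: (size_le_inj (r := fun e f => edge_orbit f e)) => //; first by move=> [x y] /al /cover.
by move=> x y e xl yl h h'; apply: il => //; apply: orbit_trans (orbit_sym h) h'.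
Qed.

End Bound.

(** * The greatest tree for refinement *)

Section Greatest.
Variables (A : set (set G)) (D : gtree G -> Prop).
Hypotheses (admA : admissible_family A) (AD : A_deformation_space A D) (ID : irreducible_space D).

Lemma collapse_injective T R (c : T -> R) : collapse_map c ->
  (forall x y, adj T x y -> c x <> c y) -> injective c.
Proof.
move=> Cc H x y E; apply: contrapT => ne; have [x' [e b _]] := next_ex (gd T) ne.
by apply: (H _ _ e); rewrite (proj2 (collapse_monotone Cc) _ _ _ E b).
Qed.

(** Among the trees of the class refining a fixed [R], take one with most inequivalent edges. Its
    lcm with [T'] is in the class and still refines [R]; an edge collapsed by [c1] would increase
    the count, so [c1] is injective and [c2] factors through it. *)
Lemma core_greatest : (exists T, core A D T) ->
  exists2 T, core A D T & forall T', core A D T' -> exists c : T -> T', collapse_map c.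
Proof.
move=> [R cR]; have [l0 cl0 al0] := edge_cover_ex fgG R.
pose P n := `[< exists T (c : T -> R) (l : seq (T * T)), [/\ core A D T, collapse_map c,
  inequivalent (@edge_orbit G T) l, forall e, e \in l -> adj T e.1 e.2 & size l = n] >].
have Pub n : P n -> (n <= 3 * size l0)%N.
  move=> /asboolP[T [c [l [[DT _ nT] Cc il al <-]]]]; apply: (edge_count Cc) => //.
  by have [DR _ _] := cR; exact: (space_dominates_each AD DR DT).
have P0 : exists n, P n.
  have nil_inequiv : inequivalent (@edge_orbit G R) [::] by split => // x y; rewrite in_nil.
  by exists 0%N; apply/asboolP; exists R, id, [::]; split => //; exact: collapse_id.
case: (ex_maxnP P0 Pub) => n /asboolP[T [c [l [cT Cc [ul il] al sl]]]] mx.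
exists T => // T' cT'; have [[_ UT _] [_ UT' _]] := (cT, cT').
have [S [c1 [c2 L]]] := lcm_ex (UC_compatible UT UT').
have cS := lcm_core fgG admA AD ID L cT cT'; have [C1 C2 _] := L.
have M := collapse_monotone C1.
have inj1 : injective c1.
  apply: (collapse_injective C1) => x y a E.
  have liftE (e : T * T) : exists f : S * S, e \in l -> adj S f.1 f.2 /\ (c1 f.1, c1 f.2) = e.
    case: (boolP (e \in l)) => [el|_]; last by exists (x, x).
    case: e el => u v el; have [[x0 cx] [y0 cy]] := (collapse_surj C1 u, collapse_surj C1 v).
    have [x1 [y1 [Ex Ey a1]]] := lift_adj (gd S) (gd T) M cx cy (al _ el).
    by exists (x1, y1) => _; rewrite /= Ex Ey.
  have [lift liftP] := choice liftE.
  have orb e f : e \in l -> f \in l -> edge_orbit (lift e) (lift f) -> e = f.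
    move=> el fl [g E1 E2]; apply: il => //; have [_ <-] := liftP e el; have [_ <-] := liftP f fl.
    by exists g; rewrite /= -collapse_equiv // ?E1 ?E2.
  have nxy e : e \in l -> ~ edge_orbit (x, y) (lift e).
    move=> el [g /= E1 E2]; have [_ Ee] := liftP e el; have := al e el; rewrite -Ee /= E1 E2.
    by rewrite !collapse_equiv // E (tree_irr (gd T)).
  suff /mx : P n.+1 by rewrite ltnn.
  apply/asboolP; exists S, (c \o c1), ((x, y) :: map lift l); split => //.
  - exact: collapse_comp.
  - split.
      rewrite /= map_inj_in_uniq ?ul ?andbT.
        apply/negP => /mapP[e el Exy]; apply: (nxy e el); rewrite Exy; exact: orbit_refl.
      by move=> e f el fl Ef; apply: orb => //; rewrite Ef; exact: orbit_refl.
    move=> e f; rewrite !inE => /orP[/eqP->|/mapP[e' el ->]] /orP[/eqP->|/mapP[f' fl ->]] // h.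
    + by case: (nxy f' fl).
    + by case: (nxy e' el); exact: orbit_sym.
    + by rewrite (orb e' f').
  - by move=> e; rewrite inE => /orP[/eqP-> //|/mapP[e' el ->]]; have [] := liftP e' el.
  - by rewrite /= size_map sl.
have [c' Cc' _] := collapse_factor C1 C2 (fun x y E => congr1 c2 (inj1 x y E)).
by exists c'.
Qed.

End Greatest.
End Count.

(** * Transport along isomorphisms and the canonical tree *)

Lemma GTree_congr (G : groupType) (V : choiceType) (e : rel V) (ac ac' : G -> V -> V) p1 p2 p3 p4 p5 p6 p7
    q2 q3 q4 q5 q6 q7 : ac = ac' ->
  @GTree G V e ac p1 p2 p3 p4 p5 p6 p7 = @GTree G V e ac' p1 q2 q3 q4 q5 q6 q7.
Proof.
move=> E; subst ac'.
by rewrite (Prop_irrelevance p2 q2) (Prop_irrelevance p3 q3) (Prop_irrelevance p4 q4)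
  (Prop_irrelevance p5 q5) (Prop_irrelevance p6 q6) (Prop_irrelevance p7 q7).
Qed.

Section Pull.
Variables (G G' : groupType) (a : G -> G') (b : G' -> G).
Hypotheses (aM : {morph a : x y / x * y}) (ba : cancel b a).

Section PullTree.
Variable T : gtree G'.

Definition pull_act g (x : T) := act T (a g) x.

Lemma pull_act1 x : pull_act 1 x = x.
Proof.
have E : a 1 = 1 by apply: (mulgI (a 1)); rewrite -aM !mulg1.
by rewrite /pull_act E gtree_act1.
Qed.
Lemma pull_actM g h x : pull_act (g * h) x = pull_act g (pull_act h x).
Proof. by rewrite /pull_act aM gtree_actM. Qed.
Lemma pull_act_adj g x y : adj T (pull_act g x) (pull_act g y) = adj T x y.
Proof. exact: gtree_act_adj. Qed.
Lemma pull_noinv g x y : adj T x y -> ~ (pull_act g x = y /\ pull_act g y = x).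
Proof. exact: gtree_noinv. Qed.
Lemma pull_minimal (S : set T) : S !=set0 -> connected (adj T) S ->
  (forall g x, S x -> S (pull_act g x)) -> S = setT.
Proof.
move=> S0 cS gS; apply: gtree_minimal => // g x Sx.
by rewrite -(ba g); exact: (gS (b g)).
Qed.
Lemma pull_nonredundant x : valence2 (adj T) x -> exists g, forall y, pull_act g y = y <-> y = x.
Proof. by move=> /gtree_nonredundant[g gP]; exists (b g) => y; rewrite /pull_act ba. Qed.

(** Restriction of the action along [a]. Vertices and adjacency are unchanged, so an isomorphism
    equivariant along [a] is by conversion an ordinary equivariant isomorphism onto the pulled back
    tree. *)
Definition pull : gtree G :=
  GTree (gtree_tree T) pull_act1 pull_actM pull_act_adj pull_noinv pull_minimal pull_nonredundant.

End PullTree.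

Lemma pull_equivariant (T1 T2 : gtree G') (f : T1 -> T2) :
  @equivariant G G idfun (pull T1) (pull T2) f <-> equivariant idfun f.
Proof.
split=> ef g x; last exact: ef (a g) x.
by rewrite -(ba g); exact: ef (b g) x.
Qed.

Lemma pull_dominates T1 T2 : dominates (pull T1) (pull T2) <-> dominates T1 T2.
Proof. by split=> -[f /pull_equivariant ef]; exists f. Qed.

Lemma pull_collapse (T1 T2 : gtree G') (f : T1 -> T2) :
  @collapse_map G (pull T1) (pull T2) f <-> collapse_map f.
Proof.
by split=> /collapseP[ef sf Mf]; apply/collapseP; split => //; exact/pull_equivariant.
Qed.

Lemma pull_irreducible T : irreducible T -> irreducible (pull T).
Proof.
move=> [nf ne nl]; split.
- by move=> [x fx]; apply: nf; exists x => g; rewrite -(ba g); exact: fx.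
- by move=> [r rr fr]; apply: ne; exists r => // g; rewrite -(ba g); exact: fr.
- by move=> [l ll fl]; apply: nl; exists l => // g; rewrite -(ba g); exact: fl.
Qed.

Lemma pull_collapsible (T : gtree G') (w u : T) : @collapsible_edge G (pull T) w u <-> collapsible_edge w u.
Proof.
have S (x y : T) : @stab G (pull T) x `<=` @stab G (pull T) y <-> stab x `<=` stab y.
  split=> h g; last exact: (h (a g)).
  by rewrite -(ba g); exact: (h (b g)).
split=> -[h1 h2 h3 h4]; split => //.
- exact/S.
- by move=> z az /S; exact: h3.
- by move=> g; rewrite -(ba g); exact: (h4 (b g)).
- exact/S.
- by move=> z az /S; exact: h3.
- by move=> g; exact: (h4 (a g)).
Qed.

End Pull.

(** An equality and not merely an isomorphism: any tree can be replaced by a pulled back one in any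
    predicate, see [pull_surj]. *)
Lemma pullK (G G' : groupType) (a : G -> G') (b : G' -> G) (aM : {morph a : x y / x * y})
    (bM : {morph b : x y / x * y}) (ab : cancel a b) (ba : cancel b a) (S : gtree G) :
  pull aM ba (pull bM ab S) = S.
Proof.
case: S => V e ac p1 p2 p3 p4 p5 p6 p7; apply: GTree_congr.
by apply/funext => g; apply/funext => x; rewrite /pull_act /= /pull_act /= ab.
Qed.

Section Transport.
Variables (G G' : groupType) (a : G -> G') (b : G' -> G).
Hypotheses (aM : {morph a : x y / x * y}) (bM : {morph b : x y / x * y})
  (ab : cancel a b) (ba : cancel b a).
Variables (A : set (set G)) (A' : set (set G')).
Hypothesis AA : forall K : set G', A' K <-> A (a @^-1` K).
Local Notation pl := (pull aM ba).
Local Notation ps := (pull bM ab).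

Lemma pull_surj (P : gtree G -> Prop) : (forall T', P (pl T')) -> forall T, P T.
Proof. by move=> H T; rewrite -(pullK aM bM ab ba T). Qed.

Lemma pull_A_tree T' : A_tree A (pl T') <-> A_tree A' T'.
Proof.
split=> H x y xy; first by apply/AA; exact: (H x y xy).
exact: (proj1 (AA (@edge_stabilizer G' T' x y)) (H x y xy)).
Qed.

Lemma pull_compatible T1 T2 : compatible (pl T1) (pl T2) <-> compatible T1 T2.
Proof.
split=> -[S]; last first.
  by move=> [f1 [f2 [C1 C2]]]; exists (pl S), f1, f2; split; exact/pull_collapse.
move: S; apply: pull_surj => S [f1 [f2 [/pull_collapse C1 /pull_collapse C2]]].
by exists S, f1, f2.
Qed.

Lemma pull_UC T' : universally_compatible A (pl T') <-> universally_compatible A' T'.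
Proof.
split=> -[/pull_A_tree AT U]; split => //.
- by move=> S /pull_A_tree /U /pull_compatible.
- by apply: pull_surj => S /pull_A_tree /U /pull_compatible.
Qed.

Lemma pull_space D : A_deformation_space A D -> A_deformation_space A' (D \o pl).
Proof.
move=> [T]; move: T; apply: pull_surj => T /pull_A_tree AT ->; exists T => //.
apply/funext => T' /=; apply/propext; rewrite /deformation_space.
split=> -[[h1 h2] h3]; (split; [split|]).
- by apply/(pull_dominates aM ba); exact: h1.
- by apply/(pull_dominates aM ba); exact: h2.
- exact/pull_A_tree.
- exact/pull_dominates.
- exact/pull_dominates.
- exact/pull_A_tree.
Qed.

Lemma pull_UC_space D : universally_compatible_space A D -> universally_compatible_space A' (D \o pl).
Proof.
move=> [AD [T DT UT]]; split; first exact: pull_space.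
by move: T DT UT; apply: pull_surj => T DT /pull_UC UT; exists T.
Qed.

Lemma pull_core D T' : core A D (pl T') <-> core A' (D \o pl) T'.
Proof.
split=> -[DT UT nT]; split => //; try exact/pull_UC.
  by move=> w u /(pull_collapsible aM ba); exact: nT.
by move=> w u /pull_collapsible; exact: nT.
Qed.

End Transport.

(** * The canonical tree and its isomorphisms *)

Section Canonical.

Lemma unit_minimal (G : groupType) (S : set unit) : S !=set0 ->
  connected (fun _ _ : unit => false) S -> (forall (g : G) x, S x -> S x) -> S = setT.
Proof. by move=> [[] S0] _ _; apply/seteqP; split => // -[]. Qed.

Lemma unit_tree : @simplicial_tree unit (fun _ _ => false).
Proof.
split => //; first by exists tt.
  by move=> [] [] _ _; exists [::].
by move=> [//|x [|y c]] // /andP[].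
Qed.

Definition point_gtree (G : groupType) : gtree G :=
  @GTree G unit (fun _ _ => false) (fun _ x => x) unit_tree (fun _ => erefl) (fun _ _ _ => erefl)
    (fun _ _ _ => erefl) (fun g x y (h : false) => False_ind _ (notF h)) (@unit_minimal G)
    (fun x h => ltac:(by case: h => -[] [[] []])).

(** [D] is quantified inside, so the property depends on [G] and [A] only and can be transported
    along isomorphisms of pairs. *)
Definition canonical (G : groupType) (A : set (set G)) (T : gtree G) := exists D,
  [/\ compatibility_JSJ_space A D, irreducible_space D, core A D T &
      forall T', core A D T' -> exists c : T -> T', collapse_map c].

Lemma canonical_pull (G G' : groupType) (a : G -> G') (b : G' -> G)
    (aM : {morph a : x y / x * y}) (bM : {morph b : x y / x * y}) (ab : cancel a b) (ba : cancel b a)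
    (A : set (set G)) (A' : set (set G')) :
  (forall K : set G', A' K <-> A (a @^-1` K)) -> forall T, canonical A T -> canonical A' (pull bM ab T).
Proof.
move=> AA; have AA' (H : set G) : A H <-> A' (b @^-1` H).
  rewrite AA; suff -> : a @^-1` (b @^-1` H) = H by [].
  by apply/seteqP; split => g; rewrite /= ab.
apply: (@pull_surj _ _ _ _ aM bM ab ba (fun T => canonical A T -> canonical A' (pull bM ab T))).
move=> T [D [[[AD [T0 D0 U0]] mD] [T1 D1 I1] cT gT]].
rewrite pullK; exists (D \o pull aM ba); split.
- split; first by apply: (pull_UC_space aM bM ab ba AA); split => //; exists T0.
  move=> D' UD' dD'; suff <- : D' \o pull bM ab = D.
    by apply/funext => T' /=; rewrite pullK.
  apply: mD; first exact: (pull_UC_space bM aM ba ab AA').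
  apply: (@pull_surj _ _ _ _ aM bM ab ba) => S; apply: (@pull_surj _ _ _ _ aM bM ab ba) => S' /=.
  rewrite pullK => D'S DS'.
  by apply/pull_dominates; exact: dD'.
- exists (pull bM ab T1); first by rewrite /= pullK.
  exact: pull_irreducible.
- exact/(pull_core aM bM ab ba AA).
- by move=> T' /(pull_core aM bM ab ba AA) /gT[c /pull_collapse Cc]; exists c.
Qed.

Variable G : groupType.
Hypothesis fgG : finitely_generated G.
Variable A : set (set G).
Hypothesis admA : admissible_family A.

Lemma canonical_ex D : compatibility_JSJ_space A D -> irreducible_space D -> exists T, canonical A T.
Proof.
move=> JD ID; have [[AD [T0 D0 U0]] _] := JD.
have [T cT gT] := core_greatest fgG admA AD ID (core_ex fgG admA AD D0 U0).
by exists T, D.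
Qed.

Lemma canonical_space D T : compatibility_JSJ_space A D -> irreducible_space D -> canonical A T -> D T.
Proof.
by move=> JD ID [D' [JD' ID' [DT _ _] _]]; rewrite (JSJ_uniq fgG admA JD ID JD' ID').
Qed.

Lemma canonical_not_fixed T : canonical A T -> ~ fixed_point T.
Proof. by move=> [D [[[AD _] _] ID cT _]]; exact: (core_not_fixed AD ID cT). Qed.

(** Greatest elements collapse onto each other; both composites are identities by uniqueness of
    collapse maps. *)
Lemma canonical_uniq T T' : canonical A T -> canonical A T' ->
  exists f : T -> T', equivariant_iso idfun f.
Proof.
move=> /[dup] /canonical_not_fixed nf [D [JD ID cT gT]].
move=> /[dup] /canonical_not_fixed nf' [D' [JD' ID' cT' gT']].
have ED := JSJ_uniq fgG admA JD ID JD' ID'; subst D'.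
have [[c Cc] [d Cd]] := (gT _ cT', gT' _ cT).
have dc := collapse_uniq fgG nf (collapse_comp Cc Cd) (collapse_id T).
have cd := collapse_uniq fgG nf' (collapse_comp Cd Cc) (collapse_id T').
exists c; apply: collapse_bij_iso => //; exists d => x.
  exact: (congr1 (fun f => f x) dc).
exact: (congr1 (fun f => f x) cd).
Qed.

Lemma iso_uniq (T T' : gtree G) (f f' : T -> T') : ~ fixed_point T' ->
  equivariant_iso idfun f -> equivariant_iso idfun f' -> f = f'.
Proof. by move=> nf /iso_collapse Cf /iso_collapse Cf'; exact: (collapse_uniq fgG nf Cf Cf'). Qed.

End Canonical.

(** An arbitrary choice for each pair, with the one-point tree as default when no canonical tree
    exists. *)
Definition canonical_tree (G : groupType) (A : set (set G)) : gtree G :=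
  if pselect (exists T, canonical A T) is left h then projT1 (cid h) else point_gtree G.

Lemma canonical_treeP (G : groupType) (A : set (set G)) :
  (exists T, canonical A T) -> canonical A (canonical_tree A).
Proof. by move=> h; rewrite /canonical_tree; case: pselect => // h'; case: cid. Qed.

Lemma canonical_tree_iso (G G' : groupType) (A : set (set G)) (A' : set (set G')) D
    (alpha : {multiplicative G -> G'}) : finitely_generated G -> admissible_family A ->
  compatibility_JSJ_space A D -> irreducible_space D -> bijective alpha -> family_image alpha A = A' ->
  exists! f : canonical_tree A -> canonical_tree A', equivariant_iso alpha f.
Proof.
move=> fgG admA JD ID [b ab ba] EA.
have aM : {morph alpha : x y / x * y} by move=> x y; exact: gmulfM.
have bM : {morph b : x y / x * y} by exact: (can2_gmulfM ab ba).
have AA (K : set G') : A' K <-> A (alpha @^-1` K).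
  rewrite -EA; split=> [[H AH <-]|AK].
    suff -> : alpha @^-1` (alpha @` H) = H by [].
    by apply/seteqP; split => [g [h Hh /(can_inj ab) <-]|g Hg] //; exists g.
  exists (alpha @^-1` K) => //; apply/seteqP; split => [_ [g Kg <-] //|g' Kg'].
  by exists (b g') => /=; rewrite ?ba.
have AA' (H : set G) : A H <-> A' (b @^-1` H).
  rewrite AA; suff -> : alpha @^-1` (b @^-1` H) = H by [].
  by apply/seteqP; split => g; rewrite /= ab.
have K := canonical_treeP (canonical_ex fgG admA JD ID).
(* The hypotheses are stated for [(G, A)]; existence for [(G', A')] comes by transport. The tree
   chosen there is then pulled back to [G], where the comparison takes place. *)
have K' : canonical A' (canonical_tree A').
  by apply: canonical_treeP; exists (pull bM ab (canonical_tree A)); exact: (canonical_pull aM bM ab ba AA K).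
have K2 := canonical_pull bM aM ba ab AA' K'.
have [f isof] := canonical_uniq fgG admA K K2.
exists f; split => // f' isof'.
exact: (iso_uniq fgG (canonical_not_fixed K2) isof isof').
Qed.

Theorem theorem10 :
  exists Tco : forall G : groupType, set (set G) -> gtree G,
    [/\ forall (G : groupType) (A : set (set G)) (D : gtree G -> Prop),
          finitely_generated G -> admissible_family A ->
          compatibility_JSJ_space A D -> irreducible_space D ->
          D (Tco G A),
        forall (G G' : groupType) (A : set (set G)) (A' : set (set G'))
               (D : gtree G -> Prop) (alpha : {multiplicative G -> G'}),
          finitely_generated G -> admissible_family A ->
          compatibility_JSJ_space A D -> irreducible_space D ->
          bijective alpha -> family_image alpha A = A' ->
          exists! f : Tco G A -> Tco G' A', equivariant_iso alpha f
      & forall (G : groupType) (A : set (set G)) (D : gtree G -> Prop),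
          finitely_generated G -> admissible_family A ->
          compatibility_JSJ_space A D -> irreducible_space D ->
          (forall alpha : {multiplicative G -> G},
             bijective alpha -> family_image alpha A = A) ->
          forall alpha : {multiplicative G -> G},
            bijective alpha -> invariant_under alpha (Tco G A)].
Proof.
exists (@canonical_tree); split.
- move=> G A D fgG admA JD ID; apply: (canonical_space fgG admA JD ID).
  exact: canonical_treeP (canonical_ex fgG admA JD ID).
- by move=> G G' A A' D alpha; exact: canonical_tree_iso.
- move=> G A D fgG admA JD ID inv alpha ba.
  by have [f [isof _]] := canonical_tree_iso fgG admA JD ID ba (inv alpha ba); exists f.
Qed.
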